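(* Let $d\in\mathbb N$, $z\in\mathbb R^d$. For $\beta\in(0,1)$ let $$X^{\beta,z}_t:=z+\sqrt\beta\int_0^t\Big(\frac ts\Big)^{\frac{1-\beta}2}dW_s,\quad t>0,\qquad X^{\beta,z}_0:=z,$$ where $W$ is a standard $d$-dimensional Brownian motion, and let $X^{0,z}_t:=z+\eta\sqrt t$, $t\ge0$, where $\eta$ is an $\mathbb R^d$-valued random variable with $\mathcal L(\eta)=\mathcal N(0,1_d)$. Then, for every $\beta\in(0,1)$, $X^{\beta,z}\in C^{1/2-}$ almost surely, and $\lim_{\beta\to0}X^{\beta,z}=X^{0,z}$ in distribution on $[0,T]$ for all $T>0$.
   Context: $C^{1/2-}$ means $\alpha$-Hölder continuous on $[0,T]$ for every $T>0$ and every $\alpha<\tfrac12$. Convergence in distribution on $[0,T]$ is weak convergence of the laws on $C([0,T];\mathbb R^d)$ with the uniform topology. $\mathcal N(0,1_d)$ is the standard normal distribution on $\mathbb R^d$. *)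

(* Defs.v *)
From HB Require Import structures.
From mathcomp Require Import all_boot all_order all_algebra.
From mathcomp Require Import all_classical all_reals all_analysis.

Set Implicit Arguments.
Unset Strict Implicit.
Unset Printing Implicit Defensive.

Import Order.TTheory GRing.Theory Num.Theory.
Import numFieldNormedType.Exports.

Local Open Scope classical_set_scope.
Local Open Scope ring_scope.

(* R^d is 'rV[R]_d.  A process with time set [0, +oo[ is a function of a real
   time variable; its values at negative times are never used. *)

Section gaussian_and_brownian.
Context {R : realType} {d : nat} {dOmega : measure_display}
  {Omega : measurableType dOmega} (P : probability Omega R).

Definition random_vector (Y : Omega -> 'rV[R]_d) : Prop :=
  forall i, measurable_fun setT (fun w => Y w ord0 i).

(* N(0, s^2 1_d), that is, the d-fold product of N(0, s^2); normal_prob takes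
   the standard deviation, and is not the Dirac mass when s = 0. *)
Definition centered_normal (s : R) (Y : Omega -> 'rV[R]_d) : Prop :=
  random_vector Y /\
  forall B : 'I_d -> set R, (forall i, measurable (B i)) ->
    P [set w | forall i, B i (Y w ord0 i)] =
    (\prod_(i < d) normal_prob 0 s (B i))%E.

(* The library puts a Borel structure on d.-tuple R but not on 'rV[R]_d. *)
Definition borel_tuple (v : 'rV[R]_d) : d.-tuple (measurableTypeR R) :=
  [tuple v ord0 i | i < d].

(* Taking some B k := setT gives the product rule for subfamilies. *)
Definition mutually_independent (n : nat) (Y : 'I_n -> Omega -> 'rV[R]_d) : Prop :=
  forall B : 'I_n -> set (d.-tuple (measurableTypeR R)),
    (forall k, measurable (B k)) ->
    P [set w | forall k, B k (borel_tuple (Y k w))] =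
    (\prod_(k < n) P [set w | B k (borel_tuple (Y k w))])%E.

Record standard_brownian_motion (W : R -> Omega -> 'rV[R]_d) : Prop := {
  brownian_random_vector : forall t, 0 <= t -> random_vector (W t);
  brownian_start : {ae P, forall w, W 0 w = 0};
  brownian_independent_increments : forall (n : nat) (t : nat -> R),
    0 <= t 0%N -> (forall k, (k < n)%N -> t k <= t k.+1) ->
    mutually_independent
      (fun (k : 'I_n) w => W (t k.+1) w - W (t k) w);
  brownian_normal_increments : forall s t, 0 <= s -> s < t ->
    centered_normal (Num.sqrt (t - s)) (fun w => W t w - W s w);
  brownian_continuous :
    {ae P, forall w, {within `[0, +oo[, continuous (fun t => W t w)}}
}.

End gaussian_and_brownian.

Section wiener_integral.
Context {R : realType} {dOmega : measure_display}
  {Omega : measurableType dOmega} (P : probability Omega R).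

(* The list p of triples (a, u, v) encodes the step function
   \sum a 1_{]u, v]}; the intervals may overlap. *)
Definition step_fun (p : seq (R * R * R)) (s : R) : R :=
  \sum_(j <- p) j.1.1 * \1_(`]j.1.2, j.2]) s.

Definition steps_within (t : R) (p : seq (R * R * R)) : bool :=
  all (fun j => [&& 0 <= j.1.2, j.1.2 <= j.2 & j.2 <= t]) p.

Definition step_integral (w : R -> Omega -> R) (p : seq (R * R * R)) (o : Omega) : R :=
  \sum_(j <- p) j.1.1 * (w j.2 o - w j.1.2 o).

(* Y = \int_0^t f dw almost surely, for a deterministic f in L^2([0, t]): the
   L^2(P)-limit of the integrals of step functions converging to f in
   L^2([0, t]).  By the isometry, Y does not depend on the approximating
   sequence, up to almost sure equality. *)
Definition is_wiener_integral (w : R -> Omega -> R) (t : R) (f : R -> R)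
    (Y : Omega -> R) : Prop :=
  [/\ measurable_fun `[0, t] f, measurable_fun setT Y &
   exists p : nat -> seq (R * R * R),
    [/\ forall n, steps_within t (p n),
        (\int[lebesgue_measure]_(s in `[0%R, t])
           ((step_fun (p n) s - f s) ^+ 2)%:E)%E @[n --> \oo] --> 0%E &
        (\int[P]_o ((step_integral w (p n) o - Y o) ^+ 2)%:E)%E
           @[n --> \oo] --> 0%E]].

(* For each t, the integral \int_0^t k t s dW_s is only defined up to almost
   sure equality; as usual, the process t |-> \int_0^t k t s dW_s, t > 0, is
   the version with continuous paths on ]0, +oo[, which is unique up to
   indistinguishability.  Nothing is imposed as t tends to 0.  (The default
   value 0 is taken only if there is no such version.) *)
Definition is_wiener_process_integral {d : nat} (W : R -> Omega -> 'rV[R]_d)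
    (k : R -> R -> R) (I : R -> Omega -> 'rV[R]_d) : Prop :=
  (forall t, 0 < t -> forall i,
     is_wiener_integral (fun s w => W s w ord0 i) t (k t)
       (fun w => I t w ord0 i)) /\
  (forall w, {within `]0, +oo[, continuous (fun t => I t w)}).

Definition wiener_process_integral {d : nat} (W : R -> Omega -> 'rV[R]_d)
    (k : R -> R -> R) : R -> Omega -> 'rV[R]_d :=
  xget (fun _ _ => 0) [set I | is_wiener_process_integral W k I].

Definition Xbeta {d : nat} (W : R -> Omega -> 'rV[R]_d) (z : 'rV[R]_d) (beta : R)
    (t : R) (w : Omega) : 'rV[R]_d :=
  if 0 < t then
    z + Num.sqrt beta *:
      wiener_process_integral W
        (fun t s => (t / s) `^ ((1 - beta) / 2)) t w
  else z.

End wiener_integral.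

Definition Xzero {R : realType} {d : nat} {Omega : Type} (eta : Omega -> 'rV[R]_d)
    (z : 'rV[R]_d) (t : R) (w : Omega) : 'rV[R]_d :=
  z + Num.sqrt t *: eta w.

Definition holder_half_minus {R : realType} {d : nat}
    (x : R -> 'rV[R]_d) : Prop :=
  forall T : R, 0 < T -> forall alpha : R, 0 < alpha -> alpha < 1 / 2 ->
    exists C : R, forall s t : R, s \in `[0, T] -> t \in `[0, T] ->
      `|x t - x s| <= C * `|t - s| `^ alpha.

(* C([0, T]; R^d), as a set of functions carrying the topology of uniform
   convergence on [0, T]; functions agreeing on [0, T] are topologically
   indistinguishable, so that a continuous functional depends only on the
   restriction to [0, T]. *)
Definition path_space {R : realType} {d : nat} (T : R) :
    set {uniform` `[0, T] -> 'rV[R]_d} :=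
  [set x : R -> 'rV[R]_d | {within `[0, T], continuous x}].
Arguments path_space {R d} T _.

(* Weak convergence on C([0, T]; R^d) of the laws of the processes X b, as b
   tends to the limit described by the filter F, to the law of Y.  The paths
   are meant to be almost surely continuous on [0, T]: the values of Phi
   outside path_space T contribute to a null set only. *)
Definition cvg_in_distribution_on {R : realType} {d : nat} (T : R)
    {dOmega : measure_display} {Omega : measurableType dOmega} (P : probability Omega R)
    (X : R -> R -> Omega -> 'rV[R]_d) (F : set_system R)
    {dOmega' : measure_display} {Omega' : measurableType dOmega'} (P' : probability Omega' R)
    (Y : R -> Omega' -> 'rV[R]_d) : Prop :=
  forall Phi : {uniform` `[0, T] -> 'rV[R]_d} -> R,
    {within path_space T, continuous Phi} ->
    (exists M : R, forall x, path_space T x -> `|Phi x| <= M) ->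
    ('E_P[fun w => Phi (fun t => X b t w)])%E @[b --> F] -->
    ('E_P'[fun w => Phi (fun t => Y t w)])%E.

(* Main.v *)
Require Import Defs.
From HB Require Import structures.
From mathcomp Require Import all_boot all_order all_algebra.
From mathcomp Require Import all_classical all_reals all_analysis.
From mathcomp Require Import measurable_realfun ring lra.

(** Write a = (1 - beta) / 2, so that 0 < a < 1/2.

The integral of (t / s)^a against W over [0, t] is first built path by path,
as the limit, along N = 2^m, of the sums of the increments of W over the N
equal cells of [0, t], each weighted by the kernel at the right end of its
cell.  On a g-Hoelder path, refining N cells into 2 N moves such a sum by at
most a constant times N^(a - g), because the changes of the weights telescope
([wsum_double]); Brownian paths are g-Hoelder for every g < 1/2 by Kolmogorov's
argument ([dyadic_increments_bound], [dyadic_hoelder]), so any g between a and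
1/2 gives convergence.  To compare two times t and s, rescale both to [0, 1]: the
path u |-> w (t u) - w (s u) is at most C |t - s|^g u^g, and summation by parts
bounds its weighted sum by that of u^g ([wsum_le_powR]), whence the limit is
g-Hoelder in t ([fractional_integral_hoelder]).  By the isometry and Fatou's
lemma, for each t it is a Wiener integral ([wiener_integral_of_ae_limit]);
Wiener integrals are almost surely unique, and so are continuous versions.
Hence X^beta coincides almost surely, at all times, with the pathwise
construction ([ae_XbetaE]), which proves the Hoelder statement.

For the convergence, t^(- a) (X^beta_t - z) is the integral of
sqrt beta s^(- a) against W, a Gaussian process with independent increments
and variance beta times the integral of s^(beta - 1), that is t^beta.
So X^beta has the law of t |-> z + t^a B (t^beta) for a Brownian motion B
started at 0.  The proof uses discrete sums: the increments of W, multiplied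
by their weights, are jointly distributed as the increments of W along a
deterministic clock ([increments_same_law]), and this clock is a Riemann sum
converging to t^beta ([clock_grid_cvg], [grid_law_eq]).  Expectations of a
bounded continuous functional of the path only depend on the joint laws at
finitely many times, by interpolation on finer and finer grids
([path_law_eq]).

The processes z + t^a B (t^beta) all live on one probability space, and there
the limit beta -> 0 is taken path by path: uniformly on [0, T], they tend to
z + sqrt t B 1 ([rescaled_cvg]), since both sides are small for small t and
t^beta tends to 1 uniformly away from 0.  Bounded convergence transfers this
to expectations, and B 1 has the law of eta. *)

Set Implicit Arguments.
Unset Strict Implicit.
Unset Printing Implicit Defensive.

Import Order.TTheory GRing.Theory Num.Theory.
Import numFieldNormedType.Exports.

Local Open Scope classical_set_scope.
Local Open Scope ring_scope.

(** * Weighted sums of the increments of a Hoelder function *)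

Section wsum.
Context {R : realType}.
Implicit Types (a g C D : R) (v h w : R -> R) (N m n : nat).

(** The approximation of the integral of u^(- a) dv over [0, 1] on N equal
    cells, with the kernel evaluated at the right end of each cell, so that
    the singularity at 0 is never met. *)
Definition wsum a N v : R :=
  \sum_(i < N) (N%:R / i.+1%:R) `^ a * (v (i.+1%:R / N%:R) - v (i%:R / N%:R)).

Lemma sum_double (F : nat -> R) N :
  \sum_(i < N.*2) F i = \sum_(i < N) (F i.*2 + F i.*2.+1).
Proof.
elim: N => [|N IH]; first by rewrite !big_ord0.
by rewrite doubleS !big_ord_recr /= IH addrA.
Qed.

Lemma sum_antitone_gaps (c : nat -> R) N :
  (forall i, (i < N.*2)%N -> c i.+1 <= c i) ->
  \sum_(i < N) (c i.*2 - c i.*2.+1) <= c 0%N - c N.*2.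
Proof.
elim: N => [|N IH] hc; first by rewrite big_ord0 subrr.
rewrite big_ord_recr /=.
have := IH (fun i hi => hc i (ltn_trans hi _)); rewrite doubleS.
move=> /(_ (ltac:(by []))) H.
have := hc N.*2.+1; rewrite doubleS ltnS leqnn => /(_ isT).
by move: H; lra.
Qed.

(** Merging two half cells only replaces the weight of the left half by
    that of the right half.  The resulting differences of weights are
    nonnegative and their sum telescopes to at most the first weight,
    (2 N)^a. *)
Lemma wsum_double a N v D : 0 <= a -> (0 < N)%N ->
  (forall i, (i < N)%N ->
    `|v (i.*2.+1%:R / N.*2%:R) - v (i.*2%:R / N.*2%:R)| <= D) ->
  `|wsum a N.*2 v - wsum a N v| <= D * N.*2%:R `^ a.
Proof.
move=> a0 N0 hD.
pose c i : R := (N.*2%:R / i.+1%:R) `^ a.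
have c_ge0 i : 0 <= c i by exact: powR_ge0.
have c_mono i : c i.+1 <= c i.
  rewrite /c; apply: ge0_ler_powR => //; rewrite ?nnegrE ?divr_ge0//.
  by rewrite ler_wpM2l// lef_pV2 ?posrE ?ltr0n// ler_nat.
have N20 : N%:R != 0 :> R by rewrite pnatr_eq0 -lt0n.
have half i : i.*2%:R / N.*2%:R = i%:R / N%:R :> R.
  by rewrite -!muln2 !natrM -mulf_div divff ?mulr1// pnatr_eq0.
have halfc i : c i.*2.+1 = (N%:R / i.+1%:R) `^ a.
  by rewrite /c -doubleS -!muln2 !natrM -mulf_div divff ?mulr1// pnatr_eq0.
have -> : wsum a N.*2 v - wsum a N v =
  \sum_(i < N) (c i.*2 - c i.*2.+1) *
     (v (i.*2.+1%:R / N.*2%:R) - v (i.*2%:R / N.*2%:R)).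
  rewrite {1}/wsum (sum_double (fun i => (N.*2%:R / i.+1%:R) `^ a *
   (v (i.+1%:R / N.*2%:R) - v (i%:R / N.*2%:R)))).
  rewrite /wsum -sumrB; apply: eq_bigr => i _.
  rewrite -/(c _) -/(c _) -halfc -[i.+1%:R / N%:R]half -[i%:R / N%:R]half doubleS.
  by ring.
apply: (le_trans (ler_norm_sum _ _ _)).
apply: (@le_trans _ _ (\sum_(i < N) (c i.*2 - c i.*2.+1) * D)).
  apply: ler_sum => i _; rewrite normrM ger0_norm ?subr_ge0//.
  by rewrite ler_wpM2l ?subr_ge0//; exact: hD.
rewrite -mulr_suml mulrC.
have D0 : 0 <= D by apply: le_trans (hD 0%N N0).
rewrite ler_wpM2l//.
apply: (le_trans (sum_antitone_gaps (fun i _ => c_mono i))).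
by rewrite {1}/c divr1 gerBl.
Qed.

(** Summation by parts: with decreasing weights, every v i enters the
    regrouped sum with the nonnegative coefficient c (i - 1) - c i or c n, so
    that a bound on |v i| passes to the sum. *)
Lemma abel_bound (c v h : nat -> R) n :
  (forall i, 0 <= c i) -> (forall i, c i.+1 <= c i) ->
  v 0%N = 0 -> h 0%N = 0 -> (forall i, (i <= n)%N -> `|v i| <= h i) ->
  `|\sum_(i < n) c i * (v i.+1 - v i)| <= \sum_(i < n) c i * (h i.+1 - h i).
Proof.
move=> c0 cS v0 h0 vh.
(* Removing the boundary term makes the inequality inductive. *)
have : `|\sum_(i < n) c i * (v i.+1 - v i) - c n * v n| <=
       \sum_(i < n) c i * (h i.+1 - h i) - c n * h n.
  elim: n vh => [|n IH] vh; first by rewrite !big_ord0 v0 h0 !mulr0 subr0 normr0.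
  rewrite !big_ord_recr /=.
  set S := \sum_(i < n) _ in IH *; set T := \sum_(i < n) _ in IH *.
  have -> : S + c n * (v n.+1 - v n) - c n.+1 * v n.+1 =
    (S - c n * v n) + (c n - c n.+1) * v n.+1 by ring.
  have -> : T + c n * (h n.+1 - h n) - c n.+1 * h n.+1 =
    (T - c n * h n) + (c n - c n.+1) * h n.+1 by ring.
  apply: (le_trans (ler_normD _ _)); apply: lerD.
    by apply: IH => i hi; apply: vh; rewrite leqW.
  by rewrite normrM ger0_norm ?subr_ge0// ler_wpM2l ?subr_ge0// vh.
set S := \sum_(i < n) _; set T := \sum_(i < n) _ => H.
have -> : S = (S - c n * v n) + c n * v n by rewrite subrK.
apply: (le_trans (ler_normD _ _)).
rewrite normrM (ger0_norm (c0 n)).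
have := ler_wpM2l (c0 n) (vh n (leqnn n)); lra.
Qed.

Lemma powR_subadd g (x y : R) : 0 <= g <= 1 -> 0 <= x -> 0 <= y ->
  (x + y) `^ g <= x `^ g + y `^ g.
Proof.
move=> /andP[g0 g1] x0 y0.
have [xy0|xy0] := eqVneq (x + y) 0.
  have [-> ->] : x = 0 /\ y = 0 by lra.
  by rewrite addr0 lerDl powR_ge0.
have {}xy0 : 0 < x + y by rewrite lt_neqAle eq_sym xy0 addr_ge0.
have key z : 0 <= z -> z <= x + y -> z / (x + y) * (x + y) `^ g <= z `^ g.
  move=> z0 zxy; have q0 : 0 <= z / (x + y) by rewrite divr_ge0// ltW.
  rewrite -[z in leRHS](divfK (lt0r_neq0 xy0) z) (powRM _ q0 (ltW xy0)).
  rewrite ler_wpM2r ?powR_ge0//.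
  have [->|z1] := eqVneq z 0; first by rewrite mul0r powR_ge0.
  apply: ger1_powR => //.
  have z2 : 0 < z by rewrite lt_neqAle eq_sym z1.
  by rewrite divr_gt0//= ler_pdivrMr// mul1r.
have := key x x0 ltac:(lra); have := key y y0 ltac:(lra).
have : x / (x + y) * (x + y) `^ g + y / (x + y) * (x + y) `^ g = (x + y) `^ g.
  by rewrite -mulrDl -mulrDl divff ?mul1r// lt0r_neq0.
lra.
Qed.

Lemma powR_hoelder g (x y : R) : 0 <= g <= 1 -> 0 <= x -> 0 <= y ->
  `|x `^ g - y `^ g| <= `|x - y| `^ g.
Proof.
move=> g01 x0 y0; wlog xy : x y x0 y0 / y <= x.
  move=> H; have [xy|/ltW yx] := leP y x; first exact: H.
  by rewrite distrC [`|x - y|]distrC H.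
have g0 : 0 <= g by case/andP: g01.
rewrite !ger0_norm ?subr_ge0//; last by rewrite ge0_ler_powR.
rewrite lerBlDr -[in leLHS](subrK y x); apply: powR_subadd => //.
by rewrite subr_ge0.
Qed.

(** The bound on u m - u 0 is uniform in m: it serves to control quantities
    that are needed at every mesh, not only in the limit. *)
Lemma geometric_cvg (u : nat -> R) C q : 0 <= C -> 0 <= q < 1 ->
  (forall m, `|u m.+1 - u m| <= C * q ^+ m) ->
  cvgn u /\ (forall m, `|u m - u 0%N| <= C / (1 - q)).
Proof.
move=> C0 /andP[q0 q1] hu.
have q1' : `|q| < 1 by rewrite ger0_norm.
have S m : u m = u 0%N + series (fun k => u k.+1 - u k) m.
  elim: m => [|m IH]; first by rewrite /series /= big_geq// addr0.
  by rewrite /series /= big_nat_recr//= addrA -[X in X + _]IH addrC subrK.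
have geoE m : C * q ^+ m = geometric C q m by [].
split.
  have -> : u = (fun m => u 0%N + series (fun k => u k.+1 - u k) m) by apply/funext.
  apply: is_cvgD; first exact: is_cvg_cst.
  apply: normed_cvg; apply: (series_le_cvg _ _ hu).
  - by move=> n; exact: normr_ge0.
  - by move=> n; rewrite mulr_ge0// exprn_ge0.
  - exact: is_cvg_geometric_series.
move=> m; rewrite S addrAC subrr add0r.
apply: (le_trans (ler_norm_sum _ _ _)).
apply: (@le_trans _ _ (series (geometric C q) m)); first by apply: ler_sum => k _; exact: hu.
have cg := @cvg_geometric_series R C q q1'.
rewrite -(cvg_lim (@Rhausdorff R) cg).
apply: nondecreasing_cvgn_le; last exact: is_cvg_geometric_series.
apply/nondecreasing_seqP => n; rewrite /series /= big_nat_recr//= lerDl.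
by rewrite mulr_ge0// exprn_ge0.
Qed.

Definition hoelder_on (A : set R) C g v := forall x y, A x -> A y ->
  `|v x - v y| <= C * `|x - y| `^ g.

Lemma frac01 (i N : nat) : (0 < N)%N -> (i <= N)%N -> `[0, 1]%classic (i%:R / N%:R : R).
Proof.
move=> N0 iN; rewrite /= in_itv /= divr_ge0//= ler_pdivrMr ?ltr0n// mul1r ler_nat//.
Qed.

Lemma wsum_dyadic_step a g C v k m : 0 <= a -> 0 <= g -> (0 < k)%N -> 0 <= C ->
  hoelder_on `[0, 1] C g v ->
  `|wsum a (k * 2 ^ m.+1) v - wsum a (k * 2 ^ m) v| <=
    C * k.*2%:R `^ (a - g) * (2 `^ (a - g)) ^+ m.
Proof.
move=> a0 g0 k0 C0 hv.
have N0 : (0 < k * 2 ^ m)%N by rewrite muln_gt0 k0 expn_gt0.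
have E : (k * 2 ^ m.+1)%N = (k * 2 ^ m).*2 by rewrite expnS mulnCA mul2n.
rewrite E; have N20 : (0 < (k * 2 ^ m).*2)%N by rewrite double_gt0.
have := @wsum_double a _ v (C * ((k * 2 ^ m).*2%:R^-1) `^ g) a0 N0.
move=> /(_ _)/le_trans; apply.
  move=> i iN; apply: (le_trans (hv _ _ _ _)).
  - by apply: frac01 => //; rewrite ltn_double.
  - by apply: frac01 => //; rewrite leq_double ltnW.
  rewrite -mulrBl -natrB ?leqnSn// subSnn mul1r ger0_norm ?invr_ge0//.
rewrite -powR_inv1// -powRrM mulN1r -mulrA -powRD; last first.
  by rewrite pnatr_eq0 -lt0n N20 implybT.
rewrite -mulrA ler_wpM2l// addrC -powR_mulrn ?powR_ge0//.
rewrite [X in _ * X]powRAC powR_mulrn// -powRM// ?exprn_ge0//.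
by rewrite -natrX -natrM -muln2 -[k.*2]muln2 mulnAC.
Qed.

(** For a g-Hoelder function with g > a the successive differences decay
    like 2^(m (a - g)).  The factor k allows a grid with k coarse cells to be
    refined dyadically, so that sums at several times share one partition. *)
Lemma wsum_dyadic_cvg a g C v k : 0 <= a -> a < g -> (0 < k)%N ->
  hoelder_on `[0, 1] C g v -> cvgn (fun m => wsum a (k * 2 ^ m) v).
Proof.
move=> a0 ag k0 hv.
have g0 : 0 <= g by apply/ltW/(le_lt_trans a0).
have C0 : 0 <= C.
  have := hv 1 0; rewrite /= !in_itv/= !lexx !ler01 => /(_ isT isT).
  rewrite subr0 normr1 powR1 mulr1; exact: le_trans.
apply: (proj1 (@geometric_cvg (fun m => wsum a (k * 2 ^ m) v) (C * k.*2%:R `^ (a - g)) (2 `^ (a - g)) _ _ _)).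
- by rewrite mulr_ge0// powR_ge0.
- rewrite powR_ge0/= -[ltRHS](powRr0 2) /powR pnatr_eq0/= ltr_expR.
  by rewrite mul0r nmulr_rlt0 ?subr_lt0// ln_gt0// ltr1n.
- by move=> m; apply: wsum_dyadic_step.
Qed.

Definition wsum_bound a g : R := 1 + 2 `^ (a - g) / (1 - 2 `^ (a - g)).

Lemma wsum_powR_le a g m : 0 <= a -> a < g -> g <= 1 ->
  wsum a (2 ^ m) (fun u => u `^ g) <= wsum_bound a g.
Proof.
move=> a0 ag g1.
have g0 : 0 < g by exact: le_lt_trans ag.
have hv : hoelder_on `[0, 1] 1 g (fun u => u `^ g).
  move=> x y; rewrite /= !in_itv/= => /andP[x0 _] /andP[y0 _].
  by rewrite mul1r powR_hoelder// ltW.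
have [|||_] := (@geometric_cvg (fun m => wsum a (1 * 2 ^ m) (fun u => u `^ g)) (2 `^ (a - g)) (2 `^ (a - g))).
- exact: powR_ge0.
- rewrite powR_ge0/= -[ltRHS](powRr0 2) /powR pnatr_eq0/= ltr_expR.
  by rewrite mul0r nmulr_rlt0 ?subr_lt0// ln_gt0// ltr1n.
- move=> n; apply: (le_trans (@wsum_dyadic_step a g 1 _ 1 n a0 (ltW g0) isT ler01 hv)).
  by rewrite mul1r.
move=> /(_ m); rewrite mul1n expn0 muln1 /wsum_bound.
(* On a single cell the sum is 1; the refinements add at most a geometric sum. *)
have -> : wsum a 1 (fun u => u `^ g) = 1.
  rewrite /wsum big_ord_recl big_ord0 /= divr1 mul0r powR0 ?gt_eqF//.
  by rewrite !powR1 /= mul1r subr0 addr0.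
by move=> H; have := le_trans (ler_norm _) H; rewrite lerBlDl.
Qed.

(** A function below A u^g in modulus has a weighted sum below A times that of
    u^g, which is bounded uniformly in the mesh. *)
Lemma wsum_le_powR a g A v m : 0 <= a -> a < g -> g <= 1 -> 0 <= A -> v 0 = 0 ->
  (forall u, 0 <= u <= 1 -> `|v u| <= A * u `^ g) ->
  `|wsum a (2 ^ m) v| <= A * wsum_bound a g.
Proof.
move=> a0 ag g1 A0 v0 hv.
have g0 : 0 < g by exact: le_lt_trans ag.
apply: le_trans (ler_wpM2l A0 (wsum_powR_le m a0 ag g1)).
have N0 : (0 < 2 ^ m)%N by rewrite expn_gt0.
rewrite /wsum mulr_sumr.
have := @abel_bound (fun i => ((2 ^ m)%:R / i.+1%:R) `^ a) (fun i => v (i%:R / (2 ^ m)%:R))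
  (fun i => A * (i%:R / (2 ^ m)%:R) `^ g) (2 ^ m).
move=> /(_ _ _ _ _ _)/le_trans; apply.
- by move=> i; exact: powR_ge0.
- move=> i; apply: ge0_ler_powR => //; rewrite ?nnegrE ?divr_ge0//.
  by rewrite ler_wpM2l// lef_pV2 ?posrE ?ltr0n// ler_nat.
- by rewrite mul0r.
- by rewrite mul0r powR0 ?mulr0// gt_eqF.
- by move=> i iN; apply: hv; have := frac01 N0 iN; rewrite /= in_itv.
by apply: ler_sum => i _; rewrite -mulrBr mulrCA.
Qed.

Lemma wsumB a N v w : wsum a N v - wsum a N w = wsum a N (fun u => v u - w u).
Proof. by rewrite /wsum -sumrB; apply: eq_bigr => i _; ring. Qed.

End wsum.

(** Continuity within a set, along a sequence that stays in the set. *)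
(** * Fractional integrals of Hoelder paths, and Hoelder bounds from dyadic increments *)

Lemma within_continuous_cvg {U V : topologicalType} (A : set U) (f : U -> V)
    (F : set_system nat) (FF : Filter F) (u : nat -> U) (x : U) :
  {within A, continuous f} -> A x -> (forall n, A (u n)) ->
  u n @[n --> F] --> x -> f (u n) @[n --> F] --> f x.
Proof.
move=> /subspace_continuousP cf Ax Au ux.
apply: cvg_comp; last exact: (cf x Ax).
move=> B /ux; rewrite /= /nbhs /=; apply: filterS => n /=; exact.
Qed.

Section paths.
Context {R : realType}.
Implicit Types (a g C : R) (w x : R -> R).

Lemma normr_lim_le (u : nat -> R) l C :
  u n @[n --> \oo] --> l -> (forall n, `|u n| <= C) -> `|l| <= C.
Proof.
move=> ul uC; have cn : `|u n| @[n --> \oo] --> `|l| by exact: cvg_norm.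
rewrite -(cvg_lim (@Rhausdorff R) cn); apply: limr_le; last by apply: nearW.
by apply/cvg_ex; exists `|l|.
Qed.

(** The integral of (t / s)^a dw(s) over [0, t], after the substitution
    s = t u. *)
Definition fractional_integral a w (t : R) : R :=
  limn (fun m => wsum a (2 ^ m) (fun u => w (t * u))).

Lemma wsum_path_cvg a g C T w t k : 0 <= a -> a < g ->
  hoelder_on `[0, T] C g w -> 0 <= t <= T -> (0 < k)%N ->
  cvgn (fun m => wsum a (k * 2 ^ m) (fun u => w (t * u))).
Proof.
move=> a0 ag hw /andP[t0 tT] k0.
apply: (@wsum_dyadic_cvg _ a g (C * t `^ g)) => // u v.
rewrite /= !in_itv/= => /andP[u0 u1] /andP[v0 v1].
rewrite -mulrA -powRM// -[X in X * `|u - v|]ger0_norm// -normrM mulrBr.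
by apply: hw; rewrite /= in_itv/= mulr_ge0//= (le_trans _ tT)// ler_piMr.
Qed.

Lemma fractional_integral_cvg a g C T w t : 0 <= a -> a < g ->
  hoelder_on `[0, T] C g w -> 0 <= t <= T ->
  wsum a (2 ^ m) (fun u => w (t * u)) @[m --> \oo] --> fractional_integral a w t.
Proof.
move=> a0 ag hw tT; have := wsum_path_cvg a0 ag hw tT (ltn0Sn 0).
rewrite /fractional_integral.
by under eq_fun do rewrite mul1n.
Qed.

(** The difference of the sums at times t and s is the sum for the path
    u |-> w (t u) - w (s u), which is at most C |t - s|^g u^g. *)
Lemma fractional_integral_hoelder a g C T w : 0 <= a -> a < g -> g <= 1 -> 0 <= C ->
  hoelder_on `[0, T] C g w ->
  hoelder_on `[0, T] (C * wsum_bound a g) g (fractional_integral a w).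
Proof.
move=> a0 ag g1 C0 hw t s At As.
have := At; rewrite /= in_itv/= => tT; have /andP[t0 tT'] := tT.
have := As; rewrite /= in_itv/= => sT; have /andP[s0 sT'] := sT.
have ct := fractional_integral_cvg a0 ag hw tT.
have cs := fractional_integral_cvg a0 ag hw sT.
apply: (normr_lim_le (cvgB ct cs)) => m.
rewrite /= wsumB mulrAC; apply: (@wsum_le_powR _ _ g) => //.
- by rewrite mulr_ge0// powR_ge0.
- by rewrite !mulr0 subrr.
move=> u /andP[u0 u1]; rewrite -mulrA -powRM// -{3}(ger0_norm u0) -normrM mulrBl.
by apply: hw; rewrite /= in_itv/= mulr_ge0//= (le_trans (ler_piMr _ _)).
Qed.

Lemma dyadic_scale (d : R) : 0 < d <= 1 ->
  exists m : nat, (2 ^+ m.+1)^-1 < d <= (2 ^+ m)^-1.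
Proof.
move=> /andP[d0 d1].
have [n hn] : exists n : nat, (2 ^+ n)^-1 < d.
  exists (Num.trunc d^-1).+1.
  rewrite invf_plt ?posrE ?exprn_gt0//.
  have := @truncn_itv R d^-1; rewrite invr_ge0 ltW// => /(_ isT)/andP[_ h2].
  apply: (lt_le_trans h2).
  by rewrite -natrX ler_nat ltnW// ltn_expl.
have exn : exists n : nat, (2 ^+ n)^-1 < d by exists n.
have := ex_minnP exn; case=> -[|m] hm hmin.
  by move: hm; rewrite expr0 invr1 ltNge d1.
exists m; rewrite hm/= leNgt; apply/negP => h.
by have := hmin m h; rewrite ltnn.
Qed.

Lemma dyadic_floor (t : R) m : 0 <= t <= 1 ->
  let k := Num.trunc (t * 2 ^+ m) in
  [/\ (k <= 2 ^ m)%N, k%:R <= t * 2 ^+ m & t * 2 ^+ m < k.+1%:R].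
Proof.
move=> /andP[t0 t1] k.
have /andP[h1 h2] := @truncn_itv R (t * 2 ^+ m) (mulr_ge0 t0 (exprn_ge0 _ (ler0n _ 2))).
split => //; rewrite -(@ler_nat R) natrX (le_trans h1)//.
by rewrite ler_piMl// exprn_ge0.
Qed.

Definition dyadic_trunc (t : R) m : R := (Num.trunc (t * 2 ^+ m))%:R / 2 ^+ m.

Let two_gt0 m : 0 < 2 ^+ m :> R. Proof. by rewrite exprn_gt0. Qed.

Lemma dyadic_trunc_cvg t : 0 <= t <= 1 -> dyadic_trunc t m @[m --> \oo] --> t.
Proof.
move=> t01; apply/cvgrPdist_le => e e0.
have c0 := @cvg_geometric R 1 2^-1 ltac:(rewrite ger0_norm ?invr_ge0// invf_lt1 ?ltr1n//).
move/cvgrPdist_le : c0 => /(_ _ e0).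
apply: filterS => m; rewrite sub0r normrN /geometric /= mul1r => hm.
apply: le_trans hm; have [_ h1 h2] := dyadic_floor m t01.
have h3 : dyadic_trunc t m <= t by rewrite ler_pdivrMr.
rewrite ger0_norm ?subr_ge0// ger0_norm ?exprn_ge0// ?invr_ge0//.
rewrite lerBlDr exprVn -[X in _ <= X + _]mul1r -mulrDl ler_pdivlMr//.
by rewrite addrC natr1 ltW.
Qed.

(** The deterministic half of Kolmogorov's criterion.  A point is reached from
    its dyadic truncation of order m through increments of orders above m, the
    sum of which is geometric; and the truncations of order m of two points at
    a distance at most 2^(- m) are equal or adjacent. *)
Lemma dyadic_hoelder g C x : 0 < g -> 0 <= C ->
  {within `[0, 1], continuous x} ->
  (forall m k, (k < 2 ^ m)%N ->
     `|x (k.+1%:R / 2 ^+ m) - x (k%:R / 2 ^+ m)| <= C * (2 `^ (- g)) ^+ m) ->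
  exists C', 0 <= C' /\ hoelder_on `[0, 1] C' g x.
Proof.
move=> g0 C0 cx hx; set q := 2 `^ (- g) in hx *.
have q0 : 0 <= q by exact: powR_ge0.
have q1 : q < 1.
  by rewrite -[ltRHS](powRr0 2) /q /powR pnatr_eq0/= ltr_expR mul0r nmulr_rlt0 ?oppr_lt0// ln_gt0// ltr1n.
have approx t m : 0 <= t <= 1 -> `|x t - x (dyadic_trunc t m)| <= C * q ^+ m / (1 - q).
  move=> t01; pose u n := x (dyadic_trunc t (m + n)).
  have [|||_ hu] := (@geometric_cvg _ u (C * q ^+ m) q).
  - by rewrite mulr_ge0// exprn_ge0.
  - by rewrite q0.
  - move=> n; rewrite -mulrA -exprD /u addnS; set p := (m + n)%N.
    have [k1 h1 h2] := dyadic_floor p t01; have [k1' h1' h2'] := dyadic_floor p.+1 t01.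
    rewrite /dyadic_trunc; set k := Num.trunc _ in k1 h1 h2 *.
    set k' := Num.trunc (t * _) in k1' h1' h2' *.
    have halve (j : nat) : j%:R / 2 ^+ p = j.*2%:R / 2 ^+ p.+1 :> R.
      by rewrite -muln2 natrM exprSr -mulf_div divff ?mulr1.
    have E1 : (k.*2 <= k')%N.
      rewrite -ltnS -(ltr_nat R) (le_lt_trans _ h2')// -muln2 natrM exprSr mulrA.
      by rewrite ler_wpM2r.
    have E2 : (k' < k.*2.+2)%N.
      rewrite -(ltr_nat R) (le_lt_trans h1')// -doubleS -muln2 natrM exprSr mulrA.
      by rewrite ltr_pM2r.
    rewrite halve; have [->|nE] := eqVneq k' k.*2.
      by rewrite subrr normr0 mulr_ge0// exprn_ge0.
    have -> : k' = k.*2.+1.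
      by apply/eqP; rewrite eqn_leq -ltnS E2/= ltn_neqAle eq_sym nE.
    apply: (le_trans (hx _ _ _)); last first.
      by rewrite ler_wpM2l// exprS ler_piMl// ?exprn_ge0// ltW.
    by apply: leq_trans k1'; rewrite ltn_neqAle eq_sym nE.
  have cu : u n @[n --> \oo] --> x t.
    have -> : u = fun n => x (dyadic_trunc t (n + m)).
      by apply/funext => n; rewrite /u addnC.
    rewrite (cvg_shiftn m (fun n => x (dyadic_trunc t n))).
    apply: (@within_continuous_cvg R R `[0, 1] x \oo _ (dyadic_trunc t) t cx) => //.
    - move=> n; have [k1 _ _] := dyadic_floor n t01.
      by rewrite /dyadic_trunc -[X in _ / X]natrX; apply: frac01; rewrite ?expn_gt0.
    - exact: dyadic_trunc_cvg.
  have cu' : u n - u 0%N @[n --> \oo] --> x t - u 0%N by apply: cvgB => //; exact: cvg_cst.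
  by have := normr_lim_le cu' hu; rewrite /u addn0.
exists (2 `^ g * (C * (1 + 2 / (1 - q)))).
have q1' : 0 < 1 - q by rewrite subr_gt0.
have K0 : 0 <= C * (1 + 2 / (1 - q)).
  by rewrite mulr_ge0// addr_ge0// divr_ge0// ltW.
split; first by rewrite mulr_ge0// powR_ge0.
suff H s t : 0 <= s <= 1 -> 0 <= t <= 1 -> s < t ->
    `|x t - x s| <= 2 `^ g * (C * (1 + 2 / (1 - q))) * `|t - s| `^ g.
  move=> t s; rewrite /= !in_itv/= => t01 s01; have [st|ts|->] := ltgtP s t.
  - by apply: H.
  - by rewrite distrC [`|t - s|]distrC; apply: H.
  - by rewrite !subrr normr0 mulr_ge0 ?powR_ge0// mulr_ge0 ?powR_ge0.
move=> s01 t01 st.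
have [m /andP[hm1 hm2]] : exists m : nat, (2 ^+ m.+1)^-1 < t - s <= (2 ^+ m)^-1.
  by apply: dyadic_scale; rewrite subr_gt0 st /=; move: s01 t01; lra.
rewrite [`|t - s|]ger0_norm ?subr_ge0 ?(ltW st)//.
have [k1 h1 h2] := dyadic_floor m s01; have [k1' h1' h2'] := dyadic_floor m t01.
have at_ := approx t m t01; have as_ := approx s m s01.
have mid : `|x (dyadic_trunc t m) - x (dyadic_trunc s m)| <= C * q ^+ m.
  rewrite /dyadic_trunc; set k := Num.trunc _ in k1 h1 h2 *.
  set k' := Num.trunc (t * _) in k1' h1' h2' *.
  have E2 : (k' < k.+2)%N.
    rewrite -(ltr_nat R) (le_lt_trans h1')//.
    rewrite -(natr1 k.+1) -ltrBlDr (le_lt_trans _ h2)//.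
    rewrite lerBlDr -lerBlDl -mulrBl.
    by rewrite -[leRHS](mulVf (lt0r_neq0 (two_gt0 m))) ler_wpM2r// ltW.
  have E1 : (k <= k')%N.
    rewrite -ltnS -(ltr_nat R) (le_lt_trans _ h2')// (le_trans h1)//.
    by rewrite ler_wpM2r// ltW.
  have [->|nE] := eqVneq k' k; first by rewrite subrr normr0 mulr_ge0// exprn_ge0.
  have E : k' = k.+1 by apply/eqP; rewrite eqn_leq -ltnS E2/= ltn_neqAle eq_sym nE.
  by rewrite E; apply: hx; rewrite -E.
have : `|x t - x s| <= C * q ^+ m / (1 - q) + C * q ^+ m + C * q ^+ m / (1 - q).
  have -> : x t - x s = (x t - x (dyadic_trunc t m)) +
    (x (dyadic_trunc t m) - x (dyadic_trunc s m)) + (x (dyadic_trunc s m) - x s) by ring.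
  apply: (le_trans (ler_normD _ _)); apply: lerD; last by rewrite distrC.
  by apply: (le_trans (ler_normD _ _)); apply: lerD.
move=> /le_trans; apply.
have -> : C * q ^+ m / (1 - q) + C * q ^+ m + C * q ^+ m / (1 - q) =
  (C * (1 + 2 / (1 - q))) * q ^+ m by ring.
rewrite [2 `^ g * _]mulrC -[leRHS]mulrA ler_wpM2l//.
have -> : q ^+ m = 2 `^ g * ((2 ^+ m.+1)^-1 `^ g).
  rewrite /q -powR_mulrn ?powR_ge0// -powRrM -powR_invn// -powRrM -powRD; last first.
    by rewrite pnatr_eq0 implybT.
  by congr (_ `^ _); rewrite -natr1; ring.
rewrite ler_wpM2l ?powR_ge0//; apply: (ge0_ler_powR (ltW g0)); rewrite ?nnegrE ?invr_ge0 ?exprn_ge0 ?subr_ge0 ?ltW//.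
Qed.

End paths.

(** * Riemann sums of the squared kernel *)

Section riemann_sums.
Context {R : realType}.
Implicit Types (a b x y t : R).

(** Young's inequality for the exponents 1 / b and 1 / (1 - b). *)
Lemma bernoulli_powR b x : 0 < b < 1 -> 0 <= 1 + x -> (1 + x) `^ b <= 1 + b * x.
Proof.
move=> /andP[b0 b1] x0.
have := @conjugate_powR R ((1 + x) `^ b) 1 b^-1 (1 - b)^-1 (powR_ge0 _ _) ler01.
rewrite !invr_gt0 subr_gt0 b0 b1 !invrK addrC subrK => /(_ isT isT erefl).
by rewrite -powRrM mulfV ?gt_eqF// powRr1// powR1 mulr1; lra.
Qed.

Lemma powR_succ_le b x : 0 < b < 1 -> 0 < x -> (x + 1) `^ b - x `^ b <= b * (x `^ b / x).
Proof.
move=> b01 x0.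
have -> : x + 1 = x * (1 + x^-1) by rewrite mulrDr mulr1 mulfV ?gt_eqF.
have i1 : 0 <= 1 + x^-1 by rewrite addr_ge0 ?invr_ge0 ?(ltW x0).
rewrite (powRM _ (ltW x0) i1).
have := ler_wpM2l (powR_ge0 x b) (@bernoulli_powR b x^-1 b01 i1); lra.
Qed.

Lemma powR_pred_le b x : 0 < b < 1 -> 1 <= x -> b * (x `^ b / x) <= x `^ b - (x - 1) `^ b.
Proof.
move=> b01 x1; have x0 : 0 < x by lra.
have -> : x - 1 = x * (1 + (- x^-1)) by rewrite mulrDr mulr1 mulrN mulfV ?gt_eqF.
have i1 : 0 <= 1 + - x^-1 by rewrite subr_ge0 invf_le1.
rewrite (powRM _ (ltW x0) i1).
have := ler_wpM2l (powR_ge0 x b) (@bernoulli_powR b (- x^-1) b01 i1); lra.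
Qed.

Definition riemann_sum a N : R := \sum_(i < N) ((N%:R / i.+1%:R) `^ a) ^+ 2 / N%:R.

Lemma riemann_sumE a N : 0 < a -> a < 2^-1 -> (0 < N)%N ->
  riemann_sum a N = N%:R `^ (a *+ 2 - 1) *
    \sum_(i < N) (i.+1%:R `^ (1 - a *+ 2) / i.+1%:R).
Proof.
move=> a0 a1 N0; rewrite /riemann_sum mulr_sumr; apply: eq_bigr => i _.
rewrite -powR_mulrn ?powR_ge0// -powRrM mulr_natr powRM ?invr_ge0//.
rewrite powRB; last by rewrite pnatr_eq0 -lt0n N0 implybT.
rewrite [i.+1%:R `^ _]powRB; last by rewrite pnatr_eq0 implybT.
have -> : i.+1%:R^-1 `^ (a *+ 2) = (i.+1%:R `^ (a *+ 2))^-1 :> R.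
  by rewrite -powR_inv1// -powRrM mulN1r powRN.
rewrite !powRr1//.
have ? : i.+1%:R != 0 :> R by rewrite pnatr_eq0.
by rewrite [i.+1%:R / _ / _]mulrAC mulfV// mul1r mulrAC.
Qed.

(** By concavity of x^b, b = 1 - 2 a, every term b i^(b - 1) is at most the
    increment of x^b from i - 1 to i, and these increments telescope.  The
    lower bound uses the increments from i to i + 1 instead. *)
Lemma riemann_sum_le a N : 0 < a -> a < 2^-1 -> (0 < N)%N ->
  (1 - a *+ 2) * riemann_sum a N <= 1.
Proof.
move=> a0 a1 N0; rewrite riemann_sumE//; set b := 1 - a *+ 2.
have b01 : 0 < b < 1 by rewrite /b; lra.
have -> : a *+ 2 - 1 = - b by rewrite /b; ring.
have : b * \sum_(i < N) (i.+1%:R `^ b / i.+1%:R) <= N%:R `^ b.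
  elim: (N) => [|n IH]; first by rewrite big_ord0 mulr0 powR_ge0.
  rewrite big_ord_recr /= mulrDr.
  have := @powR_pred_le b n.+1%:R b01; rewrite ler1n => /(_ isT).
  have -> : n.+1%:R - 1 = n%:R :> R by rewrite -natr1 addrK.
  by move=> H; have := lerD IH H; rewrite subrKC.
move=> /(ler_wpM2l (powR_ge0 N%:R (- b))).
by rewrite -powRD ?addNr ?powRr0 1?mulrCA// pnatr_eq0 -lt0n N0 implybT.
Qed.

Lemma riemann_sum_ge a N : 0 < a -> a < 2^-1 -> (0 < N)%N ->
  1 - N%:R `^ (a *+ 2 - 1) <= (1 - a *+ 2) * riemann_sum a N.
Proof.
move=> a0 a1 N0; rewrite riemann_sumE//; set b := 1 - a *+ 2.
have b01 : 0 < b < 1 by rewrite /b; lra.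
have -> : a *+ 2 - 1 = - b by rewrite /b; ring.
have : N%:R `^ b - 1 <= b * \sum_(i < N) (i.+1%:R `^ b / i.+1%:R).
  apply: (@le_trans _ _ (N.+1%:R `^ b - 1)).
    rewrite lerB// ge0_ler_powR ?nnegrE ?ler_nat//; lra.
  elim: (N) => [|n IH]; first by rewrite big_ord0 mulr0 powR1 subrr.
  rewrite big_ord_recr /= mulrDr.
  have := @powR_succ_le b n.+1%:R b01; rewrite ltr0n => /(_ isT).
  rewrite natr1 => H; rewrite -(subrKA (n.+1%:R `^ b)) [leRHS]addrC; exact: lerD.
move=> /(ler_wpM2l (powR_ge0 N%:R (- b))).
rewrite mulrBr mulr1 -powRD ?addNr ?powRr0 1?[in leRHS]mulrCA//.
by rewrite pnatr_eq0 -lt0n N0 implybT.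
Qed.

Lemma natr_powR_cvg0 b : 0 < b -> (N%:R : R) `^ (- b) @[N --> \oo] --> (0 : R).
Proof.
move=> b0; apply/cvgrPdist_le => e e0.
exists (Num.trunc ((e^-1) `^ b^-1)).+1 => // N /= hN.
have h : (e^-1) `^ b^-1 <= N%:R.
  have /andP[_ h] := @truncn_itv R _ (powR_ge0 e^-1 b^-1).
  by apply/ltW/(lt_le_trans h); rewrite ler_nat.
rewrite sub0r normrN ger0_norm ?powR_ge0// powRN invf_ple ?posrE//.
  have e1 : 0 <= e^-1 by rewrite invr_ge0 ltW.
  have <- : (e^-1 `^ b^-1) `^ b = e^-1 by rewrite -powRrM mulVf ?gt_eqF// powRr1.
  by apply: (ge0_ler_powR (ltW b0)); rewrite ?nnegrE ?powR_ge0.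
by rewrite powR_gt0// ltr0n (leq_trans _ hN).
Qed.

Lemma riemann_sum_cvg a : 0 < a -> a < 2^-1 ->
  (1 - a *+ 2) * riemann_sum a N @[N --> \oo] --> (1 : R).
Proof.
move=> a0 a1.
have h : 1 - N%:R `^ (a *+ 2 - 1) @[N --> \oo] --> (1 : R).
  rewrite -[X in _ --> X]subr0; apply: cvgB; first exact: cvg_cst.
  have := @natr_powR_cvg0 (1 - a *+ 2) ltac:(lra).
  by rewrite opprB.
apply: (@squeeze_cvgr _ _ _ _ _ (cst 1)) h _; last exact: cvg_cst.
near=> N; have N0 : (0 < N)%N by near: N; exact: nbhs_infty_gt.
by rewrite riemann_sum_le// riemann_sum_ge.
Unshelve. all: by end_near. Qed.

Lemma derivable_continuous_at (f : R -> R) x : derivable f x 1 -> {for x, continuous f}.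
Proof. by move=> /derivable1_diffP/differentiable_continuous. Qed.

Lemma powR_continuous_at b x : 0 < x -> {for x, continuous (fun y => y `^ b)}.
Proof.
by move=> x0; apply: derivable_continuous_at; apply: derivable_powR; rewrite in_itv/= x0.
Qed.

Lemma integral_powR_itv b (e t : R) : 0 < b -> 0 < e -> e < t ->
  (\int[lebesgue_measure]_(s in `[e, t]) (s `^ (b - 1))%:E =
   ((t `^ b - e `^ b) / b)%:E)%E.
Proof.
move=> b0 e0 et; have t0 := lt_trans e0 et.
rewrite (@continuous_FTC2 R _ (fun s => b^-1 * s `^ b) e t et).
- by rewrite -EFinB -mulrBr mulrC.
- apply/continuous_in_subspaceT => x; rewrite inE/= in_itv/= => /andP[ex _].
  exact/powR_continuous_at/(lt_le_trans e0).
- split.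
  + move=> x; rewrite in_itv/= => /andP[ex _].
    apply: derivableM; first exact: derivable_cst.
    by apply: derivable_powR; rewrite in_itv/= andbT (lt_trans e0).
  + apply: cvg_at_right_filter; apply: cvgM; first exact: cvg_cst.
    exact: powR_continuous_at.
  + apply: cvg_at_left_filter; apply: cvgM; first exact: cvg_cst.
    exact: powR_continuous_at.
- move=> x; rewrite in_itv/= => /andP[ex _]; have x0 := lt_trans e0 ex.
  rewrite derive1E deriveM; [|exact: derivable_cst|].
    rewrite derive_cst scaler0 addr0 -derive1E powR_derive1 ?in_itv/= ?andbT//.
    by rewrite /GRing.scale/= mulrA mulVf ?gt_eqF// mul1r.
  by apply: derivable_powR; rewrite in_itv/= andbT.
Qed.

Lemma integral_powR_le b t : 0 < b -> 0 < t ->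
  (\int[lebesgue_measure]_(s in `]0%R, t]) (s `^ (b - 1))%:E <= (t `^ b / b)%:E)%E.
Proof.
move=> b0 t0.
pose F (n : nat) : set R := `[t / n.+2%:R, t]%classic.
have -> : `]0, t]%classic = \bigcup_n F n :> set R.
  apply/seteqP; split => s; rewrite /= in_itv/=.
    move=> /andP[s0 st]; exists (Num.trunc (t / s)) => //=.
    rewrite /F /= in_itv/= st andbT ler_pdivrMr// -ler_pdivrMl// mulrC.
    have /andP[_ h] := @truncn_itv R (t / s) (divr_ge0 (ltW t0) (ltW s0)).
    by apply/ltW/(lt_le_trans h); rewrite ler_nat.
  move=> [n _] ; rewrite /F /= in_itv/= => /andP[h ->]; rewrite andbT.
  by apply: lt_le_trans h; rewrite divr_gt0.
have nF : nondecreasing_seq F.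
  apply/nondecreasing_seqP => n; apply/subsetPset => s; rewrite /F /= !in_itv/=.
  move=> /andP[h ->]; rewrite andbT (le_trans _ h)//.
  by rewrite ler_wpM2l ?(ltW t0)// lef_pV2 ?posrE// ler_nat.
have mF i : measurable (F i) by exact: measurable_itv.
have mf i : measurable_fun (F i) (EFin \o (fun s : R => s `^ (b - 1))).
  by apply/measurable_EFinP; apply: measurable_funTS; exact: measurable_powR.
have f0 i (x : R) : F i x -> (0 <= (x `^ (b - 1))%:E)%E by rewrite lee_fin powR_ge0.
have cv : (\int[lebesgue_measure]_(s in F n) (s `^ (b - 1))%:E)%E @[n --> \oo] -->
    (\int[lebesgue_measure]_(s in \bigcup_n F n) (s `^ (b - 1))%:E)%E.
  exact: ge0_nondecreasing_set_cvg_integral.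
rewrite -(cvg_lim _ cv)//; apply: lime_le; first by apply/cvg_ex; eexists; exact: cv.
apply: nearW => n; rewrite integral_powR_itv//.
- by rewrite lee_fin ler_wpM2r ?invr_ge0 ?(ltW b0)// gerBl powR_ge0.
- by rewrite divr_gt0.
- by rewrite ltr_pdivrMr// ltr_pMr// ltr1n.
Qed.

End riemann_sums.

(** * Step functions approximating the kernel *)

Section grid.
Context {R : realType}.
Implicit Types (a t s : R) (c : nat -> R) (N : nat).

(** The step function equal to c i on the i-th of N equal cells, open on
    the left, in the encoding of [step_fun]. *)
Definition grid_steps c t N : seq (R * R * R) :=
  [seq (c i, t * (i%:R / N%:R), t * (i.+1%:R / N%:R)) | i <- iota 0 N].

Lemma grid_steps_within c t N : 0 <= t -> (0 < N)%N -> steps_within t (grid_steps c t N).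
Proof.
move=> t0 N0; apply/allP => j /mapP[i]; rewrite mem_iota add0n => /andP[_ iN] ->/=.
rewrite mulr_ge0// ?divr_ge0//= ler_wpM2l//= ?ler_wpM2r ?invr_ge0 ?ler_nat//.
by rewrite ler_piMr// ler_pdivrMr ?ltr0n// mul1r ler_nat.
Qed.

Lemma big_grid_steps (F : R * R * R -> R) c t N :
  \sum_(j <- grid_steps c t N) F j =
  \sum_(i < N) F (c i, t * (i%:R / N%:R), t * (i.+1%:R / N%:R)).
Proof. by rewrite /grid_steps big_map -[X in iota _ X]subn0 -/(index_iota 0 N) big_mkord. Qed.

Lemma grid_cell t N s : (0 < N)%N -> 0 < s <= t ->
  exists2 i : 'I_N, t * (i%:R / N%:R) < s & s <= t * (i.+1%:R / N%:R).
Proof.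
move=> N0 /andP[s0 st].
have exn : exists n, s <= t * (n%:R / N%:R).
  by exists N; rewrite divff ?mulr1// pnatr_eq0 -lt0n.
have := ex_minnP exn; case=> -[|n] hn hmin.
  by move: hn; rewrite mul0r mulr0 leNgt s0.
have nN : (n < N)%N.
  by apply: hmin; rewrite divff ?mulr1// pnatr_eq0 -lt0n.
exists (Ordinal nN) => //=; rewrite ltNge; apply/negP => h.
by have := hmin n h; rewrite ltnn.
Qed.

Lemma step_fun_gridE c t N s (i : 'I_N) : 0 <= t ->
  t * (i%:R / N%:R) < s -> s <= t * (i.+1%:R / N%:R) ->
  step_fun (grid_steps c t N) s = c i.
Proof.
move=> t0 h1 h2; rewrite /step_fun big_grid_steps /= (bigD1 i)//= big1.
  by rewrite addr0 indicE mem_set ?mulr1//= in_itv/= h1 h2.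
move=> j ji; rewrite indicE memNset ?mulr0//= in_itv/= => /andP[k1 k2].
have N0 : (0 < N)%N by rewrite (leq_trans _ (ltn_ord i)).
have mono (x y : nat) : (x <= y)%N -> t * (x%:R / N%:R) <= t * (y%:R / N%:R) :> R.
  by move=> xy; rewrite ler_wpM2l// ler_wpM2r ?invr_ge0// ler_nat.
move: ji; rewrite neq_ltn => /orP[ji|ij].
- by have := lt_le_trans h1 (le_trans k2 (mono _ _ ji)); rewrite ltxx.
- by have := lt_le_trans k1 (le_trans h2 (mono _ _ ij)); rewrite ltxx.
Qed.

Lemma step_fun_grid0 c t N s : s <= 0 -> 0 <= t -> step_fun (grid_steps c t N) s = 0.
Proof.
move=> s0 t0; rewrite /step_fun big_grid_steps big1//= => i _.
rewrite indicE memNset ?mulr0//= in_itv/= => /andP[+ _].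
by rewrite ltNge (le_trans s0)// mulr_ge0// divr_ge0.
Qed.

Lemma measurable_step_fun (p : seq (R * R * R)) : measurable_fun setT (step_fun p).
Proof.
rewrite /step_fun; apply: measurable_sum => j.
by apply: measurable_funM => //; apply: measurable_indic; exact: measurable_itv.
Qed.

Lemma step_fun_grid_sqr c t N s : 0 <= t -> (0 < N)%N -> s <= t ->
  step_fun (grid_steps c t N) s ^+ 2 =
  step_fun (grid_steps (fun i => c i ^+ 2) t N) s.
Proof.
move=> t0 N0 st; have [s0|s0] := leP s 0.
  by rewrite !step_fun_grid0// expr0n.
have [||i h1 h2] := @grid_cell t N s; rewrite ?s0//.
by rewrite !(step_fun_gridE _ t0 h1 h2).
Qed.

Lemma integral_step_grid c t N : 0 < t -> (0 < N)%N -> (forall i, 0 <= c i) ->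
  (\int[lebesgue_measure]_(s in `[0%R, t]) (step_fun (grid_steps c t N) s)%:E =
   (t * \sum_(i < N) c i / N%:R)%:E)%E.
Proof.
move=> t0 N0 c0; rewrite /step_fun.
under eq_integral do rewrite big_grid_steps /= -sumEFin.
rewrite ge0_integral_sum//=; last 2 first.
- move=> i; apply/measurable_EFinP; apply: measurable_funTS.
  by apply: measurable_funM => //; apply: measurable_indic; exact: measurable_itv.
- by move=> i x _; rewrite lee_fin mulr_ge0.
rewrite mulr_sumr -sumEFin; apply: eq_bigr => i _.
under eq_integral do rewrite EFinM.
rewrite ge0_integralZl//=; last 2 first.
- apply/measurable_EFinP; apply: measurable_funTS.
  by apply: measurable_indic; exact: measurable_itv.
- by rewrite lee_fin.
rewrite integral_indic//=.
rewrite setIidl; last first.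
  move=> x /=; rewrite !in_itv/= => /andP[h1 h2]; apply/andP; split.
    by apply/ltW/(le_lt_trans _ h1); rewrite mulr_ge0 ?(ltW t0)// divr_ge0.
  apply: (le_trans h2); rewrite ler_piMr ?(ltW t0)// ler_pdivrMr ?ltr0n//.
  by rewrite mul1r ler_nat.
rewrite lebesgue_measure_itv/= lte_fin ltr_pM2l// ltr_pM2r ?invr_gt0 ?ltr0n// ltr_nat ltnSn.
rewrite -EFinB -EFinM; congr EFin.
rewrite -mulrBr -mulrBl -natrB ?leqnSn// subSnn mul1r; ring.
Qed.

Definition kernel_steps a t N := grid_steps (fun i => (N%:R / i.+1%:R) `^ a) t N.

Lemma kernel_steps_bound a t N s : 0 < a -> 0 < t -> (0 < N)%N -> 0 <= s <= t ->
  0 <= step_fun (kernel_steps a t N) s <= (t / s) `^ a.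
Proof.
move=> a0 t0 N0 /andP[s0 st]; move: s0; rewrite le_eqVlt => /orP[/eqP<-|s0].
  by rewrite step_fun_grid0 ?(ltW t0)// lexx powR_ge0.
have [||i h1 h2] := @grid_cell t N s; rewrite ?s0//.
rewrite (step_fun_gridE _ (ltW t0) h1 h2) powR_ge0/=.
apply: (ge0_ler_powR (ltW a0)); rewrite ?nnegrE ?divr_ge0 ?(ltW s0) ?(ltW t0)//.
rewrite ler_pdivlMr// mulrAC ler_pdivrMr ?ltr0n// [N%:R * s]mulrC.
by move: h2; rewrite mulrA ler_pdivlMr ?ltr0n.
Qed.

Lemma kernelE a t s : 0 < a -> 0 <= t -> 0 <= s -> (t / s) `^ a = t `^ a * s `^ (- a).
Proof.
move=> a0 t0 s0; rewrite powRM ?invr_ge0//; congr (_ * _).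
by rewrite -powR_inv1// -powRrM mulN1r.
Qed.

Lemma measurable_kernel a t : 0 < a -> 0 <= t ->
  measurable_fun `[0, t] (fun s : R => (t / s) `^ a).
Proof.
move=> a0 t0; apply: (eq_measurable_fun (fun s : R => t `^ a * s `^ (- a))).
  by move=> s; rewrite inE/= in_itv/= => /andP[s0 _]; rewrite kernelE.
by apply: measurable_funM => //; apply: measurable_funTS; exact: measurable_powR.
Qed.

(** Only an upper bound is needed: the steps lie below the kernel, and the
    integrals of their squares already tend to t / (1 - 2 a). *)
Lemma integral_kernel_sqr_le a t : 0 < a -> a < 2^-1 -> 0 < t ->
  (\int[lebesgue_measure]_(s in `[0%R, t]) (((t / s) `^ a) ^+ 2)%:E <=
   (t / (1 - a *+ 2))%:E)%E.
Proof.
move=> a0 a1 t0; pose b := 1 - a *+ 2; have b0 : 0 < b by rewrite /b; lra.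
rewrite -integral_itv_obnd_cbnd; last first.
  apply: measurable_funS (_ : measurable_fun `[0, t] _) => //.
    by apply: subset_itvr; rewrite bnd_simp.
  by apply/measurable_EFinP; apply: measurable_funX; apply: measurable_kernel => //; exact: ltW.
have -> : (\int[lebesgue_measure]_(s in `]0%R, t]) (((t / s) `^ a) ^+ 2)%:E =
  \int[lebesgue_measure]_(s in `]0%R, t]) ((t `^ (a *+ 2))%:E * (s `^ (b - 1))%:E))%E.
  apply: eq_integral => s; rewrite inE/= in_itv/= => /andP[s0 st].
  rewrite -EFinM; congr EFin.
  rewrite -powR_mulrn ?powR_ge0// -powRrM mulr_natr kernelE ?(ltW t0) ?(ltW s0)//.
    by congr (_ * _ `^ _); rewrite /b; ring.
  by rewrite mulrn_wgt0.
rewrite ge0_integralZl//=; last 3 first.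
- by apply/measurable_EFinP; apply: measurable_funTS; exact: measurable_powR.
- by move=> x _; rewrite lee_fin powR_ge0.
- by rewrite lee_fin powR_ge0.
apply: (@le_trans _ _ ((t `^ (a *+ 2))%:E * (t `^ b / b)%:E)%E).
  by apply: lee_wpmul2l; [rewrite lee_fin powR_ge0|exact: integral_powR_le].
rewrite -EFinM lee_fin mulrA -powRD; last by rewrite (gt_eqF t0) implybT.
by rewrite /b addrC subrK powRr1// ltW.
Qed.

(** If 0 <= p <= f then (p - f)^2 <= f^2 - p^2, so that the distance to the
    kernel is controlled by the difference of the integrals of squares. *)
Lemma kernel_steps_dist a t N : 0 < a -> a < 2^-1 -> 0 < t -> (0 < N)%N ->
  (\int[lebesgue_measure]_(s in `[0%R, t])
     ((step_fun (kernel_steps a t N) s - (t / s) `^ a) ^+ 2)%:E <=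
   (t / (1 - a *+ 2) * (1 - (1 - a *+ 2) * riemann_sum a N))%:E)%E.
Proof.
move=> a0 a1 t0 N0; have b0 : 1 - a *+ 2 != 0 by rewrite gt_eqF//; lra.
have mk := measurable_kernel a0 (ltW t0).
have mp : measurable_fun `[0, t] (step_fun (kernel_steps a t N)).
  by apply: measurable_funTS; exact: measurable_step_fun.
have E2 : (\int[lebesgue_measure]_(s in `[0%R, t])
     ((step_fun (kernel_steps a t N) s) ^+ 2)%:E = (t * riemann_sum a N)%:E)%E.
  rewrite /riemann_sum -(@integral_step_grid (fun i => ((N%:R / i.+1%:R) `^ a) ^+ 2) t N t0 N0); last by move=> i; exact: sqr_ge0.
  apply: eq_integral => s; rewrite inE/= in_itv/= => /andP[_ st].
  by rewrite step_fun_grid_sqr// ltW.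
rewrite mulrBr mulr1 mulrA divfK// EFinB leeBrDr// -E2.
rewrite -ge0_integralD//=; last 4 first.
- by move=> x _; rewrite lee_fin sqr_ge0.
- apply/measurable_EFinP; apply: measurable_funX.
  by apply: measurable_funB.
- by move=> x _; rewrite lee_fin sqr_ge0.
- by apply/measurable_EFinP; apply: measurable_funX.
apply: le_trans (integral_kernel_sqr_le a0 a1 t0).
apply: ge0_le_integral => //=.
- by move=> x _; rewrite -EFinD lee_fin addr_ge0// sqr_ge0.
- apply: emeasurable_funD; apply/measurable_EFinP; apply: measurable_funX => //.
  by apply: measurable_funB.
- by apply/measurable_EFinP; apply: measurable_funX.
- move=> s; rewrite in_itv/= => s0t; rewrite -EFinD lee_fin.
  have /andP[h1 h2] := kernel_steps_bound a0 t0 N0 s0t.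
  rewrite sqrrB; nra.
Qed.

End grid.

(** The pushforward, with the measurability proof that makes it a measure. *)
(** * Scaling and moments of centred normal laws *)

Definition image_measure d d' (T1 : measurableType d) (T2 : measurableType d')
    (R : realType) (m : {measure set T1 -> \bar R}) (f : T1 -> T2)
    (mf : measurable_fun setT f) : {measure set T2 -> \bar R} :=
  measure_function_pushforward__canonical__measure_function_Measure m mf.

Section normal.
Context {R : realType}.
Local Notation mu := (@lebesgue_measure R).

(** Scaling Lebesgue measure gives a measure with the same values on
    intervals, hence the same measure. *)
Lemma lebesgue_measure_scale (c : R) (c0 : 0 < c) (A : set R) : measurable A ->
  (mu A = c%:E * mu ((fun x : R => (c * x)%R) @^-1` A))%E.
Proof.
move=> mA.
have mc : measurable_fun [set: measurableTypeR R] (fun x : measurableTypeR R => c * x : measurableTypeR R).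
  exact: mulrl_measurable.
pose nu := mscale (NngNum (ltW c0)) (image_measure mu mc).
rewrite (@lebesgue_measure_unique R nu)// => _ [[a b]] _ <- /=.
rewrite /nu /mscale /= /pushforward /=.
have -> : (fun x => c * x) @^-1` `]a, b] = `]c^-1 * a, c^-1 * b]%classic.
  by apply/seteqP; split => x /=; rewrite !in_itv/= ltr_pdivrMl// ler_pdivlMl.
rewrite !lebesgue_measure_itv/= !lte_fin ltr_pM2l ?invr_gt0//.
case: ifP => _; last by rewrite mule0.
by rewrite -!EFinB -EFinM -mulrBr mulVKf// gt_eqF.
Qed.

Lemma normal_pdf_scale (c s x : R) : 0 < c -> 0 < s ->
  c * normal_pdf 0 (c * s) (c * x) = normal_pdf 0 s x.
Proof.
move=> c0 s0; rewrite !normal_pdfE ?gt_eqF ?mulr_gt0// /normal_fun !subr0.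
have -> : - (c * x) ^+ 2 / ((c * s) ^+ 2 *+ 2) = - x ^+ 2 / (s ^+ 2 *+ 2).
  rewrite !exprMn -mulrnAr -mulrN invfM mulrACA mulfV ?mul1r//.
  by rewrite expf_neq0// gt_eqF.
rewrite mulrA; congr (_ * _); rewrite /normal_peak exprMn -mulrnAr -mulrA.
rewrite -mulrnAl mulrnAr mulrnAl -mulrnAr.
rewrite sqrtrM ?sqr_ge0// sqrtr_sqr gtr0_norm// invfM mulrA mulfV ?mul1r ?gt_eqF//.
Qed.

Lemma normal_prob_scale (c s : R) (B : set R) : 0 < c -> 0 < s -> measurable B ->
  normal_prob 0 (c * s) B = normal_prob 0 s ((fun x => c * x) @^-1` B).
Proof.
move=> c0 s0 mB; rewrite /normal_prob.
have mc : measurable_fun [set: measurableTypeR R] (fun x : measurableTypeR R => c * x : measurableTypeR R).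
  exact: mulrl_measurable.
pose nu := mscale (NngNum (ltW c0)) (image_measure mu mc).
have mpdf t : measurable_fun setT (EFin \o normal_pdf 0 t : R -> \bar R).
  by apply/measurable_EFinP; exact: measurable_normal_pdf.
rewrite (@eq_measure_integral _ (measurableTypeR R) R B nu mu); last first.
  by move=> A mA _; exact: lebesgue_measure_scale.
rewrite ge0_integral_mscale//=; last 2 first.
- by apply: measurable_funTS; exact: mpdf.
- by move=> x _; rewrite lee_fin normal_pdf_ge0.
rewrite ge0_integral_pushforward//=; last 2 first.
- by apply: measurable_funTS; exact: mpdf.
- by move=> x _; rewrite lee_fin normal_pdf_ge0.
rewrite -ge0_integralZl//=; last 4 first.
- by rewrite -[X in measurable X]setTI; exact: (mc measurableT).
- apply: measurable_funTS; apply: (measurableT_comp (mpdf _)); by apply: (mc).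
- by move=> x _; rewrite lee_fin normal_pdf_ge0.
- by rewrite lee_fin ltW.
by apply: eq_integral => x _; rewrite -EFinM normal_pdf_scale.
Qed.

Lemma ge0_integral_normal (m s : R) (f : R -> \bar R) : (forall x, 0 <= f x)%E ->
  measurable_fun setT f ->
  (\int[normal_prob m s]_x f x = \int[mu]_x (f x * (normal_pdf m s x)%:E))%E.
Proof.
move=> f0 mf.
have dom := normal_prob_dominates m s.
rewrite -(Radon_Nikodym_SigmaFinite.change_of_variables dom)//.
apply: ae_eq_integral => //.
- apply: emeasurable_funM => //.
  exact: measurable_int (Radon_Nikodym_SigmaFinite.f_integrable dom).
- apply: emeasurable_funM => //; apply/measurable_EFinP.
  exact: measurable_normal_pdf.
- apply: ae_eqe_mul2l; apply: integral_ae_eq => //=.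
  + exact: Radon_Nikodym_SigmaFinite.f_integrable.
  + by apply/measurable_EFinP; exact: measurable_normal_pdf.
  + move=> E _ mE.
    by rewrite -(Radon_Nikodym_SigmaFinite.f_integral dom).
Qed.

End normal.

Section moments.
Context {R : realType}.
Local Notation mu := (@lebesgue_measure R).

Lemma expR_ge_pow (k : nat) (y : R) : 0 <= y -> (y / k.+1%:R) ^+ k.+1 <= expR y.
Proof.
move=> y0; have -> : expR y = expR (y / k.+1%:R) ^+ k.+1.
  by rewrite -expRM_natr divfK// pnatr_eq0.
apply: lerXn2r; rewrite ?nnegrE ?expR_ge0 ?divr_ge0//.
by apply: le_trans (expR_ge1Dx _); rewrite lerDr.
Qed.

Definition std_normal_moment (k : nat) : \bar R :=
  (\int[normal_prob 0 1]_x ((x ^+ 2) ^+ k)%:E)%E.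

Lemma measurable_pow (k : nat) : measurable_fun [set: R] (fun x : R => (x ^+ 2) ^+ k).
Proof. by apply: measurable_funX; apply: measurable_funX. Qed.

Lemma std_normal_moment_ge0 k : (0 <= std_normal_moment k)%E.
Proof. by apply: integral_ge0 => x _; rewrite lee_fin exprn_ge0// sqr_ge0. Qed.

(** A polynomial is at most a constant times exp (x^2 / 4), so that the
    integrand is dominated by a multiple of the density of variance 2. *)
Lemma std_normal_moment_lty k : (std_normal_moment k.+1 < +oo)%E.
Proof.
rewrite /std_normal_moment ge0_integral_normal; last 2 first.
- by move=> x; rewrite lee_fin exprn_ge0// sqr_ge0.
- by apply/measurable_EFinP; exact: measurable_pow.
(* The standard deviation of the dominating density. *)
pose s : R := Num.sqrt 2.
have s0 : s != 0 by rewrite gt_eqF// sqrtr_gt0.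
(* With y = x^2 / 4, from (y / (k + 1))^(k + 1) <= exp y. *)
pose C := (4 * k.+1%:R) ^+ k.+1 * (normal_peak 1 / normal_peak s) : R.
have C0 : 0 <= C by rewrite mulr_ge0 ?exprn_ge0 ?divr_ge0 ?normal_peak_ge0// mulr_ge0.
apply: (@le_lt_trans _ _ (\int[mu]_x (C%:E * (normal_pdf 0 s x)%:E))%E).
  apply: ge0_le_integral => //=.
  - by move=> x _; rewrite mule_ge0 ?lee_fin ?normal_pdf_ge0// exprn_ge0// sqr_ge0.
  - apply: emeasurable_funM; apply/measurable_EFinP; first exact: measurable_pow.
    exact: measurable_normal_pdf.
  - apply: emeasurable_funM => //; apply/measurable_EFinP.
    exact: measurable_normal_pdf.
  move=> x _; rewrite -!EFinM lee_fin !normal_pdfE ?oner_eq0// /C.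
  have p0 : normal_peak s != 0 by rewrite gt_eqF// normal_peak_gt0.
  rewrite -!mulrA [(normal_peak s)^-1 * _]mulrA mulVf// mul1r.
  rewrite [leLHS]mulrCA [leRHS]mulrCA ler_wpM2l ?normal_peak_ge0//.
  rewrite /normal_fun !subr0 expr1n sqr_sqrtr//.
  have -> : - x ^+ 2 / (1 *+ 2) = - (x ^+ 2 / 4) + (- x ^+ 2 / (2 *+ 2)) by field.
  rewrite expRD mulrA ler_wpM2r ?expR_ge0//.
  have := @expR_ge_pow k (x ^+ 2 / 4) _; rewrite divr_ge0 ?sqr_ge0// => /(_ isT).
  rewrite -mulrA -invfM exprMn exprVn ler_pdivrMr ?exprn_gt0 ?mulr_gt0//.
  move=> /(ler_wpM2r (expR_ge0 (- (x ^+ 2 / 4)))) /le_trans; apply.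
  by rewrite mulrAC -expRD subrr expR0 mul1r.
rewrite ge0_integralZl//=; last 2 first.
- by apply/measurable_EFinP; exact: measurable_normal_pdf.
- by move=> x _; rewrite lee_fin normal_pdf_ge0.
by rewrite integral_normal_pdf mule1 ltry.
Qed.

End moments.

Section normal_rv.
Context {R : realType} {d : measure_display} {T : measurableType d} (P : probability T R).

Definition normal_rv (s : R) (Y : T -> R) : Prop :=
  measurable_fun setT Y /\
  forall B : set R, measurable B -> P (Y @^-1` B) = normal_prob 0 s B.

Lemma normal_rv_moment (s : R) (Y : T -> R) k : 0 < s -> normal_rv s Y ->
  (\int[P]_w ((Y w ^+ 2) ^+ k)%:E = ((s ^+ 2) ^+ k)%:E * std_normal_moment k)%E.
Proof.
move=> s0 [mY hY].
have mc : measurable_fun [set: measurableTypeR R]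
  (fun x : measurableTypeR R => s * x : measurableTypeR R) by exact: mulrl_measurable.
have mY' : measurable_fun setT (Y : T -> measurableTypeR R) by exact: mY.
have -> : (\int[P]_w ((Y w ^+ 2) ^+ k)%:E =
    \int[image_measure P mY']_x ((x ^+ 2) ^+ k)%:E)%E.
  rewrite ge0_integral_pushforward//=.
  - by apply/measurable_EFinP; exact: measurable_pow.
  - by move=> x _; rewrite lee_fin exprn_ge0// sqr_ge0.
rewrite (@eq_measure_integral _ (measurableTypeR R) R _ (image_measure (normal_prob 0 1) mc)); last first.
  move=> A mA _ /=; rewrite /pushforward hY// -normal_prob_scale ?mulr1//.
rewrite ge0_integral_pushforward//=; last 2 first.
- by apply/measurable_EFinP; exact: measurable_pow.
- by move=> x _; rewrite lee_fin exprn_ge0// sqr_ge0.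
rewrite preimage_setT -ge0_integralZl//=; last 3 first.
- by apply/measurable_EFinP; exact: measurable_pow.
- by move=> x _; rewrite lee_fin exprn_ge0// sqr_ge0.
- by rewrite lee_fin exprn_ge0// sqr_ge0.
by apply: eq_integral => x _; rewrite -EFinM [(s * x) ^+ 2]exprMn exprMn; exact: erefl.
Qed.

End normal_rv.

(** * The isometry for step functions *)

Section has_integral.
Context {R : realType} {d : measure_display} {T : measurableType d}
  (mu : {measure set T -> \bar R}) (D : set T) (mD : measurable D).
Implicit Types (f g : T -> R) (r : R).

(** Integrability together with the value of the integral: this form is
    stable under finite linear combinations. *)
Definition has_integral f r : Prop :=
  mu.-integrable D (EFin \o f) /\ (\int[mu]_(x in D) (f x)%:E = r%:E)%E.

Lemma has_integralD f g r s : has_integral f r -> has_integral g s ->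
  has_integral (fun x => f x + g x) (r + s).
Proof.
move=> [if_ ef] [ig eg]; split.
  exact: (integrableD mD if_ ig).
by rewrite (integralD mD if_ ig)/= ef eg.
Qed.

Lemma has_integralZ (k : R) f r : has_integral f r -> has_integral (fun x => k * f x) (k * r).
Proof.
move=> [if_ ef]; split; first exact: (integrableZl mD k if_).
by rewrite (integralZl mD if_)/= ef.
Qed.

Lemma has_integral_sum (I : Type) (s : seq I) (f : I -> T -> R) (r : I -> R) :
  (forall i, has_integral (f i) (r i)) ->
  has_integral (fun x => \sum_(i <- s) f i x) (\sum_(i <- s) r i).
Proof.
move=> h; elim: s => [|i s IH].
  have -> : (fun x => \sum_(i <- [::]) f i x) = cst 0 :> (T -> R).
    by apply/funext => x; rewrite big_nil.
  rewrite big_nil; split; first exact: integrable0.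
  by rewrite integral0.
have -> : (fun x => \sum_(i <- i :: s) f i x) = (fun x => f i x + \sum_(i <- s) f i x).
  by apply/funext => x; rewrite big_cons.
by rewrite big_cons; apply: has_integralD.
Qed.

Lemma ge0_has_integral f r : (forall x, 0 <= f x) -> measurable_fun D f ->
  (\int[mu]_(x in D) (f x)%:E = r%:E)%E -> has_integral f r.
Proof.
move=> f0 mf e; split => //; apply/integrableP; split; first exact/measurable_EFinP.
under eq_integral do rewrite /= ger0_norm//.
by rewrite e ltry.
Qed.

Variables (h : R -> T -> R) (S : set R) (c : R).
Hypothesis mh : forall t, S t -> measurable_fun D (h t).
Hypothesis hh : forall s t, S s -> S t -> s <= t ->
  (\int[mu]_(x in D) ((h t x - h s x) ^+ 2)%:E = ((t - s) * c)%:E)%E.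

(** The length of the intersection of the intervals from i.1.2 to i.2 and
    from j.1.2 to j.2, written with distances of end points only, so that it also
    is the covariance of the increments of a process with stationary
    increments of variance proportional to the length. *)
Definition cov_increments (i j : R * R * R) : R :=
  2^-1 * ((`|i.2 - j.1.2| + `|i.1.2 - j.2|) - (`|i.2 - j.2| + `|i.1.2 - j.1.2|)).

Definition step_cov (p : seq (R * R * R)) : R :=
  \sum_(i <- p) \sum_(j <- p) i.1.1 * j.1.1 * cov_increments i j.

Lemma has_integral_increment_sqr s t : S s -> S t ->
  has_integral (fun x => (h t x - h s x) ^+ 2) (`|t - s| * c).
Proof.
move=> Ss St; apply: ge0_has_integral.
- by move=> x; exact: sqr_ge0.
- by apply: measurable_funX; apply: measurable_funB; exact: mh.
have [st|ts] := leP s t.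
  by rewrite hh// ger0_norm// subr_ge0.
rewrite ler0_norm ?subr_le0 ?ltW// opprB -hh ?(ltW ts)//.
by apply: eq_integral => x _; rewrite -sqrrN opprB.
Qed.

(** The product of two increments is a combination of squares of increments,
    by polarization.  So the integral of the square of a step sum is
    determined by the variances of single increments alone; applied both to
    Brownian motion and to the indicators of the intervals from 0 to u
    under Lebesgue measure, this gives the isometry. *)
Lemma has_integral_step_sqr (p : seq (R * R * R)) :
  (forall j, j \in p -> S j.1.2 /\ S j.2) ->
  has_integral (fun x => (\sum_(j <- p) j.1.1 * (h j.2 x - h j.1.2 x)) ^+ 2)
    (c * step_cov p).
Proof.
move=> hp.
(* Polarization: 2 (A - B) (C - D) = (A - D)^2 + (B - C)^2 - (A - C)^2 - (B - D)^2. *)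
pose F (i j : R * R * R) x := i.1.1 * j.1.1 * (2^-1 *
   (((h i.2 x - h j.1.2 x) ^+ 2 + (h i.1.2 x - h j.2 x) ^+ 2) +
    (-1) * ((h i.2 x - h j.2 x) ^+ 2 + (h i.1.2 x - h j.1.2 x) ^+ 2))).
have hF i j : i \in p -> j \in p ->
    has_integral (F i j) (i.1.1 * j.1.1 * (c * cov_increments i j)).
  move=> /hp[i1 i2] /hp[j1 j2].
  have -> : c * cov_increments i j = 2^-1 * ((`|i.2 - j.1.2| * c + `|i.1.2 - j.2| * c) +
     (-1) * (`|i.2 - j.2| * c + `|i.1.2 - j.1.2| * c)).
    by rewrite /cov_increments; ring.
  apply: has_integralZ; apply: has_integralZ; apply: has_integralD.
    by apply: has_integralD; apply: has_integral_increment_sqr.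
  by apply: has_integralZ; apply: has_integralD; apply: has_integral_increment_sqr.
have -> : (fun x => (\sum_(j <- p) j.1.1 * (h j.2 x - h j.1.2 x)) ^+ 2) =
    (fun x => \sum_(i <- p) \sum_(j <- p) if (i \in p) && (j \in p) then F i j x else 0).
  apply/funext => x; rewrite expr2 mulr_suml big_seq [RHS]big_seq.
  apply: eq_bigr => i ip; rewrite mulr_sumr big_seq [RHS]big_seq.
  by apply: eq_bigr => j jp; rewrite ip jp/= /F; field.
have -> : c * step_cov p = \sum_(i <- p) \sum_(j <- p)
    if (i \in p) && (j \in p) then i.1.1 * j.1.1 * (c * cov_increments i j) else 0.
  rewrite /step_cov mulr_sumr big_seq [RHS]big_seq.
  apply: eq_bigr => i ip; rewrite mulr_sumr big_seq [RHS]big_seq.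
  by apply: eq_bigr => j jp; rewrite ip jp/=; ring.
apply: has_integral_sum => i; apply: has_integral_sum => j.
case: ifPn => [/andP[ip jp]|_]; first exact: hF.
split; first exact: integrable0.
by rewrite integral0.
Qed.

End has_integral.

Section step_isometry.
Context {R : realType}.
Local Notation mu := (@lebesgue_measure R).

Lemma integral_step_fun_sqr (t : R) (p : seq (R * R * R)) : 0 <= t -> steps_within t p ->
  (\int[mu]_(s in `[0%R, t]) ((step_fun p s) ^+ 2)%:E = (step_cov p)%:E)%E.
Proof.
move=> t0 /allP hp.
pose h (u s : R) : R := \1_(`]0, u] : set R) s.
have mh u : `[0, t]%classic u -> measurable_fun (`[0, t] : set R) (h u).
  by move=> _; apply: measurable_funTS; apply: measurable_indic; exact: measurable_itv.
have hE (u v x : R) : 0 <= u -> u <= v -> h v x - h u x = \1_(`]u, v] : set R) x.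
  move=> u0 uv; rewrite /h !indicE !mem_setE !in_itv/=.
  case: (ltP 0 x) => x0/=; last first.
    by rewrite subrr ltNge (le_trans x0)//= .
  case: (leP x u) => xu/=; last by rewrite subr0.
  by rewrite (le_trans xu uv) subrr.
have hh u v : `[0, t]%classic u -> `[0, t]%classic v -> u <= v ->
    (\int[mu]_(x in `[0%R, t]) ((h v x - h u x) ^+ 2)%:E = ((v - u) * 1)%:E)%E.
  rewrite /= !in_itv/= => /andP[u0 ut] /andP[v0 vt] uv.
  have -> : (\int[mu]_(x in `[0%R, t]) ((h v x - h u x) ^+ 2)%:E =
      \int[mu]_(x in `[0%R, t]) (\1_(`]u, v] : set R) x)%:E)%E.
    by apply: eq_integral => x _; rewrite hE// indicE; case: (_ \in _); rewrite ?expr1n ?expr0n.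
  rewrite integral_indic//= setIidl; last first.
    move=> x /=; rewrite !in_itv/= => /andP[ux xv].
    by rewrite (ltW (le_lt_trans u0 ux)) (le_trans xv).
  rewrite lebesgue_measure_itv/= lte_fin mulr1; case: ifP => [_|]; first by rewrite EFinB.
  move=> vu; have -> : v = u by apply/eqP; rewrite eq_le uv andbT leNgt vu.
  by rewrite subrr.
have hp' j : j \in p -> `[0, t]%classic j.1.2 /\ `[0, t]%classic j.2.
  move=> /hp/and3P[j1 j2 j3]; rewrite /= !in_itv/=; split; apply/andP; split=> //.
    exact: le_trans j3.
  exact: le_trans j2.
have [_ E] := @has_integral_step_sqr R _ (measurableTypeR R) mu `[0, t]%classic
  (measurable_itv _) h `[0, t]%classic 1 mh hh p hp'.
move: E; rewrite mul1r => <-; apply: eq_integral => x _; congr (EFin (_ ^+ 2)).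
rewrite /step_fun big_seq [RHS]big_seq; apply: eq_bigr => j /hp/and3P[j1 j2 j3].
by rewrite hE.
Qed.

End step_isometry.

(** * Mean-square distances *)

Section L2.
Context {R : realType} {d : measure_display} {T : measurableType d}
  (mu : {measure set T -> \bar R}) (D : set T) (mD : measurable D).
Implicit Types (f g h : T -> R).

Definition dist2 f g : \bar R := (\int[mu]_(x in D) ((f x - g x) ^+ 2)%:E)%E.

Lemma dist2_ge0 f g : (0 <= dist2 f g)%E.
Proof. by apply: integral_ge0 => x _; rewrite lee_fin sqr_ge0. Qed.

Lemma dist2C f g : dist2 f g = dist2 g f.
Proof. by apply: eq_integral => x _; rewrite -sqrrN opprB. Qed.

Lemma dist2_triangle f g h : measurable_fun D f -> measurable_fun D g -> measurable_fun D h ->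
  (dist2 f h <= 2%:E * (dist2 f g + dist2 g h))%E.
Proof.
move=> mf mg mh.
have mm (u v : T -> R) : measurable_fun D u -> measurable_fun D v ->
    measurable_fun D (fun x => ((u x - v x) ^+ 2)%:E : \bar R).
  by move=> mu_ mv; apply/measurable_EFinP; apply: measurable_funX; apply: measurable_funB.
rewrite /dist2 -ge0_integralD//=; [|by move=> x _; rewrite lee_fin sqr_ge0|exact: mm
  |by move=> x _; rewrite lee_fin sqr_ge0|exact: mm].
rewrite -ge0_integralZl//=; [|by apply: emeasurable_funD; exact: mm
  |by move=> x _; rewrite adde_ge0// lee_fin sqr_ge0].
apply: ge0_le_integral => //.
- by move=> x _; rewrite lee_fin sqr_ge0.
- exact: mm.
- by apply: emeasurable_funM => //; apply: emeasurable_funD; exact: mm.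
move=> x _; rewrite -EFinD -EFinM lee_fin.
have := sqr_ge0 (f x - g x - (g x - h x)); nra.
Qed.

(** Fatou's lemma for almost everywhere convergent sequences. *)
Lemma fatou_le (g : nat -> T -> R) (l : T -> R) (B : \bar R) :
  (forall n, measurable_fun D (g n)) -> (forall n x, 0 <= g n x) ->
  measurable_fun D l -> (forall x, 0 <= l x) ->
  {ae mu, forall x, D x -> g n x @[n --> \oo] --> l x} ->
  (forall n, \int[mu]_(x in D) (g n x)%:E <= B)%E ->
  (\int[mu]_(x in D) (l x)%:E <= B)%E.
Proof.
move=> mg g0 ml l0 gl gB.
have mg' n : measurable_fun D (fun x => (g n x)%:E : \bar R) by exact/measurable_EFinP.
have -> : (\int[mu]_(x in D) (l x)%:E =
    \int[mu]_(x in D) limn_einf (fun n => (g n x)%:E))%E.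
  apply: ge0_ae_eq_integral => //.
  - exact/measurable_EFinP.
  - have -> : (fun x => limn_einf (fun n => (g n x)%:E)) =
        (fun x => - limn_esup (fun n => (- (g n x)%:E)))%E.
      by apply/funext => x; rewrite -(oppeK (limn_einf _)) -limn_esupN.
    apply: (measurableT_comp (f := -%E)); first exact: oppe_measurable.
    apply: measurable_fun_limn_esup => n.
    by apply: (measurableT_comp (f := -%E)) => //; exact: oppe_measurable.
  - by move=> x _; rewrite lee_fin.
  - move=> x _; rewrite limn_einf_lim; apply: lime_ge.
      apply: ereal_nondecreasing_is_cvgn => a b ab.
      by apply: ereal_inf_le_tmp => _ /= [n bn <-]; exists n => //=; rewrite (leq_trans ab).
    by apply: nearW => n; apply: le_ereal_inf_tmp => _ /= [m _ <-]; rewrite lee_fin.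
  apply: filterS gl => x gl Dx.
  have gl' : (g n x)%:E @[n --> \oo] --> (l x)%:E.
    by apply/fine_cvgP; split; [exact: nearW|exact: gl].
  by rewrite (cvg_limn_einf_sup gl').
apply: (le_trans (fatou mu mD mg' _)); first by move=> n x _; rewrite lee_fin.
rewrite limn_einf_lim; apply: lime_le.
  apply: ereal_nondecreasing_is_cvgn => a b ab.
  by apply: ereal_inf_le_tmp => _ /= [n bn <-]; exists n => //=; rewrite (leq_trans ab).
by apply: nearW => n; apply: (le_trans _ (gB n)); apply: ereal_inf_lbound; exists n => /=.
Qed.

Lemma dist2_eq0 f g : measurable_fun D f -> measurable_fun D g -> dist2 f g = 0%E ->
  {ae mu, forall x, D x -> f x = g x}.
Proof.
move=> mf mg h0.
have m2 : measurable_fun D (fun x => ((f x - g x) ^+ 2)%:E : \bar R).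
  by apply/measurable_EFinP; apply: measurable_funX; apply: measurable_funB.
have : (\int[mu]_(x in D) `|((f x - g x) ^+ 2)%:E| = 0)%E.
  by rewrite -h0; apply: eq_integral => x _; rewrite /= ger0_norm// sqr_ge0.
move/(ae_eq_integral_abs mu mD m2); apply: filterS => x h Dx.
by have := h Dx => -[] /eqP; rewrite sqrf_eq0 subr_eq0 => /eqP.
Qed.

End L2.

(** * Wiener integrals: uniqueness and pathwise limits *)

Section wiener.
Context {R : realType} {d : measure_display} {T : measurableType d} (P : probability T R).
Local Notation mu := (@lebesgue_measure R).
Implicit Types (w : R -> T -> R) (t : R) (p q : seq (R * R * R)) (f : R -> R).

(** What the isometry and the moment bounds use of one coordinate of a
    Brownian motion. *)
Definition gaussian_increments w : Prop :=
  (forall t, 0 <= t -> measurable_fun setT (w t)) /\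
  (forall s t, 0 <= s -> s < t -> normal_rv P (Num.sqrt (t - s)) (fun o => w t o - w s o)).

(** The second moment of N(0, 1).  It equals 1, but as the factor of the
    isometry only its finiteness matters. *)
Definition std_normal_variance : R := fine (std_normal_moment 1).
Local Notation c := std_normal_variance.

Lemma std_normal_varianceE : std_normal_moment 1 = c%:E.
Proof.
rewrite /c fineK// ge0_fin_numE; first exact: std_normal_moment_lty.
exact: std_normal_moment_ge0.
Qed.

Lemma std_normal_variance_ge0 : 0 <= c.
Proof. by rewrite -lee_fin -std_normal_varianceE std_normal_moment_ge0. Qed.

Lemma steps_withinP t p j : steps_within t p -> j \in p ->
  [/\ 0 <= j.1.2, j.1.2 <= j.2, j.2 <= t & 0 <= j.2].
Proof.
move=> /allP h /h /and3P[h1 h2 h3]; split => //; exact: le_trans h2.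
Qed.

Lemma measurable_step_integral w t p : gaussian_increments w -> steps_within t p ->
  measurable_fun setT (step_integral w p).
Proof.
move=> [mw _] hp; rewrite /step_integral.
have -> : (fun o => \sum_(j <- p) j.1.1 * (w j.2 o - w j.1.2 o)) =
    (fun o => \sum_(j <- p) (if j \in p then j.1.1 * (w j.2 o - w j.1.2 o) else 0)).
  apply/funext => o; rewrite big_seq [RHS]big_seq.
  by apply: eq_bigr => j ->.
apply: measurable_sum => j; case: (boolP (j \in p)) => [jp|_]; last exact: measurable_cst.
have [h1 h2 h3 h4] := steps_withinP hp jp.
by apply: measurable_funM => //; apply: measurable_funB; exact: mw.
Qed.

Lemma integral_increment_sqr w s t : gaussian_increments w -> 0 <= s -> s <= t ->
  (\int[P]_o ((w t o - w s o) ^+ 2)%:E = ((t - s) * c)%:E)%E.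
Proof.
move=> [_ hw] s0; rewrite le_eqVlt => /predU1P[<-|st].
  rewrite subrr mul0r; apply: integral0_eq => o _.
  by rewrite subrr expr0n.
have s1 : 0 < Num.sqrt (t - s) by rewrite sqrtr_gt0 subr_gt0.
have ts : 0 <= t - s by rewrite subr_ge0 ltW.
have -> : ((t - s) * c)%:E = (((Num.sqrt (t - s) ^+ 2) ^+ 1)%:E * std_normal_moment 1)%E.
  by rewrite std_normal_varianceE expr1 sqr_sqrtr.
exact: (normal_rv_moment 1 s1 (hw s t s0 st)).
Qed.

Lemma step_isometry w t p : gaussian_increments w -> 0 <= t -> steps_within t p ->
  (\int[P]_o ((step_integral w p o) ^+ 2)%:E =
   c%:E * \int[mu]_(s in `[0%R, t]) ((step_fun p s) ^+ 2)%:E)%E.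
Proof.
move=> hw t0 hp; rewrite integral_step_fun_sqr// -EFinM.
have [_ <-] := @has_integral_step_sqr R _ T P setT measurableT w [set t | 0 <= t] c
   hw.1 (fun s t s0 _ st => integral_increment_sqr hw s0 st) p
   (fun j jp => let: And4 h1 _ _ h4 := steps_withinP hp jp in conj h1 h4).
by [].
Qed.

Definition neg_steps q : seq (R * R * R) := [seq (- j.1.1, j.1.2, j.2) | j <- q].

(** The isometry for the difference of two step functions, encoded as the
    concatenation of one list with the negative of the other. *)
Lemma dist2_step_isometry w t p q : gaussian_increments w -> 0 <= t ->
  steps_within t p -> steps_within t q ->
  dist2 P setT (step_integral w p) (step_integral w q) =
  (c%:E * dist2 mu `[0%R, t] (step_fun p) (step_fun q))%E.
Proof.
move=> hw t0 hp hq.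
have hpq : steps_within t (p ++ neg_steps q).
  rewrite /steps_within all_cat; apply/andP; split => //.
  by rewrite all_map; exact: hq.
have E1 o : step_integral w (p ++ neg_steps q) o = step_integral w p o - step_integral w q o.
  rewrite /step_integral big_cat/= big_map/= -sumrN; congr (_ + _).
  by apply: eq_bigr => j _; rewrite mulNr.
have E2 s : step_fun (p ++ neg_steps q) s = step_fun p s - step_fun q s.
  rewrite /step_fun big_cat/= big_map/= -sumrN; congr (_ + _).
  by apply: eq_bigr => j _; rewrite mulNr.
transitivity (\int[P]_o ((step_integral w (p ++ neg_steps q) o) ^+ 2)%:E)%E.
  by apply: eq_integral => o _; rewrite E1.
rewrite (step_isometry hw t0 hpq); congr (_ * _)%E.
by apply: eq_integral => s _; rewrite E2.
Qed.

Lemma dist2_step_le w t p q f : gaussian_increments w -> 0 <= t ->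
  steps_within t p -> steps_within t q -> measurable_fun `[0, t] f ->
  (dist2 P setT (step_integral w p) (step_integral w q) <=
   c%:E * (2%:E * (dist2 mu `[0%R, t] (step_fun p) f + dist2 mu `[0%R, t] (step_fun q) f)))%E.
Proof.
move=> hw t0 hp hq mf; rewrite (dist2_step_isometry hw t0 hp hq).
rewrite lee_wpmul2l ?lee_fin ?std_normal_variance_ge0//.
rewrite [dist2 mu `[0%R, t] (step_fun q) f]dist2C.
by apply: dist2_triangle => //; apply: measurable_funTS; exact: measurable_step_fun.
Qed.

Lemma cvge0_combine (k : R) (u v : nat -> \bar R) : (u n @[n --> \oo] --> 0)%E ->
  (v n @[n --> \oo] --> 0)%E -> (k%:E * (u n + v n) @[n --> \oo] --> 0)%E.
Proof.
move=> hu hv; rewrite -[X in _ --> X](mule0 k%:E); apply: cvgeZl => //.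
by rewrite -[X in _ --> X](adde0 0%E); apply: cvgeD.
Qed.

(** Two approximating sequences converge to the same function, so that by the
    isometry their integrals are asymptotically close in mean square. *)
Lemma wiener_integral_unique w t f Y Y' : gaussian_increments w -> 0 <= t ->
  is_wiener_integral P w t f Y -> is_wiener_integral P w t f Y' ->
  {ae P, forall o, Y o = Y' o}.
Proof.
move=> hw t0 [mf mY [p [hp pf pY]]] [_ mY' [q [hq qf qY]]].
have mI n := measurable_step_integral hw (hp n).
have mJ n := measurable_step_integral hw (hq n).
have : dist2 P setT Y Y' = 0%E.
  apply/eqP; rewrite eq_le dist2_ge0 andbT.
  have bound n : (dist2 P setT Y Y' <= 2%:E * (dist2 P setT (step_integral w (p n)) Y +
      2%:E * (c%:E * (2%:E * (dist2 mu `[0%R, t] (step_fun (p n)) f +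
         dist2 mu `[0%R, t] (step_fun (q n)) f)) +
      dist2 P setT (step_integral w (q n)) Y')))%E.
    apply: (le_trans (@dist2_triangle _ _ _ P setT measurableT Y (step_integral w (p n)) Y' mY (mI n) mY')).
    rewrite lee_wpmul2l// dist2C leeD2l//.
    apply: (le_trans (@dist2_triangle _ _ _ P setT measurableT _ (step_integral w (q n)) Y' (mI n) (mJ n) mY')).
    by rewrite lee_wpmul2l// leeD2r//; exact: dist2_step_le.
  have lim0 : (2%:E * (dist2 P setT (step_integral w (p n)) Y +
      2%:E * (c%:E * (2%:E * (dist2 mu `[0%R, t] (step_fun (p n)) f +
         dist2 mu `[0%R, t] (step_fun (q n)) f)) +
      dist2 P setT (step_integral w (q n)) Y')) @[n --> \oo] --> 0)%E.
    apply: cvge0_combine => //; apply: cvge0_combine => //.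
    rewrite -[X in _ --> X](mule0 c%:E); apply: cvgeZl => //.
    exact: cvge0_combine.
  rewrite -(cvg_lim _ lim0)//; apply: lime_ge; first by apply/cvg_ex; eexists; exact: lim0.
  exact: nearW.
move/(dist2_eq0 measurableT mY mY'); apply: filterS => o; exact.
Qed.

(** Almost sure limits of the step integrals may replace mean-square limits:
    the isometry bounds the distance of the n-th and m-th integrals, and
    Fatou's lemma lets m tend to infinity in this bound. *)
Lemma wiener_integral_of_ae_limit w t f (Y : T -> R) (p : nat -> seq (R * R * R)) :
  gaussian_increments w -> 0 <= t ->
  measurable_fun `[0, t] f -> measurable_fun setT Y ->
  (forall n, steps_within t (p n)) ->
  (dist2 mu `[0%R, t] (step_fun (p n)) f @[n --> \oo] --> 0)%E ->
  {ae P, forall o, step_integral w (p n) o @[n --> \oo] --> Y o} ->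
  is_wiener_integral P w t f Y.
Proof.
move=> hw t0 mf mY hp pf pY; split => //; exists p; split => //.
have mI n := measurable_step_integral hw (hp n).
pose del n := dist2 mu `[0%R, t] (step_fun (p n)) f.
have bound n (e : R) : 0 < e ->
    (dist2 P setT (step_integral w (p n)) Y <= c%:E * (2%:E * (del n + e%:E)))%E.
  move=> e0.
  (* Fatou's lemma is applied to the sequence shifted by M, the terms of which
      are already close to f. *)
  have [M _ hM] : \forall m \near \oo, (del m <= e%:E)%E.
    move/fine_cvgP : pf => [ff /cvgrPdist_le/(_ e e0) h].
    near=> m; have fm : del m \is a fin_num by near: m.
    have hm : `|0 - fine (del m)| <= e by near: m; exact: h.
    by rewrite -(fineK fm) lee_fin; move: hm; rewrite sub0r normrN; apply: le_trans; exact: ler_norm.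
  apply: (@fatou_le _ _ _ P setT measurableT
     (fun m o => (step_integral w (p n) o - step_integral w (p (m + M)%N) o) ^+ 2)).
  - by move=> m; apply: measurable_funX; apply: measurable_funB.
  - by move=> m x; exact: sqr_ge0.
  - by apply: measurable_funX; apply: measurable_funB.
  - by move=> x; exact: sqr_ge0.
  - apply: filterS pY => o ho _.
    have ho' : step_integral w (p (m + M)%N) o @[m --> \oo] --> Y o.
      by rewrite (cvg_shiftn M (fun m => step_integral w (p m) o)).
    rewrite expr2; under eq_fun do rewrite expr2.
    by apply: cvgM; apply: cvgB => //; exact: cvg_cst.
  - move=> m; apply: (le_trans (dist2_step_le hw t0 (hp n) (hp (m + M)%N) mf)).
    rewrite lee_wpmul2l ?lee_fin ?std_normal_variance_ge0// lee_wpmul2l//.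
    by rewrite leeD2l//; apply: hM => /=; rewrite leq_addl.
have [ff dn] := (fine_cvgP _ _).1 pf.
apply: (@squeeze_cvge _ _ _ _ (cst 0%E) _ (fun n => c%:E * (2%:E * (del n + del n))))%E.
- near=> n; rewrite dist2_ge0/=; apply/lee_addgt0Pr => e e0.
  have fd : del n \is a fin_num by near: n.
  have e1 : 0 < e / (2 * (c + 1)).
    by rewrite divr_gt0// mulr_gt0// ltr_wpDl// std_normal_variance_ge0.
  apply: (le_trans (bound n _ e1)).
  rewrite -(fineK fd) -!EFinD -!EFinM lee_fin.
  have c0 := std_normal_variance_ge0.
  have d0 : 0 <= fine (del n) by rewrite fine_ge0// dist2_ge0.
  have h2 : c * (2 * (e / (2 * (c + 1)))) <= e.
    have -> : c * (2 * (e / (2 * (c + 1)))) = e * (c / (c + 1)) by field; rewrite gt_eqF// ltr_wpDl.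
    by rewrite ler_piMr ?(ltW e0)// ler_pdivrMr ?ltr_wpDl// mul1r lerDl.
  have h3 : 0 <= c * (2 * fine (del n)) by rewrite mulr_ge0// mulr_ge0.
  set u := e / _ in h2 *; rewrite !mulrDr; lra.
- exact: cvg_cst.
- rewrite -[X in _ --> X](mule0 c%:E); apply: cvgeZl => //.
  by apply: cvge0_combine.
Unshelve. all: by end_near. Qed.

End wiener.

(** * Hoelder regularity of Brownian paths *)

Section kolmogorov.
Context {R : realType} {d : measure_display} {T : measurableType d} (P : probability T R).
Implicit Types (w : R -> T -> R) (g K : R).

Lemma nneseries_geometric_lty (A q : R) : 0 <= A -> 0 <= q < 1 ->
  (\sum_(m <oo) (A * q ^+ m)%:E < +oo)%E.
Proof.
move=> A0 /andP[q0 q1].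
have q1' : `|q| < 1 by rewrite ger0_norm.
apply: (@le_lt_trans _ _ (A / (1 - q))%:E); last by rewrite ltry.
apply: lime_le; first by apply: is_cvg_nneseries => n _ _; rewrite lee_fin mulr_ge0// exprn_ge0.
apply: nearW => n; rewrite sumEFin lee_fin.
rewrite -(cvg_lim (@Rhausdorff R) (@cvg_geometric_series R A q q1')).
apply: (@nondecreasing_cvgn_le R (series (geometric A q))); last exact: is_cvg_geometric_series.
apply/nondecreasing_seqP => m; rewrite /series /= big_nat_recr//= lerDl.
by rewrite mulr_ge0// exprn_ge0.
Qed.

Lemma pow_bound (x S : R) p : 0 <= x -> (x ^+ 2) ^+ p.+1 <= S -> x <= S + 1.
Proof.
move=> x0 h; have S0 : 0 <= S by apply: le_trans h; rewrite exprn_ge0// sqr_ge0.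
have [x1|x1] := leP x 1; first by rewrite (le_trans x1)// lerDr.
apply: (@le_trans _ _ S); last by rewrite lerDl.
by apply: le_trans h; rewrite -exprM; apply: ler_eXnr => //; exact: ltW.
Qed.

(** The probabilistic half of Kolmogorov's criterion.  Multiply the
    increments of order m by 2^(g m) and add up their moments of order
    2 (p + 1) over the 2^m cells: since g < 1/2, for a large p the result is
    of order q^m with q < 1.  So the sum over all orders has a finite expectation and is almost surely
    finite, and it bounds every single term. *)
Lemma dyadic_increments_bound w g K : gaussian_increments P w -> 0 <= g -> g < 2^-1 -> 0 < K ->
  {ae P, forall o, exists2 C, 0 <= C & forall m k, (k < 2 ^ m)%N ->
     `|w (K * (k.+1%:R / 2 ^+ m)) o - w (K * (k%:R / 2 ^+ m)) o| <=
       C * (2 `^ (- g)) ^+ m}.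
Proof.
move=> [mw hw] g0 g1 K0.
pose t m (k : nat) : R := K * (k%:R / 2 ^+ m).
have t0 m k : 0 <= t m k by rewrite mulr_ge0 ?divr_ge0 ?exprn_ge0// ltW.
have tS m k : t m k.+1 - t m k = K / 2 ^+ m.
  by rewrite /t -mulrBr -mulrBl -natrB// subSnn mul1r.
have sqM (x y : R) n : ((x * y) ^+ 2) ^+ n = (y ^+ 2) ^+ n * (x ^+ 2) ^+ n.
  by rewrite (mulrC x) [(_ * _) ^+ 2]exprMn [LHS]exprMn.
(* This p gives (1 - 2 g) (p + 1) > 1, that is, q < 1 below. *)
pose p := Num.trunc (1 - g *+ 2)^-1.
pose b : R := 2 `^ g.
have b0 : 0 <= b by exact: powR_ge0.
pose Dl m k o := (w (t m k.+1) o - w (t m k) o) * b ^+ m.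
have mDl m k : measurable_fun setT (Dl m k).
  by apply: measurable_funM => //; apply: measurable_funB; exact: mw.
pose F m o : \bar R := (\sum_(k < 2 ^ m) ((Dl m k o ^+ 2) ^+ p.+1)%:E)%E.
have F0 m o : (0 <= F m o)%E.
  by apply: sume_ge0 => k _; rewrite lee_fin exprn_ge0// sqr_ge0.
have mF m : measurable_fun setT (F m).
  apply: emeasurable_sum => k; apply/measurable_EFinP.
  by apply: measurable_funX; apply: measurable_funX.
pose M : R := fine (std_normal_moment p.+1).
have ME : std_normal_moment p.+1 = M%:E.
  rewrite /M fineK// ge0_fin_numE; first exact: std_normal_moment_lty.
  exact: std_normal_moment_ge0.
have M0 : 0 <= M by rewrite -lee_fin -ME std_normal_moment_ge0.
pose q : R := 2 * (b ^+ 2 / 2) ^+ p.+1.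
have q0 : 0 <= q by rewrite mulr_ge0// exprn_ge0// divr_ge0// sqr_ge0.
have q1 : q < 1.
  have -> : q = 2 `^ (1 + (g *+ 2 - 1) * p.+1%:R).
    have bE : b ^+ 2 = 2 `^ (g *+ 2) by rewrite /b -powR_mulrn ?powR_ge0// -powRrM mulr_natr.
    rewrite /q bE.
    have -> : 2 `^ (g *+ 2) / 2 = 2 `^ (g *+ 2 - 1) :> R.
      by rewrite powRB ?powRr1// pnatr_eq0 implybT.
    rewrite -powR_mulrn ?powR_ge0// -powRrM powRD; last by rewrite pnatr_eq0 implybT.
    by rewrite powRr1.
  have h : 0 < 1 - g *+ 2 by lra.
  have hp : 1 < (1 - g *+ 2) * p.+1%:R.
    have := @truncn_itv R (1 - g *+ 2)^-1; rewrite invr_ge0 ltW// => /(_ isT)/andP[_ h3].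
    by rewrite -[ltLHS](mulfV (lt0r_neq0 h)) ltr_pM2l.
  have e0 : 1 + (g *+ 2 - 1) * p.+1%:R < 0 by rewrite -[g *+ 2 - 1]opprB mulNr subr_lt0.
  rewrite -[ltRHS](powRr0 2) /powR pnatr_eq0/= ltr_expR mul0r.
  by rewrite nmulr_rlt0// ln_gt0// ltr1n.
pose A := K ^+ p.+1 * M.
have A0 : 0 <= A by rewrite mulr_ge0// exprn_ge0// ltW.
have intF m : (\int[P]_o F m o = (A * q ^+ m)%:E)%E.
  rewrite ge0_integral_sum//=; last 2 first.
  - move=> k; apply/measurable_EFinP.
    by apply: measurable_funX; apply: measurable_funX.
  - by move=> k o _; rewrite lee_fin exprn_ge0// sqr_ge0.
  have E (k : 'I_(2 ^ m)) : (\int[P]_o ((Dl m k o ^+ 2) ^+ p.+1)%:E =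
     (A * (((b ^+ 2 / 2) ^+ p.+1) ^+ m))%:E)%E.
    have lt : t m k < t m k.+1 by rewrite -subr_gt0 tS divr_gt0// exprn_gt0.
    have s0 : 0 < Num.sqrt (t m k.+1 - t m k) by rewrite sqrtr_gt0 subr_gt0.
    have N := hw _ _ (t0 m k) lt.
    have := normal_rv_moment p.+1 s0 N.
    rewrite ME sqr_sqrtr ?subr_ge0 ?(ltW lt)// => h.
    transitivity ((((b ^+ m) ^+ 2) ^+ p.+1)%:E * (((t m k.+1 - t m k) ^+ p.+1)%:E * M%:E))%E.
      rewrite -h -ge0_integralZl//=.
      - by apply: eq_integral => o _; rewrite -EFinM /Dl sqM.
      - apply/measurable_EFinP; apply: measurable_funX; apply: measurable_funX.
        by apply: measurable_funB; exact: mw.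
      - by move=> o _; rewrite lee_fin exprn_ge0// sqr_ge0.
      - by rewrite lee_fin exprn_ge0// sqr_ge0.
    rewrite -!EFinM tS; congr EFin.
    rewrite /A (exprAC b m 2) (exprAC _ m p.+1) -exprVn.
    rewrite [(K * _) ^+ _]exprMn (exprAC _ m p.+1).
    rewrite [(b ^+ 2 / 2) ^+ _]exprMn [(_ * _) ^+ m]exprMn; ring.
  rewrite (eq_bigr _ (fun k _ => E k)) sumEFin sumr_const card_ord; congr EFin.
  by rewrite -[LHS]mulr_natr natrX /q [in RHS]exprMn; ring.
have ae : {ae P, forall o, (\sum_(m <oo) F m o)%E \is a fin_num}.
  have int : P.-integrable setT (fun o => \sum_(m <oo) F m o)%E.
    apply/integrableP; split.
      by apply: ge0_emeasurable_sum.
    have -> : (\int[P]_o `|\sum_(m <oo) F m o| = \int[P]_o \sum_(m <oo) F m o)%E.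
      by apply: eq_integral => o _; rewrite gee0_abs// nneseries_ge0.
    rewrite integral_nneseries//.
    under eq_eseriesr do rewrite intF.
    by apply: nneseries_geometric_lty => //; rewrite q0.
  by have := integrable_ae measurableT int; apply: filterS => o; exact.
apply: filterS ae => o fo.
pose S := fine (\sum_(m <oo) F m o)%E.
have S0 : 0 <= S by rewrite fine_ge0// nneseries_ge0.
exists (S + 1); first by rewrite addr_ge0.
move=> m k km.
have h : ((`|Dl m k o|) ^+ 2) ^+ p.+1 <= S.
  rewrite -lee_fin fineK// real_normK ?num_real//.
  apply: (@le_trans _ _ (F m o)).
    rewrite /F (bigD1 (Ordinal km))//= leeDl// sume_ge0// => i _.
    by rewrite lee_fin exprn_ge0// sqr_ge0.
  apply: (le_trans _ (@nneseries_lim_ge R (F^~ o) xpredT 0 m.+1 _)) => //.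
  by rewrite big_nat_recr//= leeDr// sume_ge0.
have := pow_bound (normr_ge0 _) h.
by rewrite /Dl normrM (ger0_norm (exprn_ge0 _ b0)) powRN exprVn ler_pdivlMr//.
Qed.

Lemma hoelder_on_weaken (C g g' K : R) (v : R -> R) : 0 <= C -> 0 <= g' -> g' <= g ->
  0 < K -> hoelder_on `[0, K] C g v -> hoelder_on `[0, K] (C * K `^ (g - g')) g' v.
Proof.
move=> C0 g0 gg K0 h x y Kx Ky; apply: (le_trans (h x y Kx Ky)).
rewrite -mulrA ler_wpM2l//.
have [->|xy] := eqVneq x y.
  rewrite subrr normr0 /powR eqxx.
  case: (eqVneq g 0) => [g00|_]; last by rewrite mulr_ge0// ?powR_ge0.
  have -> : g' = 0 by apply/eqP; rewrite eq_le g0 -g00 gg.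
  by rewrite g00 subrr eqxx (gt_eqF K0) mul0r expR0 mul1r.
have -> : `|x - y| `^ g = `|x - y| `^ (g - g') * `|x - y| `^ g'.
  by rewrite -powRD ?subrK// normr_eq0 subr_eq0 xy implybT.
rewrite ler_wpM2r ?powR_ge0// ge0_ler_powR ?nnegrE ?subr_ge0 ?(ltW K0)//.
by move: Kx Ky; rewrite /= !in_itv/= ler_norml => /andP[? ?] /andP[? ?]; lra.
Qed.

Lemma hoelder_on_sub (C g K K' : R) (v : R -> R) : K' <= K ->
  hoelder_on `[0, K] C g v -> hoelder_on `[0, K'] C g v.
Proof.
move=> KK h x y; rewrite /= !in_itv/= => /andP[x0 xK] /andP[y0 yK].
by apply: h; rewrite /= in_itv/= ?x0 ?y0 /= (le_trans _ KK).
Qed.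

Lemma brownian_hoelder_fixed w g K : gaussian_increments P w -> 0 < g -> g < 2^-1 -> 0 < K ->
  {ae P, forall o, {within `[0, +oo[, continuous (fun t => w t o)}} ->
  {ae P, forall o, exists C, 0 <= C /\ hoelder_on `[0, K] C g (fun t => w t o)}.
Proof.
move=> hw g0 g1 K0 cw.
have := dyadic_increments_bound hw (ltW g0) g1 K0.
apply: filterS2 cw => o co [C C0 hC].
have cx : {within `[0, 1], continuous (fun u => w (K * u) o)}.
  apply/subspace_continuousP => u; rewrite /= in_itv/= => /andP[u0 u1].
  apply: (@cvg_comp _ _ _ (fun u => K * u) (fun t => w t o) _ (within `[0, +oo[ (nbhs (K * u)))).
    move=> B hB; have cK : (fun u => K * u) @ u --> K * u.
      by apply: cvgM; [exact: cvg_cst|exact: cvg_id].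
    have : nbhs u ((fun u => K * u) @^-1` [set t | `[0, +oo[%classic t -> B t]).
      by apply: cK; exact: hB.
    apply: filterS => v h; rewrite /= in_itv/= => /andP[v0 v1]; apply: h.
    by rewrite /= in_itv/= andbT mulr_ge0// ltW.
  move/subspace_continuousP : co; apply.
  by rewrite /= in_itv/= andbT mulr_ge0// ltW.
have [C' [C'0 hC']] := dyadic_hoelder g0 C0 cx hC.
exists (C' * (K^-1) `^ g); split; first by rewrite mulr_ge0// powR_ge0.
move=> x y; rewrite /= !in_itv/= => /andP[x0 xK] /andP[y0 yK].
have K1 : 0 <= K^-1 by rewrite invr_ge0 ltW.
have := hC' (x / K) (y / K).
rewrite /= !in_itv/= !divr_ge0 ?(ltW K0)//= !ler_pdivrMr// mul1r => /(_ xK yK).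
rewrite !(mulrC K) !divfK ?gt_eqF//.
have -> : `|x / K - y / K| = K^-1 * `|x - y|.
  by rewrite -mulrBl normrM (ger0_norm K1) mulrC.
by rewrite powRM// mulrA.
Qed.

(** Countably many exponents, increasing to 1/2, and countably many lengths
    suffice, so that the exceptional null set does not depend on them. *)
Lemma brownian_hoelder w : gaussian_increments P w ->
  {ae P, forall o, {within `[0, +oo[, continuous (fun t => w t o)}} ->
  {ae P, forall o, forall K g, 0 < K -> 0 < g -> g < 2^-1 ->
     exists C, 0 <= C /\ hoelder_on `[0, K] C g (fun t => w t o)}.
Proof.
move=> hw cw.
(* The shift by 3 makes the exponents positive. *)
pose gj (j : nat) : R := 2^-1 - j.+3%:R^-1.
have gj0 j : 0 < gj j by rewrite subr_gt0 ltf_pV2 ?posrE// ltr_nat.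
have gj1 j : gj j < 2^-1 by rewrite gtrBl invr_gt0.
have := ae_foralln (fun n => ae_foralln (fun j =>
  brownian_hoelder_fixed hw (gj0 j) (gj1 j) (ltr0Sn R n) cw)).
apply: filterS => o h K g K0 g0 g1.
have d0 : 0 < 2^-1 - g by rewrite subr_gt0.
have [j gj_] : exists j, g <= gj j.
  exists (Num.trunc (2^-1 - g)^-1).
  have := @truncn_itv R (2^-1 - g)^-1; rewrite invr_ge0 (ltW d0) => /(_ isT)/andP[_ h1].
  rewrite lerBrDr -lerBrDl -[leRHS]invrK lef_pV2 ?posrE ?invr_gt0//.
  by apply: (le_trans (ltW h1)); rewrite ler_nat ltnS (leq_trans (leqnSn _)).
have /andP[_ h2] := truncn_itv (ltW K0).
have [C [C0 hC]] := h (Num.trunc K) j.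
have hC' := hoelder_on_sub (ltW h2) hC.
exists (C * K `^ (gj j - g)); split; first by rewrite mulr_ge0// powR_ge0.
exact: (hoelder_on_weaken C0 (ltW g0) gj_ K0 hC').
Qed.

End kolmogorov.

(** * Integrals of possibly non-measurable functions *)

Section null_modification.
Context {R : realType} {d : measure_display} {T : measurableType d}
  (mu : {measure set T -> \bar R}).
Import HBNNSimple.

(** A simple function below f, restricted to the complement of N, is below g
    and has the same integral. *)
Lemma ge0_integral_null_le (f g : T -> \bar R) (N : set T) : measurable N -> mu N = 0%E ->
  (forall x, 0 <= f x)%E -> (forall x, 0 <= g x)%E -> (forall x, ~ N x -> f x = g x) ->
  (\int[mu]_x f x <= \int[mu]_x g x)%E.
Proof.
move=> mN N0 f0 g0 fg; rewrite !ge0_integralTE//; apply: ge_ereal_sup => _ [h /= hf <-].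
have mNC : measurable (~` N) by exact: measurableC.
(* The product of h and the indicator of the complement of N. *)
pose k := proj_nnsfun h mNC.
have kE x : k x = h x * \1_(~` N) x by [].
have -> : sintegral mu h = sintegral mu k.
  rewrite -!integralT_nnsfun; apply: ge0_ae_eq_integral => //.
  - by apply/measurable_EFinP.
  - by apply/measurable_EFinP.
  - by move=> x _; rewrite lee_fin.
  - by move=> x _; rewrite lee_fin.
  exists N; split => // x; apply: contra_notP => Nx _.
  by rewrite kE indicE mem_set// mulr1.
apply: ereal_sup_ubound; exists k => // x.
change ((h x * \1_(~` N) x)%:E <= g x)%E; rewrite indicE; have [/set_mem Nx|_] := boolP (x \in ~` N).
  by rewrite mulr1 -fg.
by rewrite mulr0 g0.
Qed.

Lemma integral_null_eq (f g : T -> \bar R) (N : set T) : measurable N -> mu N = 0%E ->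
  (forall x, ~ N x -> f x = g x) -> (\int[mu]_x f x = \int[mu]_x g x)%E.
Proof.
move=> mN N0 fg.
have H (u v : T -> \bar R) : (forall x, 0 <= u x)%E -> (forall x, 0 <= v x)%E ->
    (forall x, ~ N x -> u x = v x) -> (\int[mu]_x u x = \int[mu]_x v x)%E.
  move=> u0 v0 uv; apply/eqP; rewrite eq_le.
  rewrite (ge0_integral_null_le mN N0 u0 v0 uv)/=.
  by apply: (ge0_integral_null_le mN N0 v0 u0) => x Nx; rewrite uv.
rewrite integralE [RHS]integralE; congr (_ - _)%E; apply: H => // x Nx.
- by rewrite !funeposE fg.
- by rewrite !funenegE fg.
Qed.

End null_modification.

Section bounded_convergence.
Context {R : realType} {d : measure_display} {T : measurableType d} (P : probability T R).

(** The limit l is not assumed to be measurable: a functional of paths is only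
    controlled on a set of full measure, where the paths are continuous. *)
Lemma bounded_cvg_integral (f : nat -> T -> R) (l : T -> R) (M : R) :
  (forall n, measurable_fun setT (f n)) -> (forall n x, `|f n x| <= M) ->
  {ae P, forall x, f n x @[n --> \oo] --> l x} ->
  (\int[P]_x (f n x)%:E @[n --> \oo] --> \int[P]_x (l x)%:E)%E.
Proof.
move=> mf fM [N [mN N0 hN]].
have mI : measurable_fun setT (\1_(~` N) : T -> R).
  by apply: measurable_indic; exact: measurableC.
have hl x : f n x * \1_(~` N) x @[n --> \oo] --> l x * \1_(~` N) x.
  rewrite indicE; have [/set_mem Nx|_] := boolP (x \in ~` N).
    apply: cvgM; last exact: cvg_cst.
    by apply: contrapT => h; apply: Nx; exact: hN.
  rewrite mulr0; under eq_fun do rewrite mulr0.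
  exact: cvg_cst.
have E : (\int[P]_x (l x)%:E = \int[P]_x (l x * \1_(~` N) x)%:E)%E.
  by apply: (integral_null_eq mN N0) => x Nx; rewrite indicE mem_set// mulr1.
rewrite E.
have mf' n : measurable_fun setT (fun x => f n x * \1_(~` N) x).
  exact: measurable_funM.
have ml : measurable_fun setT (fun x => l x * \1_(~` N) x).
  by apply: (measurable_fun_cvg mf') => x _; exact: hl.
have -> : (fun n => \int[P]_x (f n x)%:E)%E = (fun n => \int[P]_x (f n x * \1_(~` N) x)%:E)%E.
  apply/funext => n; apply: (integral_null_eq mN N0) => x Nx.
  by rewrite indicE mem_set// mulr1.
have [|||||_ _] := @dominated_convergence _ _ _ P setT measurableT
  (fun n x => (f n x * \1_(~` N) x)%:E) (fun x => (l x * \1_(~` N) x)%:E) (cst M%:E).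
- by move=> n; exact/measurable_EFinP.
- exact/measurable_EFinP.
- apply: nearW => x _; apply/fine_cvgP; split; [exact: nearW|exact: hl].
- apply/integrableP; split; first exact: measurable_cst.
  by rewrite integral_cst//= probability_setT mule1 ltry.
- apply: nearW => x n _; rewrite /= lee_fin normrM -[leRHS]mulr1.
  apply: ler_pM => //.
  by rewrite indicE; case: (_ \in _); rewrite ?normr1 ?normr0.
by [].
Qed.

Lemma bounded_integral_fin_num (f : T -> R) (M : R) : measurable_fun setT f ->
  (forall x, `|f x| <= M) -> (\int[P]_x (f x)%:E)%E \is a fin_num.
Proof.
move=> mf fM; apply: integrable_fin_num => //; apply: (@le_integrable _ _ _ P setT measurableT _ (cst M%:E)).
- exact/measurable_EFinP.
- by move=> x _ /=; rewrite lee_fin (le_trans (fM x))// ler_norm.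
- apply/integrableP; split; first exact: measurable_cst.
  by rewrite integral_cst//= probability_setT mule1 ltry.
Qed.

End bounded_convergence.

(** * Laws of finite families of random variables *)

Section grid_rounding.
Context {R : realType}.

Definition gridcell m (y : R) : nat := minn (Num.trunc ((y + m%:R) * 2 ^+ m)) (m.*2 * 2 ^ m).
Definition gridpt m (k : nat) : R := k%:R / 2 ^+ m - m%:R.

Lemma gridcell_lt m y : (gridcell m y < (m.*2 * 2 ^ m).+1)%N.
Proof. by rewrite ltnS geq_minr. Qed.

Lemma measurable_gridcell m (k : nat) : measurable [set y | gridcell m y = k].
Proof.
pose f (y : R) : R := (gridcell m y)%:R.
have mf : measurable_fun setT f.
  apply: nondecreasing_measurable => // x y xy; rewrite /f ler_nat /gridcell.
  rewrite leq_min geq_minr andbT (leq_trans (geq_minl _ _))// le_truncn//.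
  by rewrite ler_wpM2r ?exprn_ge0// lerD2r.
have -> : [set y | gridcell m y = k] = f @^-1` [set k%:R].
  apply/seteqP; split => y /=; rewrite /f; first by move=> ->.
  by move/eqP; rewrite eqr_nat => /eqP.
by rewrite -[X in measurable X]setTI; apply: mf => //; exact: measurable_set1.
Qed.

Lemma gridpt_cvg (y : R) : gridpt m (gridcell m y) @[m --> \oo] --> y.
Proof.
apply/cvgrPdist_le => e e0.
have c0 := @cvg_geometric R 1 2^-1 ltac:(rewrite ger0_norm ?invr_ge0// invf_lt1 ?ltr1n//).
move/cvgrPdist_le : c0 => /(_ _ e0) c0.
near=> m.
have hm : `|0 - geometric 1 2^-1 m| <= e by near: m; exact: c0.
have ym : `|y| < m%:R.
  near: m; exists (Num.trunc `|y|).+1 => // m /= hm'.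
  have /andP[_ h] := truncn_itv (normr_ge0 y).
  by apply: (lt_le_trans h); rewrite ler_nat.
move: hm; rewrite sub0r normrN /geometric /= mul1r ger0_norm ?exprn_ge0 ?invr_ge0//; apply: le_trans.
have p0 : 0 < 2 ^+ m :> R by rewrite exprn_gt0.
have := ym; rewrite ltr_norml => /andP[y1 y2].
have z0 : 0 <= (y + m%:R) * 2 ^+ m by rewrite mulr_ge0 ?(ltW p0)//; lra.
have /andP[h1 h2] := truncn_itv z0.
have -> : gridcell m y = Num.trunc ((y + m%:R) * 2 ^+ m).
  apply/minn_idPl; rewrite -(ler_nat R) (le_trans h1)// natrM natrX ler_wpM2r ?(ltW p0)//.
  by rewrite -addnn natrD; lra.
have k1 : gridpt m (Num.trunc ((y + m%:R) * 2 ^+ m)) <= y.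
  by rewrite lerBlDr ler_pdivrMr.
rewrite ger0_norm ?subr_ge0// /gridpt opprB addrA lerBlDr exprVn -[X in _ <= X + _]mul1r -mulrDl.
by rewrite ler_pdivlMr// [1 + _]addrC natr1 ltW.
Unshelve. all: by end_near. Qed.

End grid_rounding.

Section law_eq.
Context {R : realType} {I : finType}.

(** Continuity for pointwise convergence, by sequences. *)
Definition seq_continuous (G : (I -> R) -> R) : Prop :=
  forall (y : nat -> I -> R) (l : I -> R),
    (forall i, y n i @[n --> \oo] --> l i) -> G (y n) @[n --> \oo] --> G l.

Definition round m (x : I -> R) : I -> R := fun i => gridpt m (gridcell m (x i)).

(** The preimage of f under rounding is a box; this reduces expectations to
    probabilities of boxes. *)
Definition round_cell m (f : {ffun I -> 'I_((m.*2 * 2 ^ m).+1)}) (i : I) : set R :=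
  [set y | gridcell m y = f i].

Context {d : measure_display} {T : measurableType d} (P : probability T R).

Lemma measurable_box (x : T -> I -> R) (B : I -> set R) :
  (forall i, measurable_fun setT (fun w => x w i)) -> (forall i, measurable (B i)) ->
  measurable [set w | forall i, B i (x w i)].
Proof.
move=> mx mB.
have -> : [set w | forall i, B i (x w i)] =
    \big[setI/setT]_(i <- enum I) ((fun w => x w i) @^-1` B i).
  apply/seteqP; split => w /=.
    by move=> h; rewrite -bigcap_seq => i _; exact: h.
  by rewrite -bigcap_seq => h i; apply: (h i); rewrite /= mem_enum.
apply: bigsetI_measurable => i _.
by rewrite -[X in measurable X]setTI; apply: mx.
Qed.

Lemma round_sum m (G : (I -> R) -> R) (x : T -> I -> R) w :
  G (round m (x w)) = \sum_(f : {ffun I -> 'I_((m.*2 * 2 ^ m).+1)})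
    G (fun i => gridpt m (f i)) * \1_[set w | forall i, round_cell f i (x w i)] w.
Proof.
pose f0 : {ffun I -> 'I_((m.*2 * 2 ^ m).+1)} :=
  [ffun i => Ordinal (gridcell_lt m (x w i))].
rewrite (bigD1 f0)//= big1 ?addr0.
  rewrite indicE mem_set ?mulr1 /=; last by move=> i; rewrite /round_cell /= ffunE.
  by congr G; apply/funext => i; rewrite ffunE.
move=> f ff0; rewrite indicE memNset ?mulr0//= => h; move/eqP: ff0; apply.
by apply/ffunP => i; rewrite ffunE; apply/val_inj => /=; rewrite -(h i).
Qed.

Lemma has_integral_round m (G : (I -> R) -> R) (x : T -> I -> R) :
  (forall i, measurable_fun setT (fun w => x w i)) ->
  has_integral P setT (fun w => G (round m (x w)))
    (\sum_(f : {ffun I -> 'I_((m.*2 * 2 ^ m).+1)})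
       G (fun i => gridpt m (f i)) * fine (P [set w | forall i, round_cell f i (x w i)])).
Proof.
move=> mx.
have -> : (fun w => G (round m (x w))) = (fun w => \sum_(f : {ffun I -> 'I_((m.*2 * 2 ^ m).+1)})
    G (fun i => gridpt m (f i)) * \1_[set w | forall i, round_cell f i (x w i)] w).
  by apply/funext => w; exact: round_sum.
apply: has_integral_sum => // f; apply: has_integralZ => //.
have mb : measurable [set w | forall i, round_cell f i (x w i)].
  by apply: measurable_box => // i; exact: measurable_gridcell.
apply: ge0_has_integral => //.
by rewrite integral_indic// setIT fineK// fin_num_measure.
Qed.

Lemma round_cvg (G : (I -> R) -> R) (x : I -> R) : seq_continuous G ->
  G (round m x) @[m --> \oo] --> G x.
Proof. by move=> cG; apply: cG => i; exact: gridpt_cvg. Qed.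

Lemma measurable_round m (G : (I -> R) -> R) (x : T -> I -> R) :
  (forall i, measurable_fun setT (fun w => x w i)) ->
  measurable_fun setT (fun w => G (round m (x w))).
Proof.
move=> mx; have [+ _] := has_integral_round m G mx.
by move=> /integrableP[/measurable_EFinP].
Qed.

(** Rounding makes G a finite combination of indicators of boxes, and G is the
    limit of these. *)
Lemma measurable_seq_continuous (G : (I -> R) -> R) (x : T -> I -> R) :
  seq_continuous G -> (forall i, measurable_fun setT (fun w => x w i)) ->
  measurable_fun setT (fun w => G (x w)).
Proof.
move=> cG mx; apply: (measurable_fun_cvg (fun m => measurable_round m G mx)) => w _.
exact: round_cvg.
Qed.

Lemma integral_round_cvg (G : (I -> R) -> R) (M : R) (x : T -> I -> R) :
  seq_continuous G -> (forall y, `|G y| <= M) -> (forall i, measurable_fun setT (fun w => x w i)) ->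
  (\int[P]_w (G (round m (x w)))%:E @[m --> \oo] --> \int[P]_w (G (x w))%:E)%E.
Proof.
move=> cG GM mx; apply: (@bounded_cvg_integral _ _ _ P (fun m w => G (round m (x w))) _ M) => //.
- by move=> m; exact: measurable_round.
- by apply: nearW => w; exact: round_cvg.
Qed.

End law_eq.

(** Probabilities of boxes determine the expectations of continuous functions:
    after rounding every variable to a finite grid, the expectation is a
    finite sum over boxes. *)
Lemma law_eq (R : realType) (I : finType) (d d' : measure_display)
  (T : measurableType d) (T' : measurableType d') (P : probability T R) (P' : probability T' R)
  (x : T -> I -> R) (x' : T' -> I -> R) (G : (I -> R) -> R) (M : R) :
  (forall i, measurable_fun setT (fun w => x w i)) ->
  (forall i, measurable_fun setT (fun w => x' w i)) ->
  (forall B : I -> set R, (forall i, measurable (B i)) ->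
     P [set w | forall i, B i (x w i)] = P' [set w | forall i, B i (x' w i)]) ->
  seq_continuous G -> (forall y, `|G y| <= M) ->
  (\int[P]_w (G (x w))%:E = \int[P']_w (G (x' w))%:E)%E.
Proof.
move=> mx mx' h cG GM.
have c1 := @integral_round_cvg R I _ T P G M x cG GM mx.
have c2 := @integral_round_cvg R I _ T' P' G M x' cG GM mx'.
apply: (cvg_unique _ c1); first exact: ereal_hausdorff.
have -> : (fun m => \int[P]_w (G (round m (x w)))%:E)%E =
  (fun m => \int[P']_w (G (round m (x' w)))%:E)%E; last exact: c2.
apply/funext => m.
have [_ ->] := @has_integral_round R I _ T P m G x mx.
have [_ ->] := @has_integral_round R I _ T' P' m G x' mx'.
congr EFin; apply: eq_bigr => f _; congr (_ * fine _).
by apply: h => i; exact: measurable_gridcell.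
Qed.

(** * Interpolation of continuous paths *)

Section uniform_continuity.
Context {R : realType} {V : normedModType R}.

Lemma segment_uniform_continuous (T : R) (x : R -> V) : {within `[0, T], continuous x} ->
  forall e, 0 < e -> exists2 del, 0 < del &
    forall s t, `[0, T]%classic s -> `[0, T]%classic t -> `|s - t| < del -> `|x s - x t| <= e.
Proof.
move=> /subspace_continuousP cx e e0.
have := @segment_compact R 0 T.
rewrite compact_near_coveringP => /(_ R 0^'+
  (fun del s => `[0, T]%classic s -> forall t, `[0, T]%classic t -> `|s - t| < del -> `|x s - x t| <= e)).
have h0 : forall s, `[0, T]%classic s -> \forall s' \near s & del \near 0^'+,
  `[0, T]%classic s' -> forall t, `[0, T]%classic t -> `|s' - t| < del -> `|x s' - x t| <= e.
  move=> s As; have e2 : 0 < e / 2 by rewrite divr_gt0.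
  have := cx s As => /cvgrPdist_le/(_ _ e2).
  rewrite /within /= => /nbhs_ballP[r /= r0 hr].
  exists (ball s (r / 2), [set del | del < r / 2]).
    split => /=; first by apply: nbhsx_ballx; rewrite divr_gt0.
    by apply: nbhs_right_lt; rewrite divr_gt0.
  move=> [s' del] /= [hs hd] As' t At st.
  have h1 := hr s' _ As'; have h2 := hr t _ At.
  have b1 : ball s r s'.
    by apply: le_ball hs; rewrite ler_pdivrMr// ler_pMr// ler1n.
  have b2 : ball s r t.
    move: hs; rewrite /ball /= => hs.
    rewrite (splitr r) -(subrKA s') (le_lt_trans (ler_normD _ _))// ltrD//.
    exact: lt_trans hd.
  have := h1 b1; have := h2 b2 => k2 k1.
  rewrite -(subrKA (x s)) (le_trans (ler_normD _ _))// (splitr e) lerD//.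
  by rewrite distrC.
move=> /(_ _ h0) H.
have /filter_ex[del [h d0]] : 0^'+ ([set del : R | (`[0, T]%classic `<=` (fun s => `[0, T]%classic s ->
    forall t, `[0, T]%classic t -> `|s - t| < del -> `|x s - x t| <= e)) /\ 0 < del]).
  by apply: filterI; [exact: H|exact: nbhs_right_gt].
by exists del => // s t As At; exact: h.
Qed.

End uniform_continuity.

Section path_functional.
Context {R : realType} {d : nat}.

(** Continuity of a functional within the continuous paths, along uniformly
    convergent sequences. *)
Lemma path_functional_cvg (T : R) (Phi : {uniform` `[0, T] -> 'rV[R]_d} -> R)
    (x : nat -> R -> 'rV[R]_d) (l : R -> 'rV[R]_d) :
  {within path_space T, continuous Phi} -> path_space T l -> (forall n, path_space T (x n)) ->
  (forall e, 0 < e -> \forall n \near \oo, forall t, `[0, T]%classic t -> `|x n t - l t| <= e) ->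
  Phi (x n) @[n --> \oo] --> Phi l.
Proof.
move=> cP hl hx h.
apply: (@within_continuous_cvg {uniform` `[0, T] -> 'rV[R]_d} R (path_space T) Phi \oo _ x l) => //.
move=> B /uniform_nbhs[E [entE EB]].
move: entE; rewrite -entourage_ballE => -[e /= e0 eE].
have e2 : 0 < e / 2 by rewrite divr_gt0.
apply: filterS (h _ e2) => n hn; apply: EB => t At.
apply: eE => /=; rewrite -ball_normE /= distrC (le_lt_trans (hn t At))//.
by rewrite ltr_pdivrMr// ltr_pMr// ltr1n.
Qed.

End path_functional.

Lemma cvg_sum (K : numFieldType) (V : normedModType K) (U I : Type) (F : set_system U)
    (FF : Filter F) (r : seq I) (f : I -> U -> V) (l : I -> V) :
  (forall i, f i x @[x --> F] --> l i) ->
  \sum_(i <- r) f i x @[x --> F] --> \sum_(i <- r) l i.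
Proof.
move=> h; elim: r => [|i r IH].
  by rewrite big_nil; under eq_fun do rewrite big_nil; exact: cvg_cst.
rewrite big_cons; under eq_fun do rewrite big_cons.
exact: cvgD.
Qed.

Section interpolation.
Context {R : realType} {d : nat} (T : R) (T0 : 0 < T).
Implicit Types (n : nat) (t : R) (y : nat -> 'rV[R]_d).

Definition grid_time n (k : nat) : R := T * (k%:R / n.+1%:R).

Definition hat n (k : nat) t : R := Num.max 0 (1 - `|t * n.+1%:R / T - k%:R|).

Definition hat_sum n t : R := \sum_(k < n.+2) hat n k t.

(** A partition of unity replaces the explicit broken line: dividing by the sum
    of the hats makes the values convex combinations without computing this
    sum, which is 1 on [0, T]. *)
Definition interp n y t : 'rV[R]_d :=
  (hat_sum n t)^-1 *: \sum_(k < n.+2) hat n k t *: y k.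

Lemma hat_ge0 n k t : 0 <= hat n k t.
Proof. by rewrite /hat le_max lexx. Qed.

Lemma hat_sum_gt0 n t : `[0, T]%classic t -> 0 < hat_sum n t.
Proof.
rewrite /= in_itv/= => /andP[t0 tT].
have u0 : 0 <= t * n.+1%:R / T by rewrite divr_ge0 ?mulr_ge0// ltW.
have /andP[h1 h2] := truncn_itv u0.
have kn : (Num.trunc (t * n.+1%:R / T) < n.+2)%N.
  rewrite ltnS -(ler_nat R) (le_trans h1)// ler_pdivrMr// mulrC ler_wpM2l//.
rewrite /hat_sum (bigD1 (Ordinal kn))//= ltr_pwDl//.
  rewrite /hat lt_max subr_gt0; apply/orP; right.
  by rewrite ger0_norm ?subr_ge0// ltrBlDl natr1.
by apply: sumr_ge0 => k _; exact: hat_ge0.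
Qed.

Lemma hat_neq0 n k t : hat n k t != 0 -> `|grid_time n k - t| < T / n.+1%:R.
Proof.
have [h|h] := leP 1 `|t * n.+1%:R / T - k%:R|.
  by rewrite /hat max_l ?eqxx// subr_le0.
move=> _; have -> : grid_time n k - t = (k%:R - t * n.+1%:R / T) * (T / n.+1%:R).
  have N0 : n.+1%:R != 0 :> R by rewrite pnatr_eq0.
  rewrite /grid_time; move: (n.+1%:R : R) N0 => N N0.
  by field; rewrite N0 gt_eqF.
rewrite normrM distrC [`|T / _|]ger0_norm ?divr_ge0// ?ltW//.
by rewrite gtr_pMl// divr_gt0.
Qed.

Lemma hat_continuous n k : continuous (hat n k).
Proof.
move=> t; apply: (@continuous_max _ _ (cst 0) (fun t => 1 - `|t * n.+1%:R / T - k%:R|)).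
  exact: cvg_cst.
apply: cvgB; first exact: cvg_cst.
apply: cvg_norm; apply: cvgB; last exact: cvg_cst.
apply: cvgM; last exact: cvg_cst.
by apply: cvgM; [exact: cvg_id|exact: cvg_cst].
Qed.

Lemma hat_sum_continuous n : continuous (hat_sum n).
Proof.
move=> t; rewrite /hat_sum; apply: cvg_sum => k; exact: hat_continuous.
Qed.

Lemma interp_continuous n y : path_space T (interp n y).
Proof.
apply: continuous_in_subspaceT => t /set_mem At.
apply: cvgZ.
  apply: cvgV; last by apply: hat_sum_continuous.
  by rewrite gt_eqF// hat_sum_gt0.
apply: cvg_sum => k; apply: cvgZ; last exact: cvg_cst.
by apply: hat_continuous.
Qed.

(** The interpolation is a convex combination of those values y k whose hat
    does not vanish at t. *)
Lemma interp_dist n y t (v : 'rV[R]_d) e : `[0, T]%classic t -> 0 <= e ->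
  (forall k, (k < n.+2)%N -> hat n k t != 0 -> `|y k - v| <= e) ->
  `|interp n y t - v| <= e.
Proof.
move=> At e0 h; have s0 := hat_sum_gt0 n At.
have -> : interp n y t - v = (hat_sum n t)^-1 *: \sum_(k < n.+2) hat n k t *: (y k - v).
  under eq_bigr do rewrite scalerBr.
  by rewrite sumrB -scaler_suml -/(hat_sum n t) scalerBr scalerA mulVf ?gt_eqF// scale1r.
rewrite normrZ ger0_norm ?invr_ge0 ?(ltW s0)// ler_pdivrMl//.
apply: (le_trans (ler_norm_sum _ _ _)).
rewrite mulrC /hat_sum mulr_sumr; apply: ler_sum => k _.
rewrite normrZ ger0_norm ?hat_ge0// mulrC.
have [->|hk] := eqVneq (hat n k t) 0; first by rewrite !mul0r.
by rewrite ler_wpM2l ?hat_ge0// h.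
Qed.

Lemma interp_dist2 n y y' t e : `[0, T]%classic t -> 0 <= e ->
  (forall k, (k < n.+2)%N -> `|y k - y' k| <= e) -> `|interp n y t - interp n y' t| <= e.
Proof.
move=> At e0 h.
have -> : interp n y t - interp n y' t = interp n (fun k => y k - y' k) t - 0.
  rewrite subr0 /interp -scalerBr -sumrB; congr (_ *: _).
  by apply: eq_bigr => k _; rewrite scalerBr.
by apply: interp_dist => // k kn _; rewrite subr0 h.
Qed.

Lemma interp_cvg (x : R -> 'rV[R]_d) : path_space T x -> forall e, 0 < e ->
  \forall n \near \oo, forall t, `[0, T]%classic t ->
    `|interp n (fun k => x (grid_time n k)) t - x t| <= e.
Proof.
move=> cx e e0; have [del d0 hd] := segment_uniform_continuous cx e0.
exists (Num.trunc (T / del)) => // n /= hn t At.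
apply: interp_dist => //; first exact: ltW.
move=> k kn /hat_neq0 hk; apply: hd => //.
  rewrite /= in_itv/= mulr_ge0 ?divr_ge0// ?(ltW T0)//= ler_piMr ?(ltW T0)//.
  by rewrite ler_pdivrMr// mul1r ler_nat -ltnS.
apply: (lt_trans hk); rewrite ltr_pdivrMr// mulrC -ltr_pdivrMr//.
have /andP[_ h2] := @truncn_itv R (T / del) (divr_ge0 (ltW T0) (ltW d0)).
by apply: (lt_le_trans h2); rewrite ler_nat.
Qed.

Definition assemble n (y : 'I_n.+2 * 'I_d -> R) (k : nat) : 'rV[R]_d :=
  \row_i y (inord k, i).

Lemma norm_row_le (v : 'rV[R]_d) e : 0 <= e -> (forall i, `|v ord0 i| <= e) -> `|v| <= e.
Proof.
move=> e0 h; rewrite /Num.norm/= mx_normrE; apply: bigmax_le => // -[i j] _ /=.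
by rewrite (ord1 i).
Qed.

Lemma seq_continuous_interp n (Phi : {uniform` `[0, T] -> 'rV[R]_d} -> R) :
  {within path_space T, continuous Phi} ->
  seq_continuous (fun y : 'I_n.+2 * 'I_d -> R => Phi (interp n (assemble y))).
Proof.
move=> cP y l yl; apply: (path_functional_cvg cP).
- exact: interp_continuous.
- by move=> m; exact: interp_continuous.
move=> e e0.
have h : \forall m \near \oo, forall ki, `|y m ki - l ki| <= e.
  apply: filter_forall => ki; move/cvgrPdist_le: (yl ki) => /(_ _ e0).
  by apply: filterS => m; rewrite distrC.
apply: filterS h => m hm t At; apply: interp_dist2 => //; first exact: ltW.
move=> k _; apply: norm_row_le; first exact: ltW.
by move=> i; rewrite !mxE.
Qed.

End interpolation.

(** * Laws of processes with continuous paths *)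

Section path_law.
Context {R : realType} {d : nat} (T : R) (T0 : 0 < T)
  (Phi : {uniform` `[0, T] -> 'rV[R]_d} -> R) (M : R).
Hypothesis cPhi : {within path_space T, continuous Phi}.
Hypothesis bPhi : forall x, path_space T x -> `|Phi x| <= M.

Definition grid_values {Omega : Type} n (X : R -> Omega -> 'rV[R]_d) (w : Omega)
  (ki : 'I_n.+2 * 'I_d) : R := X (grid_time T n ki.1) w ord0 ki.2.

Lemma grid_time_itv n (k : 'I_n.+2) : `[0, T]%classic (grid_time T n k).
Proof.
rewrite /= in_itv/= mulr_ge0 ?divr_ge0// ?(ltW T0)//= ler_piMr ?(ltW T0)//.
by rewrite ler_pdivrMr// mul1r ler_nat -ltnS.
Qed.

Lemma interp_grid_values {Omega : Type} n (X : R -> Omega -> 'rV[R]_d) w :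
  interp T n (assemble (grid_values (n := n) X w)) = interp T n (fun k => X (grid_time T n k) w).
Proof.
apply/funext => t; rewrite /interp; congr (_ *: _); apply: eq_bigr => k _; congr (_ *: _).
by apply/rowP => i; rewrite mxE /grid_values /= inord_val.
Qed.

Lemma interp_integral_cvg {dO : measure_display} {Omega : measurableType dO}
    (P : probability Omega R) (X : R -> Omega -> 'rV[R]_d) :
  (forall t, `[0, T]%classic t -> random_vector (X t)) ->
  {ae P, forall w, path_space T (fun t => X t w)} ->
  (\int[P]_w (Phi (interp T n (assemble (grid_values (n := n) X w))))%:E @[n --> \oo]
     --> \int[P]_w (Phi (fun t => X t w))%:E)%E.
Proof.
move=> mX cX; apply: (@bounded_cvg_integral _ _ _ P
  (fun n w => Phi (interp T n (assemble (grid_values (n := n) X w)))) _ M).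
- move=> n; apply: (@measurable_seq_continuous R _ _ Omega P
    (fun y => Phi (interp T n (assemble y))) (grid_values (n := n) X)).
    exact: seq_continuous_interp.
  by move=> ki; apply: mX; exact: grid_time_itv.
- by move=> n w; apply: bPhi; exact: interp_continuous.
- apply: filterS cX => w cw; apply: path_functional_cvg => //.
    by move=> n; exact: interp_continuous.
  move=> e e0; apply: filterS (interp_cvg T0 cw e0) => n h t At.
  by rewrite interp_grid_values; exact: h.
Qed.

(** The functional of the path is the limit of the same functional of the
    interpolations, and each of these depends on finitely many values of the
    process only. *)
Lemma path_law_eq {dO dO' : measure_display} {Omega : measurableType dO}
    {Omega' : measurableType dO'} (P : probability Omega R) (P' : probability Omega' R)
    (X : R -> Omega -> 'rV[R]_d) (X' : R -> Omega' -> 'rV[R]_d) :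
  (forall t, `[0, T]%classic t -> random_vector (X t)) ->
  (forall t, `[0, T]%classic t -> random_vector (X' t)) ->
  {ae P, forall w, path_space T (fun t => X t w)} ->
  {ae P', forall w, path_space T (fun t => X' t w)} ->
  (forall n (G : ('I_n.+2 * 'I_d -> R) -> R), seq_continuous G -> (forall y, `|G y| <= M) ->
     (\int[P]_w (G (grid_values X w))%:E = \int[P']_w (G (grid_values X' w))%:E)%E) ->
  (\int[P]_w (Phi (fun t => X t w))%:E = \int[P']_w (Phi (fun t => X' t w))%:E)%E.
Proof.
move=> mX mX' cX cX' h.
apply: (cvg_unique _ (interp_integral_cvg mX cX)); first exact: ereal_hausdorff.
have -> : (fun n => \int[P]_w (Phi (interp T n (assemble (grid_values (n := n) X w))))%:E)%E =
  (fun n => \int[P']_w (Phi (interp T n (assemble (grid_values (n := n) X' w))))%:E)%E.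
  apply/funext => n; apply: (h n (fun y => Phi (interp T n (assemble y)))).
    exact: seq_continuous_interp.
  by move=> y; apply: bPhi; exact: interp_continuous.
exact: interp_integral_cvg.
Qed.

End path_law.

(** * Laws of the increments of Brownian motion *)

Section increments.
Context {R : realType} {d : nat} {dO : measure_display} {Omega : measurableType dO}
  (P : probability Omega R) (W : R -> Omega -> 'rV[R]_d) (hW : standard_brownian_motion P W).

Lemma normal_rv_coord (s : R) (Y : Omega -> 'rV[R]_d) i : centered_normal P s Y ->
  normal_rv P s (fun w => Y w ord0 i).
Proof.
move=> [mY hY]; split; first exact: mY.
move=> B mB.
pose BB (j : 'I_d) : set R := if j == i then B else setT.
have mBB j : measurable (BB j) by rewrite /BB; case: ifP.
have := hY BB mBB; rewrite (bigD1 i)//= big1 ?mule1; last first.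
  by move=> j ji; rewrite /BB (negbTE ji) probability_setT.
rewrite /BB eqxx => <-; congr (P _); apply/seteqP; split => w /=.
  by move=> h j; case: eqP => // ->.
by move=> /(_ i); rewrite eqxx.
Qed.

Lemma gaussian_increments_coord i : gaussian_increments P (fun t w => W t w ord0 i).
Proof.
split=> [t t0|s t s0 st]; first exact: (brownian_random_vector hW).
have := normal_rv_coord i (brownian_normal_increments hW s0 st).
by under eq_fun do rewrite !mxE.
Qed.

(** Independence in time, independence of the coordinates and the scaling of
    normal laws, in one formula.  The weights c are included because the
    increments are later multiplied by a kernel. *)
Lemma increments_box n (t : nat -> R) (c : nat -> R) (B : 'I_n * 'I_d -> set R) :
  0 <= t 0%N -> (forall k, (k < n)%N -> t k < t k.+1) -> (forall k, 0 < c k) ->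
  (forall ki, measurable (B ki)) ->
  P [set w | forall ki, B ki (c ki.1 * (W (t ki.1.+1) w ord0 ki.2 - W (t ki.1) w ord0 ki.2))] =
  (\prod_(k < n) \prod_(i < d) normal_prob 0 (c k * Num.sqrt (t k.+1 - t k)) (B (k, i)))%E.
Proof.
move=> t0 tS c0 mB.
pose C (k : 'I_n) (i : 'I_d) : set R := (fun x => c k * x) @^-1` B (k, i).
have mC k i : measurable (C k i).
  by rewrite -[X in measurable X]setTI; apply: (mulrl_measurable (c k)).
pose D (k : 'I_n) : set (d.-tuple (measurableTypeR R)) := [set v | forall i, C k i (tnth v i)].
have mD k : measurable (D k).
  apply: (@measurable_box R _ _ (d.-tuple (measurableTypeR R)) (fun v i => tnth v i) (C k)) => // i.
  exact: measurable_tnth.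
have DE (k : 'I_n) w : D k (borel_tuple (W (t k.+1) w - W (t k) w)) <->
    (forall i, C k i ((W (t k.+1) w - W (t k) w) ord0 i)).
  by rewrite /D /borel_tuple /=; split => h i; have := h i; rewrite tnth_mktuple.
have nn k : (k < n)%N -> 0 <= t k.
  elim: k => // k IH kn; apply: le_trans (ltW (tS k (ltnW kn))); apply: IH; exact: ltnW.
have := brownian_independent_increments hW t0 (fun k kn => ltW (tS k kn)) mD.
have -> : [set w | forall k : 'I_n, D k (borel_tuple (W (t k.+1) w - W (t k) w))] =
  [set w | forall ki : 'I_n * 'I_d, B ki (c ki.1 * (W (t ki.1.+1) w ord0 ki.2 - W (t ki.1) w ord0 ki.2))].
  apply/seteqP; split => w /= h.
    by move=> [k i] /=; have := (DE k w).1 (h k) i; rewrite /C /= !mxE.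
  by move=> k; apply/DE => i; rewrite /C /= !mxE; exact: (h (k, i)).
move=> ->; apply: eq_bigr => k _.
have [_ hN] := brownian_normal_increments hW (nn k (ltn_ord k)) (tS k (ltn_ord k)).
transitivity (P [set w | forall i, C k i ((W (t k.+1) w - W (t k) w) ord0 i)]).
  by congr (P _); apply/seteqP; split => w /= /DE.
rewrite hN//; apply: eq_bigr => i _; rewrite /C normal_prob_scale//.
by rewrite sqrtr_gt0 subr_gt0; exact: tS.
Qed.

End increments.

(** * Hoelder regularity in several dimensions *)

Section vector_hoelder.
Context {R : realType} {d : nat}.
Implicit Types (x : R -> 'rV[R]_d).

(** The norm of a row vector is the largest modulus of its coordinates. *)
Lemma hoelder_rows (A : set R) g x :
  (forall i, exists C, 0 <= C /\ hoelder_on A C g (fun t => x t ord0 i)) ->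
  exists C, 0 <= C /\ forall s t, A s -> A t -> `|x t - x s| <= C * `|t - s| `^ g.
Proof.
move=> /choice[C hC]; exists (\sum_i C i); split.
  by apply: sumr_ge0 => i _; have [] := hC i.
have C0 i : 0 <= C i by have [] := hC i.
move=> s t As At; apply: norm_row_le; first by rewrite mulr_ge0 ?powR_ge0// sumr_ge0.
move=> i; rewrite !mxE; have [_ h] := hC i.
apply: (le_trans (h t s At As)); rewrite ler_wpM2r ?powR_ge0// (bigD1 i)//= lerDl.
by rewrite sumr_ge0.
Qed.

Lemma hoelder_within_continuous (V : normedModType R) g (x : R -> V) : 0 < g ->
  (forall K, 0 < K -> exists C, 0 <= C /\
     forall s t, `[0, K]%classic s -> `[0, K]%classic t -> `|x t - x s| <= C * `|t - s| `^ g) ->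
  {within `[0, +oo[, continuous x}.
Proof.
move=> g0 h; apply/subspace_continuousP => t; rewrite /= in_itv/= andbT => t0.
have K0 : 0 < t + 1 by rewrite ltr_wpDl.
have [C [C0 hC]] := h _ K0.
apply/cvgrPdist_le => e e0; rewrite /within /=.
pose r := (e / (C + 1)) `^ g^-1.
have C1 : 0 < C + 1 by rewrite ltr_wpDl.
have eC : 0 < e / (C + 1) by rewrite divr_gt0.
have r0 : 0 < r by rewrite powR_gt0.
apply/nbhs_ballP; exists (Num.min r 1) => /=; first by rewrite lt_min r0 ltr01.
move=> s; rewrite /ball /= lt_min => /andP[sr s1]; rewrite in_itv/= andbT => s0.
apply: (le_trans (hC s t _ _)).
- rewrite /= in_itv/= s0/=; move: s1; rewrite ltr_norml => /andP[? ?]; lra.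
- by rewrite /= in_itv/= t0/= lerDl.
have : `|t - s| `^ g <= e / (C + 1).
  have -> : e / (C + 1) = r `^ g.
    by rewrite /r -powRrM mulVf ?gt_eqF// powRr1// ltW.
  by rewrite ge0_ler_powR ?nnegrE ?(ltW g0) ?(ltW r0)// ltW.
move=> /(ler_wpM2l C0)/le_trans; apply.
by rewrite mulrA ler_pdivrMr// mulrC ler_pM2l// lerDl.
Qed.

End vector_hoelder.

Section brownian_good.
Context {R : realType} {d : nat} {dO : measure_display} {Omega : measurableType dO}
  (P : probability Omega R) (W : R -> Omega -> 'rV[R]_d) (hW : standard_brownian_motion P W).

(** The event on which the pathwise construction works. *)
Definition regular_path (w : Omega) : Prop :=
  forall i K g, 0 < K -> 0 < g -> g < 2^-1 ->
    exists C, 0 <= C /\ hoelder_on `[0, K] C g (fun t => W t w ord0 i).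

Lemma within_continuous_coord (A : set R) (x : R -> 'rV[R]_d) i :
  {within A, continuous x} -> {within A, continuous (fun t => x t ord0 i)}.
Proof.
move=> /subspace_continuousP cx; apply/subspace_continuousP => t At.
apply: (@cvg_comp _ _ _ x (fun v : 'rV[R]_d => v ord0 i) _ (nbhs (x t))); first exact: cx.
exact: (@coord_continuous R 1 d ord0 i).
Qed.

Lemma ae_regular_path : {ae P, forall w, regular_path w}.
Proof.
have hc i : {ae P, forall w, {within `[0, +oo[, continuous (fun t => W t w ord0 i)}}.
  by apply: filterS (brownian_continuous hW) => w; exact: within_continuous_coord.
apply: filter_forall => i.
exact: (brownian_hoelder (gaussian_increments_coord hW i) (hc i)).
Qed.

End brownian_good.

(** * The continuous version of the integral process *)

Section wiener_version.
Context {R : realType} {d : nat} {dO : measure_display} {Omega : measurableType dO}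
  (P : probability Omega R) (W : R -> Omega -> 'rV[R]_d) (hW : standard_brownian_motion P W)
  (a : R) (a0 : 0 < a) (a1 : a < 2^-1).
Local Notation Wi i := (fun s w => W s w ord0 i).

Lemma step_integral_kernel t N i w :
  step_integral (Wi i) (kernel_steps a t N) w = wsum a N (fun u => W (t * u) w ord0 i).
Proof. by rewrite /step_integral big_grid_steps. Qed.

Lemma kernel_steps_cvg t k : 0 < t -> (0 < k)%N ->
  dist2 lebesgue_measure `[0, t] (step_fun (kernel_steps a t (k * 2 ^ m)))
     (fun s : R => (t / s) `^ a) @[m --> \oo] --> 0%E.
Proof.
move=> t0 k0.
have N0 m : (0 < k * 2 ^ m)%N by rewrite muln_gt0 k0 expn_gt0.
apply: (@squeeze_cvge _ _ _ _ (cst 0%E) _ (fun m =>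
  (t / (1 - a *+ 2) * (1 - (1 - a *+ 2) * riemann_sum a (k * 2 ^ m)))%:E)).
- by apply: nearW => m; rewrite dist2_ge0/=; exact: kernel_steps_dist.
- exact: cvg_cst.
apply/fine_cvgP; split; first exact: nearW.
rewrite -[X in _ --> X](mulr0 (t / (1 - a *+ 2))) -(subrr 1).
apply: cvgM; first exact: cvg_cst.
apply: cvgB; first exact: cvg_cst.
apply: (@cvg_comp _ _ _ (fun m => k * 2 ^ m)%N (fun N => (1 - a *+ 2) * riemann_sum a N) _ \oo).
  move=> A [n _ hn]; exists n => // m /= nm; apply: hn => /=.
  by rewrite (leq_trans nm)// (leq_trans (ltnW (ltn_expl _ (ltnSn 1))))// leq_pmull.
exact: riemann_sum_cvg.
Qed.

Lemma exists_exponent : exists g : R, [/\ 0 < g, a < g, g < 2^-1 & g <= 1].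
Proof. by exists ((a + 2^-1) / 2); move: a0 a1 => h0 h1; split; lra. Qed.

Lemma kernel_wsum_cvg k t i w : regular_path W w -> 0 < t -> (0 < k)%N ->
  cvgn (fun m => wsum a (k * 2 ^ m) (fun u => W (t * u) w ord0 i)).
Proof.
move=> hw t0 k0; have [g [g0 ag g1 g2]] := exists_exponent.
have [C [C0 hC]] := hw i t g t0 g0 g1.
by apply: (wsum_path_cvg (ltW a0) ag hC) => //; rewrite (ltW t0) lexx.
Qed.

Lemma wiener_integral_kernel k t i (Y : Omega -> R) : 0 < t -> (0 < k)%N ->
  measurable_fun setT Y ->
  {ae P, forall w, wsum a (k * 2 ^ m) (fun u => W (t * u) w ord0 i) @[m --> \oo] --> Y w} ->
  is_wiener_integral P (Wi i) t (fun s => (t / s) `^ a) Y.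
Proof.
move=> t0 k0 mY hY.
have N0 m : (0 < k * 2 ^ m)%N by rewrite muln_gt0 k0 expn_gt0.
apply: (@wiener_integral_of_ae_limit _ _ _ P _ _ _ _ (fun m => kernel_steps a t (k * 2 ^ m))).
- exact: gaussian_increments_coord.
- exact: ltW.
- by apply: measurable_kernel => //; exact: ltW.
- exact: mY.
- by move=> m; apply: grid_steps_within => //; exact: ltW.
- exact: kernel_steps_cvg.
apply: filterS hY => w; by under eq_fun do rewrite -step_integral_kernel.
Qed.

(** The candidate for the continuous version, given by the same formula on
    every path; it is only meaningful on regular paths. *)
Definition pathwise_integral t w : 'rV[R]_d :=
  \row_i fractional_integral a (fun s => W s w ord0 i) t.

Lemma pathwise_integral_hoelder w i K g : regular_path W w -> 0 < K -> a < g -> g < 2^-1 ->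
  exists C, 0 <= C /\ hoelder_on `[0, K] C g (fun t => pathwise_integral t w ord0 i).
Proof.
move=> hw K0 ag g1; have g0 := lt_trans a0 ag.
have [C [C0 hC]] := hw i K g K0 g0 g1.
have g2 : g <= 1 by lra.
exists (C * wsum_bound a g); split.
  rewrite mulr_ge0//; apply: le_trans (wsum_powR_le 0 (ltW a0) ag g2).
  rewrite /wsum; apply: sumr_ge0 => j _; rewrite mulr_ge0 ?powR_ge0// subr_ge0.
  rewrite ge0_ler_powR ?nnegrE ?(ltW g0) ?divr_ge0//.
  by rewrite ler_wpM2r ?invr_ge0// ler_nat.
have := fractional_integral_hoelder (ltW a0) ag g2 C0 hC.
move=> h s t As At; have := h s t As At; by rewrite !mxE.
Qed.

Lemma pathwise_integral_continuous w : regular_path W w -> {within `[0, +oo[, continuous (fun t => pathwise_integral t w)}.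
Proof.
move=> hw; have [g [g0 ag g1 g2]] := exists_exponent.
apply: (hoelder_within_continuous g0) => K K0; apply: hoelder_rows => i.
exact: pathwise_integral_hoelder.
Qed.

Lemma pathwise_integral0 w : pathwise_integral 0 w = 0.
Proof.
apply/rowP => i; rewrite !mxE /fractional_integral.
have -> : (fun m => wsum a (2 ^ m) (fun u => W (0 * u) w ord0 i)) = cst 0.
  apply/funext => m; rewrite /wsum big1// => j _.
  by rewrite !mul0r subrr mulr0.
by apply: cvg_lim => //; exact: cvg_cst.
Qed.

(** The pathwise integral, set to 0 on a measurable null set containing all
    irregular paths: this makes it measurable and all its paths continuous. *)
Lemma wiener_version_ex : exists I, is_wiener_process_integral P W (fun t s => (t / s) `^ a) I /\
  {ae P, forall w, forall t, 0 < t -> I t w = pathwise_integral t w}.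
Proof.
have [N [mN N0 hN]] := ae_regular_path hW.
have hreg w : ~ N w -> regular_path W w by move=> Nw; apply: contrapT => h; apply: Nw; exact: hN.
(* Discarding a measurable null set, instead of the set of irregular paths,
    keeps measurability. *)
pose I t w := \1_(~` N) w *: pathwise_integral t w.
have IE t w : ~ N w -> I t w = pathwise_integral t w.
  by move=> Nw; rewrite /I indicE mem_set// scale1r.
have I0 t w : N w -> I t w = 0.
  by move=> Nw; rewrite /I indicE memNset ?scale0r//= => h; exact: h.
exists I; split; last first.
  by exists N; split => // w; apply: contra_notP => Nw t _; exact: IE.
split=> [t t0 i|w]; last first.
  have [Nw|Nw] := pselect (N w).
    have -> : (fun t => I t w) = cst 0 by apply/funext => t; rewrite I0.
    by move=> ?; exact: cst_continuous.
  have -> : (fun t => I t w) = (fun t => pathwise_integral t w) by apply/funext => t; rewrite IE.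
  apply: continuous_subspaceW (pathwise_integral_continuous (hreg w Nw)).
  by apply: subset_itvr; rewrite bnd_simp.
have hc w : ~ N w -> wsum a (2 ^ m) (fun u => W (t * u) w ord0 i) @[m --> \oo] --> pathwise_integral t w ord0 i.
  move=> Nw; rewrite mxE; have hw := hreg w Nw.
  have [g [g0 ag g1 g2]] := exists_exponent.
  have [C [C0 hC]] := hw i t g t0 g0 g1.
  by apply: (fractional_integral_cvg (ltW a0) ag hC); rewrite (ltW t0) lexx.
have mW (s : R) : 0 <= s -> measurable_fun setT (fun w => W s w ord0 i).
  by move=> s0; exact: (brownian_random_vector hW s0).
apply: (@wiener_integral_kernel 1) => //.
  apply: (measurable_fun_cvg (h := fun m w => \1_(~` N) w * wsum a (2 ^ m) (fun u => W (t * u) w ord0 i))).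
    move=> m; apply: measurable_funM.
      by apply: measurable_indic; exact: measurableC.
    have hs : steps_within t (kernel_steps a t (2 ^ m)).
      by apply: grid_steps_within; rewrite ?(ltW t0) ?expn_gt0.
    have -> : (fun w => wsum a (2 ^ m) (fun u => W (t * u) w ord0 i)) =
        step_integral (Wi i) (kernel_steps a t (2 ^ m)).
      by apply/funext => w; rewrite step_integral_kernel.
    exact: (measurable_step_integral (gaussian_increments_coord hW i) hs).
  move=> w _; rewrite mxE; have [Nw|Nw] := pselect (N w).
    rewrite indicE memNset ?mul0r; last by move=> h; exact: h.
    by under eq_fun do rewrite mul0r; exact: cvg_cst.
  by apply: cvgM; [exact: cvg_cst|exact: hc].
exists N; split => // w; apply: contra_notP => Nw.
rewrite /= IE//; have := hc w Nw.
suff -> : (fun m => wsum a (1 * 2 ^ m) (fun u => W (t * u) w ord0 i)) =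
  (fun m => wsum a (2 ^ m) (fun u => W (t * u) w ord0 i)) by [].
by apply/funext => m; rewrite mul1n.
Qed.

Let IW := wiener_process_integral P W (fun t s => (t / s) `^ a).

Lemma wiener_process_integralP : is_wiener_process_integral P W (fun t s => (t / s) `^ a) IW.
Proof.
rewrite /IW /wiener_process_integral; have [I [hI _]] := wiener_version_ex.
by apply: (@xgetPex _ _ [set I | is_wiener_process_integral P W _ I]); exists I.
Qed.

(** The approximating dyadic points are rounded up so that they stay positive,
    where the integral process is defined. *)
Lemma dyadic_above_cvg (t : R) : 0 < t ->
  (Num.trunc (t * 2 ^+ m)).+1%:R / 2 ^+ m @[m --> \oo] --> t.
Proof.
move=> t0; apply/cvgrPdist_le => e e0.
have c0 := @cvg_geometric R 1 2^-1 ltac:(rewrite ger0_norm ?invr_ge0// invf_lt1 ?ltr1n//).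
move/cvgrPdist_le : c0 => /(_ _ e0).
apply: filterS => m; rewrite sub0r normrN /geometric /= mul1r => hm.
apply: le_trans hm; have p0 : 0 < 2 ^+ m :> R by rewrite exprn_gt0.
have /andP[h1 h2] := truncn_itv (mulr_ge0 (ltW t0) (ltW p0)).
have h3 : t <= (Num.trunc (t * 2 ^+ m)).+1%:R / 2 ^+ m by rewrite ler_pdivlMr// ltW.
rewrite ler0_norm ?subr_le0// opprB ger0_norm ?exprn_ge0// ?invr_ge0//.
rewrite lerBlDr exprVn ler_pdivrMr// mulrDl mulVf ?gt_eqF//.
by rewrite addrC -natr1 lerD2r.
Qed.

(** Uniqueness of Wiener integrals at the countably many positive dyadic
    times, extended to all t > 0 by continuity of both versions. *)
Lemma ae_wiener_process_integralE :
  {ae P, forall w, forall t, 0 < t -> IW t w = pathwise_integral t w}.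
Proof.
have [I [[hI cI] aeI]] := wiener_version_ex; have [hIW cIW] := wiener_process_integralP.
have D (m k : nat) : {ae P, forall w, IW (k.+1%:R / 2 ^+ m) w = I (k.+1%:R / 2 ^+ m) w}.
  have t0 : 0 < k.+1%:R / 2 ^+ m :> R by rewrite divr_gt0// exprn_gt0.
  have : {ae P, forall w, forall i, IW (k.+1%:R / 2 ^+ m) w ord0 i = I (k.+1%:R / 2 ^+ m) w ord0 i}.
    apply: filter_forall => i.
    exact: (wiener_integral_unique (gaussian_increments_coord hW i) (ltW t0) (hIW _ t0 i) (hI _ t0 i)).
  by apply: filterS => w h; apply/rowP.
have := ae_foralln (fun m => ae_foralln (fun k => D m k)).
apply: filterS2 aeI => w hw h t t0; rewrite -hw//.
pose s m : R := (Num.trunc (t * 2 ^+ m)).+1%:R / 2 ^+ m.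
have s0 m : `]0, +oo[%classic (s m) by rewrite /= in_itv/= andbT divr_gt0// exprn_gt0.
have t0' : `]0, +oo[%classic t by rewrite /= in_itv/= andbT.
have c1 : I (s m) w @[m --> \oo] --> I t w.
  by apply: (@within_continuous_cvg R 'rV[R]_d `]0, +oo[ (fun t => I t w) \oo _ s t (cI w) t0' s0 (dyadic_above_cvg t0)).
have c2 : IW (s m) w @[m --> \oo] --> IW t w.
  by apply: (@within_continuous_cvg R 'rV[R]_d `]0, +oo[ (fun t => IW t w) \oo _ s t (cIW w) t0' s0 (dyadic_above_cvg t0)).
apply: (cvg_unique (@norm_hausdorff R 'rV[R]_d) c2).
have -> : (fun m => IW (s m) w) = (fun m => I (s m) w); last exact: c1.
by apply/funext => m; exact: h.
Qed.

End wiener_version.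

(** * The integral process in law: a time-changed Brownian motion *)

Section kernel_limit.
Context {R : realType} {d : nat} {dO : measure_display} {Omega : measurableType dO}
  (P : probability Omega R) (W : R -> Omega -> 'rV[R]_d) (hW : standard_brownian_motion P W)
  (a : R) (a0 : 0 < a) (a1 : a < 2^-1).

(** For each k the sums over k 2^m cells converge on every regular path, but
    the definition of the limit uses k = 1.  The limits for different k are
    Wiener integrals of the same kernel, hence almost surely equal. *)
Lemma kernel_wsum_ae_cvg t k : 0 < t -> (0 < k)%N ->
  {ae P, forall w, forall i,
    wsum a (k * 2 ^ m) (fun u => W (t * u) w ord0 i) @[m --> \oo] --> pathwise_integral W a t w ord0 i}.
Proof.
move=> t0 k0; apply: filter_forall => i.
have [N [mN N0 hN]] := ae_regular_path hW.
have hreg w : ~ N w -> regular_path W w by move=> Nw; apply: contrapT => h; apply: Nw; exact: hN.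
pose S m w := wsum a (k * 2 ^ m) (fun u => W (t * u) w ord0 i).
pose Y w := \1_(~` N) w * limn (S ^~ w).
have cS w : ~ N w -> S m w @[m --> \oo] --> limn (S ^~ w).
  by move=> /hreg hw; exact: (kernel_wsum_cvg a0 a1 hw t0 k0).
have YE w : ~ N w -> Y w = limn (S ^~ w) by move=> Nw; rewrite /Y indicE mem_set// mul1r.
have mY : measurable_fun setT Y.
  apply: (measurable_fun_cvg (h := fun m w => \1_(~` N) w * S m w)).
    move=> m; apply: measurable_funM.
      by apply: measurable_indic; exact: measurableC.
    have hs : steps_within t (kernel_steps a t (k * 2 ^ m)).
      by apply: grid_steps_within; rewrite ?(ltW t0) ?muln_gt0 ?k0 ?expn_gt0.
    have -> : S m = step_integral (fun s w => W s w ord0 i) (kernel_steps a t (k * 2 ^ m)).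
      by apply/funext => w; rewrite step_integral_kernel.
    exact: (measurable_step_integral (gaussian_increments_coord hW i) hs).
  move=> w _; rewrite /Y; have [Nw|Nw] := pselect (N w).
    rewrite indicE memNset ?mul0r; last by move=> h; exact: h.
    by under eq_fun do rewrite mul0r; exact: cvg_cst.
  by apply: cvgM; [exact: cvg_cst|exact: cS].
have hY : {ae P, forall w, S m w @[m --> \oo] --> Y w}.
  exists N; split => // w; apply: contra_notP => Nw /=.
  by rewrite YE//; exact: cS.
have wY := wiener_integral_kernel hW a0 a1 t0 k0 mY hY.
have [I [[hI _] aeI]] := wiener_version_ex hW a0 a1.
have := wiener_integral_unique (gaussian_increments_coord hW i) (ltW t0) wY (hI _ t0 i).
apply: filterS3 hY aeI => w h1 h2 h3.
by rewrite -h2// -h3.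
Qed.

(** A modification started at 0 all paths of which are Hoelder, so that
    statements about functionals of its paths hold everywhere and not just
    almost surely. *)
Lemma regularized_brownian :
  exists B : R -> Omega -> 'rV[R]_d,
   [/\ forall t, 0 <= t -> random_vector (B t),
       forall w, {within `[0, +oo[, continuous (fun t => B t w)},
       forall w K, 0 < K -> exists C, 0 <= C /\
         forall s t, `[0, K]%classic s -> `[0, K]%classic t -> `|B t w - B s w| <= C * `|t - s| `^ 4^-1,
       (forall w, B 0 w = 0) &
       {ae P, forall w, forall t, B t w = W t w - W 0 w}].
Proof.
have [N [mN N0 hN]] := ae_regular_path hW.
have hreg w : ~ N w -> regular_path W w by move=> Nw; apply: contrapT => h; apply: Nw; exact: hN.
pose B t w := \1_(~` N) w *: (W t w - W 0 w).
have BE t w : ~ N w -> B t w = W t w - W 0 w.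
  by move=> Nw; rewrite /B indicE mem_set// scale1r.
have B0 t w : N w -> B t w = 0.
  by move=> Nw; rewrite /B indicE memNset ?scale0r//= => h; exact: h.
have hB w K : 0 < K -> exists C, 0 <= C /\
    forall s t, `[0, K]%classic s -> `[0, K]%classic t -> `|B t w - B s w| <= C * `|t - s| `^ 4^-1.
  move=> K0; have [Nw|Nw] := pselect (N w).
    exists 0; split => // s t _ _; by rewrite !B0// subrr normr0 mul0r.
  apply: hoelder_rows => i.
  have [C [C0 hC]] := hreg w Nw i K 4^-1 K0 ltac:(lra) ltac:(lra).
  exists C; split => // s t As At; have := hC s t As At.
  by rewrite !BE// !mxE opprB addrA subrK.
exists B; split => //.
- move=> t t0 i; rewrite /B.
  have -> : (fun w => (\1_(~` N) w *: (W t w - W 0 w)) ord0 i) =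
      (fun w => \1_(~` N) w * (W t w ord0 i - W 0 w ord0 i)).
    by apply/funext => w; rewrite !mxE.
  apply: measurable_funM; first by apply: measurable_indic; exact: measurableC.
  by apply: measurable_funB; exact: (brownian_random_vector hW).
- by move=> w; apply: (@hoelder_within_continuous _ _ 4^-1); [lra|exact: hB].
- by move=> w; rewrite /B subrr scaler0.
- by exists N; split => // w; apply: contra_notP => Nw t; exact: BE.
Qed.

End kernel_limit.

Section fdd.
Context {R : realType} {d : nat} {dO : measure_display} {Omega : measurableType dO}
  (P : probability Omega R) (W : R -> Omega -> 'rV[R]_d) (hW : standard_brownian_motion P W)
  (beta : R) (b0 : 0 < beta) (b1 : beta < 1) (T : R) (T0 : 0 < T) (z : 'rV[R]_d).
Let a : R := (1 - beta) / 2.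

Let a0 : 0 < a. Proof. by rewrite /a; move: b1; lra. Qed.
Let a1 : a < 2^-1. Proof. by rewrite /a; move: b0; lra. Qed.
Let ab : 1 - a *+ 2 = beta. Proof. by rewrite /a; lra. Qed.

Lemma ae_XbetaE : {ae P, forall w, forall t, 0 <= t ->
  Xbeta P W z beta t w = z + Num.sqrt beta *: pathwise_integral W a t w}.
Proof.
apply: filterS (ae_wiener_process_integralE hW a0 a1) => w h t t0.
rewrite /Xbeta; case: ltP => [t1|t1]; first by rewrite h.
have -> : t = 0 by apply/eqP; rewrite eq_le t1 t0.
by rewrite pathwise_integral0 scaler0 addr0.
Qed.

Variable n : nat.
Local Notation tk k := (grid_time T n k).

(** The grid of n + 1 cells on [0, T], each cut into 2^m pieces.  The first
    k 2^m of these cells form a partition of [0, tk k], for every k at once. *)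
Definition fine_time m (l : nat) : R := T * (l%:R / (n.+1 * 2 ^ m)%:R).

Let c m (l : nat) : R := Num.sqrt beta * fine_time m l.+1 `^ (- a).

(** The variance accumulated by the weighted increments. *)
Definition clock m (l : nat) : R :=
  \sum_(j < l) c m j ^+ 2 * (fine_time m j.+1 - fine_time m j).

Lemma fine_timeS m l : fine_time m l < fine_time m l.+1.
Proof.
rewrite /fine_time ltr_pM2l// ltr_pM2r ?ltr_nat//.
Qed.

Lemma fine_time_ge0 m l : 0 <= fine_time m l.
Proof. by rewrite mulr_ge0 ?divr_ge0// ltW. Qed.

Let c_gt0 m l : 0 < c m l.
Proof.
rewrite mulr_gt0 ?sqrtr_gt0// powR_gt0//.
by rewrite (le_lt_trans (fine_time_ge0 m l))// fine_timeS.
Qed.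

Lemma clockS m l : clock m l.+1 - clock m l = c m l ^+ 2 * (fine_time m l.+1 - fine_time m l).
Proof. by rewrite /clock big_ord_recr/= addrAC subrr add0r. Qed.

Lemma clock_lt m l : clock m l < clock m l.+1.
Proof.
by rewrite -subr_gt0 clockS mulr_gt0 ?exprn_gt0// subr_gt0 fine_timeS.
Qed.

Lemma fine_time_grid m k l : (0 < k)%N ->
  fine_time m l = tk k * (l%:R / (k * 2 ^ m)%:R).
Proof.
move=> k0; rewrite /fine_time /grid_time !natrM.
have h1 : n.+1%:R != 0 :> R by rewrite pnatr_eq0.
have h2 : k%:R != 0 :> R by rewrite pnatr_eq0 -lt0n.
have h3 : (2 ^ m)%:R != 0 :> R by rewrite pnatr_eq0 expn_eq0.
move: (n.+1%:R : R) (k%:R : R) ((2 ^ m)%:R : R) (l%:R : R) h1 h2 h3 => u v x y h1 h2 h3.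
by field; rewrite h1 h2 h3.
Qed.

Let tk_gt0 k : (0 < k)%N -> 0 < tk k.
Proof. by move=> k0; rewrite mulr_gt0// divr_gt0// ltr0n. Qed.

(** The kernel at time tk k is the product of a factor depending on tk k and
    of one depending on s, so that the same weights c serve at all times of
    the grid. *)
Lemma c_kernel m k l : (0 < k)%N ->
  tk k `^ a * c m l = Num.sqrt beta * ((k * 2 ^ m)%:R / l.+1%:R) `^ a.
Proof.
move=> k0; rewrite /c mulrCA -kernelE ?(ltW (tk_gt0 k0)) ?fine_time_ge0//.
congr (_ * _ `^ _); rewrite (fine_time_grid m _ k0) invfM mulrA mulfV ?mul1r ?invf_div//.
by rewrite gt_eqF// tk_gt0.
Qed.

Lemma clock_grid m k : (0 < k)%N ->
  clock m (k * 2 ^ m) = tk k `^ beta * ((1 - a *+ 2) * riemann_sum a (k * 2 ^ m)).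
Proof.
move=> k0; rewrite /clock /riemann_sum ab !mulr_sumr; apply: eq_bigr => l _.
have t0 := tk_gt0 k0.
have E : tk k `^ beta * tk k `^ a ^+ 2 = tk k.
  rewrite -powR_mulrn ?powR_ge0// -powRrM -powRD; last by rewrite (gt_eqF t0) implybT.
  have -> : beta + a * 2%:R = 1 by rewrite /a; lra.
  by rewrite powRr1// ltW.
have p0 : tk k `^ a ^+ 2 != 0 by rewrite expf_neq0// gt_eqF// powR_gt0.
have E2 : tk k `^ a ^+ 2 * c m l ^+ 2 = beta * (((k * 2 ^ m)%:R / l.+1%:R) `^ a) ^+ 2.
  by rewrite -exprMn c_kernel// exprMn sqr_sqrtr// ltW.
have D : fine_time m l.+1 - fine_time m l = tk k * ((k * 2 ^ m)%:R)^-1.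
  by rewrite !(fine_time_grid m _ k0) -mulrBr -mulrBl -natrB// subSnn mul1r.
apply: (mulfI p0); rewrite D [LHS]mulrA E2 -[in LHS]E.
move: (tk k `^ beta) (tk k `^ a) ((k * 2 ^ m)%:R^-1 : R) (_ `^ a) => u v x y; ring.
Qed.

(** The limit is beta times the integral of s^(beta - 1) over [0, tk k]. *)
Lemma clock_grid_cvg k : (0 < k)%N ->
  clock m (k * 2 ^ m) @[m --> \oo] --> tk k `^ beta.
Proof.
move=> k0; rewrite -[tk k `^ beta]mulr1.
have -> : (fun m => clock m (k * 2 ^ m)) =
    (fun m => tk k `^ beta * ((1 - a *+ 2) * riemann_sum a (k * 2 ^ m))).
  by apply/funext => m; exact: clock_grid.
apply: cvgM; first exact: cvg_cst.
apply: (@cvg_comp _ _ _ (fun m => k * 2 ^ m)%N (fun N => (1 - a *+ 2) * riemann_sum a N) _ \oo).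
  move=> A [m0 _ hn]; exists m0 => // m /= nm; apply: hn => /=.
  by rewrite (leq_trans nm)// (leq_trans (ltnW (ltn_expl _ (ltnSn 1))))// leq_pmull.
exact: riemann_sum_cvg.
Qed.

Local Notation Nm m := (n.+1 * 2 ^ m)%N.

Definition sums_at_grid m (y : 'I_(Nm m) * 'I_d -> R) (ki : 'I_n.+2 * 'I_d) : R :=
  z ord0 ki.2 + tk ki.1 `^ a * \sum_(l < Nm m | (l < ki.1 * 2 ^ m)%N) y (l, ki.2).

Definition scaled_increments m w (li : 'I_(Nm m) * 'I_d) : R :=
  c m li.1 * (W (fine_time m li.1.+1) w ord0 li.2 - W (fine_time m li.1) w ord0 li.2).

(** The factor 1 gives this family the form of [scaled_increments], with
    constant weights. *)
Definition clock_increments m w (li : 'I_(Nm m) * 'I_d) : R :=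
  1 * (W (clock m li.1.+1) w ord0 li.2 - W (clock m li.1) w ord0 li.2).

Lemma sums_at_gridE m (F : nat -> 'I_d -> R) ki :
  sums_at_grid (fun li : 'I_(Nm m) * 'I_d => F li.1 li.2) ki =
  z ord0 ki.2 + tk ki.1 `^ a * \sum_(l < ki.1 * 2 ^ m) F l ki.2.
Proof.
rewrite /sums_at_grid; congr (_ + _ * _).
have h : (ki.1 * 2 ^ m <= Nm m)%N by rewrite leq_mul2r -ltnS ltn_ord orbT.
by rewrite (big_ord_widen _ (fun l => F l ki.2) h).
Qed.

Lemma sums_scaled_incrementsE m w ki :
  sums_at_grid (scaled_increments (m := m) w) ki =
  z ord0 ki.2 + Num.sqrt beta * wsum a (ki.1 * 2 ^ m) (fun u => W (tk ki.1 * u) w ord0 ki.2).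
Proof.
rewrite (@sums_at_gridE m (fun l i => c m l * (W (fine_time m l.+1) w ord0 i - W (fine_time m l) w ord0 i))).
congr (_ + _); have [k0|k0] := posnP ki.1.
  by rewrite /wsum k0 mul0n !big_ord0 !mulr0.
rewrite /wsum !mulr_sumr; apply: eq_bigr => l _.
by rewrite mulrA (c_kernel m _ k0) -mulrA !(fine_time_grid m _ k0).
Qed.

Lemma sums_clock_incrementsE m w ki :
  sums_at_grid (clock_increments (m := m) w) ki =
  z ord0 ki.2 + tk ki.1 `^ a * (W (clock m (ki.1 * 2 ^ m)) w ord0 ki.2 - W 0 w ord0 ki.2).
Proof.
rewrite (@sums_at_gridE m (fun l i => 1 * (W (clock m l.+1) w ord0 i - W (clock m l) w ord0 i))).
congr (_ + _ * _); under eq_bigr do rewrite mul1r.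
rewrite -(big_mkord xpredT (fun l => W (clock m l.+1) w ord0 ki.2 - W (clock m l) w ord0 ki.2)).
by rewrite telescope_sumr// /clock big_ord0.
Qed.

(** Both families consist of independent centred normal variables, with the
    same variances by the choice of the clock. *)
Lemma increments_same_law m (B : 'I_(Nm m) * 'I_d -> set R) : (forall li, measurable (B li)) ->
  P [set w | forall li, B li (scaled_increments w li)] =
  P [set w | forall li, B li (clock_increments w li)].
Proof.
move=> mB.
rewrite (increments_box hW (fine_time_ge0 m 0) (fun l _ => fine_timeS m l) (c_gt0 m) mB).
rewrite (@increments_box _ _ _ _ P W hW _ (clock m) (fun=> 1) B _ (fun l _ => clock_lt m l) (fun=> ltr01) mB).
  apply: eq_bigr => l _; apply: eq_bigr => i _; congr (normal_prob _ _ _).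
  by rewrite clockS mul1r sqrtrM ?sqr_ge0// sqrtr_sqr ger0_norm// ltW.
by rewrite /clock big_ord0.
Qed.

Lemma seq_continuous_sums m (G : ('I_n.+2 * 'I_d -> R) -> R) : seq_continuous G ->
  seq_continuous (fun y : 'I_(Nm m) * 'I_d -> R => G (sums_at_grid y)).
Proof.
move=> cG y l yl; apply: cG => ki; rewrite /sums_at_grid.
apply: cvgD; first exact: cvg_cst.
apply: cvgM; first exact: cvg_cst.
rewrite big_mkcond; under eq_fun do rewrite big_mkcond.
by apply: cvg_sum => j; case: ifP => _; [exact: yl|exact: cvg_cst].
Qed.

(** The two families of increments have the same law, and the same function of
    them tends to the values of X^beta on the grid in one case and to those of
    the time-changed Brownian motion in the other. *)
Lemma grid_law_eq (B : R -> Omega -> 'rV[R]_d) (G : ('I_n.+2 * 'I_d -> R) -> R) M :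
  (forall w, {within `[0, +oo[, continuous (fun t => B t w)}) ->
  {ae P, forall w, forall t, B t w = W t w - W 0 w} ->
  seq_continuous G -> (forall y, `|G y| <= M) ->
  (\int[P]_w (G (grid_values T (Xbeta P W z beta) w))%:E =
   \int[P]_w (G (grid_values T (fun t w => z + t `^ a *: B (t `^ beta) w) w))%:E)%E.
Proof.
move=> cB aeB cG GM.
have mW s i : 0 <= s -> measurable_fun setT (fun w => W s w ord0 i).
  by move=> s0; exact: (brownian_random_vector hW s0).
have clock0 m l : 0 <= clock m l.
  by apply: sumr_ge0 => j _; rewrite mulr_ge0 ?sqr_ge0// subr_ge0 ltW// fine_timeS.
have mS m li : measurable_fun setT (fun w => scaled_increments (m := m) w li).
  by apply: measurable_funM => //; apply: measurable_funB; apply: mW; exact: fine_time_ge0.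
have mC m li : measurable_fun setT (fun w => clock_increments (m := m) w li).
  by apply: measurable_funM => //; apply: measurable_funB; apply: mW; exact: clock0.
have cS : (\int[P]_w (G (sums_at_grid (scaled_increments (m := m) w)))%:E @[m --> \oo] -->
    \int[P]_w (G (grid_values T (Xbeta P W z beta) w))%:E)%E.
  apply: (@bounded_cvg_integral _ _ _ P (fun m w => G (sums_at_grid (scaled_increments (m := m) w))) _ M).
  - move=> m; apply: (@measurable_seq_continuous R _ _ Omega P (fun y => G (sums_at_grid y)) (@scaled_increments m)).
      exact: seq_continuous_sums.
    exact: mS.
  - by move=> m w; exact: GM.
  have : {ae P, forall w, forall k : 'I_n.+2, (0 < k)%N -> forall i,
      wsum a (k * 2 ^ m) (fun u => W (tk k * u) w ord0 i) @[m --> \oo] --> pathwise_integral W a (tk k) w ord0 i}.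
    apply: filter_forall => k; have [k0|k0] := posnP k.
      by apply: nearW => w; rewrite k0.
    by apply: filterS (kernel_wsum_ae_cvg hW a0 a1 (tk_gt0 k0) k0) => w h _.
  apply: filterS2 ae_XbetaE => w hX h; apply: cG => ki.
  under eq_fun do rewrite sums_scaled_incrementsE.
  rewrite /grid_values hX; last by rewrite mulr_ge0 ?divr_ge0// ltW.
  rewrite !mxE; apply: cvgD; first exact: cvg_cst.
  apply: cvgM; first exact: cvg_cst.
  have [k0|k0] := posnP ki.1; last by have := h ki.1 k0 ki.2; rewrite mxE.
  have -> : (fun m => wsum a (ki.1 * 2 ^ m) (fun u => W (tk ki.1 * u) w ord0 ki.2)) = cst 0.
    by apply/funext => m; rewrite /wsum k0 mul0n big_ord0.
  have := @pathwise_integral0 _ _ _ _ W a w => /rowP/(_ ki.2); rewrite !mxE => hJ0.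
  have -> : tk ki.1 = 0 by rewrite /grid_time k0 mul0r mulr0.
  by rewrite hJ0; exact: cvg_cst.
have cC : (\int[P]_w (G (sums_at_grid (clock_increments (m := m) w)))%:E @[m --> \oo] -->
    \int[P]_w (G (grid_values T (fun t w => z + t `^ a *: B (t `^ beta) w) w))%:E)%E.
  apply: (@bounded_cvg_integral _ _ _ P (fun m w => G (sums_at_grid (clock_increments (m := m) w))) _ M).
  - move=> m; apply: (@measurable_seq_continuous R _ _ Omega P (fun y => G (sums_at_grid y)) (@clock_increments m)).
      exact: seq_continuous_sums.
    exact: mC.
  - by move=> m w; exact: GM.
  apply: filterS aeB => w hB; apply: cG => ki.
  under eq_fun do rewrite sums_clock_incrementsE.
  rewrite /grid_values !mxE; apply: cvgD; first exact: cvg_cst.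
  have [k0|k0] := posnP ki.1.
    have -> : tk ki.1 = 0 by rewrite /grid_time k0 mul0r mulr0.
    rewrite powR0 ?gt_eqF// mul0r; under eq_fun do rewrite mul0r.
    exact: cvg_cst.
  apply: cvgM; first exact: cvg_cst.
  have -> : (fun m => W (clock m (ki.1 * 2 ^ m)) w ord0 ki.2 - W 0 w ord0 ki.2) =
      (fun m => B (clock m (ki.1 * 2 ^ m)) w ord0 ki.2).
    by apply/funext => m; rewrite hB !mxE.
  apply: (@within_continuous_cvg R R `[0, +oo[ (fun t => B t w ord0 ki.2) \oo _
    (fun m => clock m (ki.1 * 2 ^ m)) (tk ki.1 `^ beta)).
  - exact: within_continuous_coord.
  - by rewrite /= in_itv/= powR_ge0.
  - by move=> m; rewrite /= in_itv/= andbT.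
  - exact: clock_grid_cvg.
apply: (cvg_unique _ cS); first exact: ereal_hausdorff.
have -> : (fun m => \int[P]_w (G (sums_at_grid (scaled_increments (m := m) w)))%:E)%E =
  (fun m => \int[P]_w (G (sums_at_grid (clock_increments (m := m) w)))%:E)%E; last exact: cC.
apply/funext => m; apply: (law_eq (mS m) (mC m) (G := fun y => G (sums_at_grid y)) (M := M)).
- by move=> D mD; exact: increments_same_law.
- exact: seq_continuous_sums.
- by move=> y; exact: GM.
Qed.

End fdd.

(** * Uniform convergence of the rescaled paths *)

Section limit_paths.
Context {R : realType} {d : nat}.
Implicit Types (b : R -> 'rV[R]_d).

Definition rescaled (z : 'rV[R]_d) b (beta t : R) : 'rV[R]_d :=
  z + t `^ ((1 - beta) / 2) *: b (t `^ beta).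

Lemma within_continuousDZ (A : set R) (z : 'rV[R]_d) (f : R -> R) (x : R -> 'rV[R]_d) :
  {within A, continuous f} -> {within A, continuous x} ->
  {within A, continuous (fun t => z + f t *: x t)}.
Proof.
move=> /subspace_continuousP cf /subspace_continuousP cx; apply/subspace_continuousP => t At.
apply: cvgD; first exact: cvg_cst.
by apply: cvgZ; [exact: cf|exact: cx].
Qed.

Lemma powR_within_continuous g : 0 < g -> g <= 1 ->
  {within `[0, +oo[, continuous (fun t : R => t `^ g)}.
Proof.
move=> g0 g1; apply: (@hoelder_within_continuous R R g) => // K K0.
exists 1; split => // s t; rewrite /= !in_itv/= => /andP[s0 _] /andP[t0 _].
by rewrite mul1r powR_hoelder// (ltW g0).
Qed.

Lemma rescaled_continuous (z : 'rV[R]_d) b beta T :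
  (forall K, 0 < K -> exists C, 0 <= C /\
     forall s t, `[0, K]%classic s -> `[0, K]%classic t -> `|b t - b s| <= C * `|t - s| `^ 4^-1) ->
  0 < beta -> beta < 1 -> path_space T (rescaled z b beta).
Proof.
move=> hb b0 b1.
suff h : {within `[0, +oo[, continuous (rescaled z b beta)}.
  by apply: continuous_subspaceW h; apply: subset_itvl; rewrite bnd_simp.
apply: within_continuousDZ; first by apply: powR_within_continuous; lra.
apply: (@hoelder_within_continuous R _ (beta * 4^-1)); first by rewrite mulr_gt0.
move=> K K0; have [C [C0 hC]] := hb (K `^ beta) (powR_gt0 _ K0).
exists C; split => // s t; rewrite /= !in_itv/= => /andP[s0 sK] /andP[t0 tK].
have mono x : 0 <= x -> x <= K -> x `^ beta <= K `^ beta.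
  by move=> x0 xK; rewrite ge0_ler_powR ?nnegrE ?(ltW b0) ?(ltW K0).
apply: (le_trans (hC _ _ _ _)); rewrite /= ?in_itv/= ?powR_ge0/= ?mono//.
rewrite ler_wpM2l// powRrM ge0_ler_powR ?nnegrE ?powR_ge0//.
by apply: powR_hoelder => //; rewrite (ltW b0) (ltW b1).
Qed.

Lemma powR_exponent_cvg (x : R) (u : nat -> R) l : 0 < x -> u n @[n --> \oo] --> l ->
  x `^ (u n) @[n --> \oo] --> x `^ l.
Proof.
move=> x0 ul; rewrite /powR (gt_eqF x0).
apply: (@cvg_comp _ _ _ (fun n => u n * ln x) expR _ (nbhs (l * ln x))).
  by apply: cvgM; [exact: ul|exact: cvg_cst].
exact: continuous_expR.
Qed.

(** Monotonicity in y reduces the distance of y^p to 1, uniformly over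
    [x, K], to the end points. *)
Lemma powR_dist1 (x y K p : R) : 0 < x -> x <= y -> y <= K -> 0 <= p ->
  `|y `^ p - 1| <= `|x `^ p - 1| + `|K `^ p - 1|.
Proof.
move=> x0 xy yK p0; have y0 : 0 < y := lt_le_trans x0 xy.
have K0 : 0 < K := lt_le_trans y0 yK.
have h1 : x `^ p <= y `^ p by rewrite ge0_ler_powR ?nnegrE ?(ltW x0) ?(ltW y0).
have h2 : y `^ p <= K `^ p by rewrite ge0_ler_powR ?nnegrE ?(ltW y0) ?(ltW K0).
have [h|h] := leP 1 (y `^ p).
  rewrite ger0_norm ?subr_ge0//.
  by have := normr_ge0 (x `^ p - 1); have := ler_norm (K `^ p - 1); lra.
rewrite ler0_norm ?subr_le0 ?(ltW h)//.
by have := normr_ge0 (K `^ p - 1); have := ler_norm (- (x `^ p - 1)); rewrite normrN; lra.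
Qed.

(** On [0, del] both paths are small, because every exponent of t is at least
    1/4 as soon as beta <= 1/2.  On [del, T], t^beta tends to 1 uniformly, and b is Hoelder. *)
Lemma rescaled_cvg (z : 'rV[R]_d) b T (u : nat -> R) : 0 < T -> b 0 = 0 ->
  (forall K, 0 < K -> exists C, 0 <= C /\
     forall s t, `[0, K]%classic s -> `[0, K]%classic t -> `|b t - b s| <= C * `|t - s| `^ 4^-1) ->
  (forall n, 0 < u n) -> u n @[n --> \oo] --> (0 : R) ->
  forall e, 0 < e -> \forall n \near \oo, forall t, `[0, T]%classic t ->
    `|rescaled z b (u n) t - (z + Num.sqrt t *: b 1)| <= e.
Proof.
move=> T0 b00 hb u0 ucv e e0.
(* S bounds all times t^(u n) and all factors t^p with 0 <= p <= 1. *)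
pose S := Num.max 1 T; have S1 : 1 <= S by rewrite /S le_max lexx.
have TS : T <= S by rewrite /S le_max lexx orbT.
have S0 : 0 < S by apply: lt_le_trans S1.
have [C [C0 hC]] := hb S S0.
pose L := C * S `^ 4^-1; have L0 : 0 <= L by rewrite mulr_ge0// powR_ge0.
have bL r : 0 <= r -> r <= S -> `|b r| <= L.
  move=> r0 rS; rewrite -[b r]subr0 -b00; apply: (le_trans (hC 0 r _ _)).
  - by rewrite /= in_itv/= lexx (ltW S0).
  - by rewrite /= in_itv/= r0.
  rewrite subr0 ger0_norm// ler_wpM2l// ge0_ler_powR ?nnegrE ?(ltW S0)//; lra.
have powS r p : 0 <= r -> r <= S -> 0 <= p -> p <= 1 -> r `^ p <= S.
  move=> r0 rS p0 p1; apply: (@le_trans _ _ (S `^ p)).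
    by rewrite ge0_ler_powR ?nnegrE ?(ltW S0).
  by rewrite ler1_powR.
(* Chosen so that 2 L del^(1/4) <= e, which bounds the two paths on [0, del]. *)
pose del := Num.min 1 ((e / (2 * (L + 1))) ^+ 4).
have L1 : 0 < 2 * (L + 1) by rewrite mulr_gt0// ltr_wpDl.
have d0 : 0 < del by rewrite lt_min ltr01 exprn_gt0// divr_gt0.
have d1 : del <= 1 by rewrite ge_min lexx.
have dL : del `^ 4^-1 * L + del `^ 4^-1 * L <= e.
  have h : del `^ 4^-1 <= e / (2 * (L + 1)).
    have -> : e / (2 * (L + 1)) = ((e / (2 * (L + 1))) ^+ 4) `^ 4^-1.
      by rewrite -powR_mulrn ?divr_ge0 ?(ltW e0) ?(ltW L1)// -powRrM mulfV ?powRr1 ?divr_ge0 ?(ltW e0) ?(ltW L1)// pnatr_eq0.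
    rewrite ge0_ler_powR ?nnegrE ?invr_ge0 ?(ltW d0)//.
      by rewrite exprn_ge0// divr_ge0 ?(ltW e0) ?(ltW L1).
    by rewrite /del ge_min lexx orbT.
  have L2 : 0 <= 2 * L by rewrite mulr_ge0.
  have -> : del `^ 4^-1 * L + del `^ 4^-1 * L = del `^ 4^-1 * (2 * L) by ring.
  apply: (le_trans (ler_wpM2r L2 h)).
  rewrite mulrAC ler_pdivrMr// ler_wpM2l ?(ltW e0)// ler_wpM2l// lerDl//.
have c1 (x : R) : 0 < x -> `|x `^ (u n) - 1| @[n --> \oo] --> (0 : R).
  move=> x0; rewrite -[X in _ --> X](normr0 R) -[X in `|X|](subrr 1).
  apply: cvg_norm; apply: cvgB; last exact: cvg_cst.
  by rewrite -[X in _ --> X](powRr0 x); exact: powR_exponent_cvg.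
have c2 (x : R) : 0 < x -> `|x `^ (u n / 2) - 1| @[n --> \oo] --> (0 : R).
  move=> x0; rewrite -[X in _ --> X](normr0 R) -[X in `|X|](subrr 1).
  apply: cvg_norm; apply: cvgB; last exact: cvg_cst.
  rewrite -[X in _ --> X](powRr0 x); apply: powR_exponent_cvg => //.
  by rewrite -[X in _ --> X](mul0r 2^-1); apply: cvgM => //; exact: cvg_cst.
(* Bounds, on [del, T], for |t^(u n) - 1| and for |t^(u n / 2) - 1|. *)
pose al n := `|del `^ (u n) - 1| + `|T `^ (u n) - 1|.
pose be n := `|del `^ (u n / 2) - 1| + `|T `^ (u n / 2) - 1|.
have cal : al n @[n --> \oo] --> (0 : R).
  by rewrite -[X in _ --> X](addr0 0); apply: cvgD; exact: c1.
have cbe : be n @[n --> \oo] --> (0 : R).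
  by rewrite -[X in _ --> X](addr0 0); apply: cvgD; exact: c2.
have ctot : S * (C * (al n) `^ 4^-1) + S * be n * L @[n --> \oo] --> (0 : R).
  rewrite -[X in _ --> X](addr0 0); apply: cvgD.
    rewrite -[X in _ --> X](mulr0 S); apply: cvgM; first exact: cvg_cst.
    rewrite -[X in _ --> X](mulr0 C); apply: cvgM; first exact: cvg_cst.
    have -> : (0 : R) = 0 `^ 4^-1 by rewrite powR0.
    apply: (@within_continuous_cvg R R `[0, +oo[ (fun t => t `^ 4^-1) \oo _ al 0) => //.
    - by apply: powR_within_continuous; lra.
    - by rewrite /= in_itv/= lexx.
    - by move=> n; rewrite /= in_itv/= andbT addr_ge0.
  rewrite -[X in _ --> X](mul0r L); apply: cvgM; last exact: cvg_cst.
  by rewrite -[X in _ --> X](mulr0 S); apply: cvgM => //; exact: cvg_cst.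
near=> n => t; rewrite /= in_itv/= => /andP[t0 tT].
have tS : t <= S := le_trans tT TS.
have un1 : u n <= 2^-1.
  near: n; move/cvgrPdist_le : ucv => /(_ 2^-1 ltac:(lra)); apply: filterS => n.
  by rewrite sub0r normrN; apply: le_trans; exact: ler_norm.
have un0 := ltW (u0 n).
have htot : S * (C * (al n) `^ 4^-1) + S * be n * L <= e.
  near: n; move/cvgrPdist_le : ctot => /(_ _ e0); apply: filterS => n.
  by rewrite sub0r normrN; apply: le_trans; exact: ler_norm.
have tuS : t `^ (u n) <= S by apply: powS => //; lra.
rewrite /rescaled opprD addrACA subrr add0r -powR12_sqrt//.
have [td|td] := leP t del.
  apply: (le_trans (ler_normB _ _)); apply: (le_trans _ dL).
  have small p : 4^-1 <= p -> t `^ p <= del `^ 4^-1.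
    move=> p4; have p0 : 0 < p by lra.
    apply: (@le_trans _ _ (del `^ p)).
      by rewrite ge0_ler_powR ?nnegrE ?(ltW d0) ?(ltW p0).
    by apply: ger_powR => //; rewrite d0.
  rewrite !normrZ !ger0_norm ?powR_ge0//; apply: lerD; apply: ler_pM => //; rewrite ?powR_ge0 ?small ?bL ?powR_ge0//; lra.
have tp : 0 < t := lt_trans d0 td.
have -> : t `^ ((1 - u n) / 2) *: b (t `^ u n) - t `^ 2^-1 *: b 1 =
  t `^ ((1 - u n) / 2) *: (b (t `^ u n) - b 1) + (t `^ ((1 - u n) / 2) - t `^ 2^-1) *: b 1.
  by rewrite scalerBr scalerBl addrA subrK.
apply: (le_trans (ler_normD _ _)); apply: le_trans htot; rewrite !normrZ.
have ta : t `^ ((1 - u n) / 2) <= S by apply: powS => //; lra.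
apply: lerD.
  rewrite ger0_norm ?powR_ge0//; apply: ler_pM => //; first exact: powR_ge0.
  apply: (le_trans (hC _ _ _ _)).
  - by rewrite /= in_itv/= ler01.
  - by rewrite /= in_itv/= powR_ge0.
  rewrite ler_wpM2l// ge0_ler_powR ?nnegrE ?addr_ge0//.
  by apply: powR_dist1 => //; exact: ltW.
have -> : t `^ ((1 - u n) / 2) - t `^ 2^-1 = - (t `^ ((1 - u n) / 2) * (t `^ (u n / 2) - 1)).
  rewrite mulrBr mulr1 -powRD; last by rewrite (gt_eqF tp) implybT.
  by rewrite opprB; congr (_ - t `^ _); lra.
rewrite normrN normrM [`|t `^ _|]ger0_norm ?powR_ge0//.
apply: ler_pM => //; [by rewrite mulr_ge0 ?powR_ge0| |by apply: bL].
apply: ler_pM => //; first exact: powR_ge0.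
apply: powR_dist1 => //; [exact: ltW|lra].
Unshelve. all: by end_near. Qed.

End limit_paths.

(** * Hoelder regularity and convergence in distribution *)

Section limit_law.
Context {R : realType} {d : nat} {dO : measure_display} {Omega : measurableType dO}
  (P : probability Omega R) (W : R -> Omega -> 'rV[R]_d) (hW : standard_brownian_motion P W)
  (z : 'rV[R]_d).

Section fixed_beta.
Variables (beta : R) (b0 : 0 < beta) (b1 : beta < 1).
Let a : R := (1 - beta) / 2.
Let a0 : 0 < a. Proof. by rewrite /a; move: b1; lra. Qed.
Let a1 : a < 2^-1. Proof. by rewrite /a; move: b0; lra. Qed.

Lemma Xbeta_random_vector t : random_vector (Xbeta P W z beta t).
Proof.
move=> i; rewrite /Xbeta; have [t1|t1] := ltP 0 t; last exact: measurable_cst.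
have [/(_ t t1 i)[_ mI _] _] := wiener_process_integralP hW a0 a1.
rewrite (_ : (fun w => _) = fun w => z ord0 i + Num.sqrt beta *
    wiener_process_integral P W (fun t s => (t / s) `^ a) t w ord0 i); last first.
  by apply/funext => w; rewrite !mxE.
apply: measurable_funD; first exact: measurable_cst.
by apply: measurable_funM; first exact: measurable_cst.
Qed.

Lemma ae_path_space_Xbeta T : {ae P, forall w, path_space T (fun t => Xbeta P W z beta t w)}.
Proof.
apply: filterS2 (ae_XbetaE hW b0 b1 z) (ae_regular_path hW) => w hX hw.
have h : {within `[0, T], continuous (fun t => z + Num.sqrt beta *: pathwise_integral W a t w)}.
  apply: within_continuousDZ; first by move=> t; exact: cst_continuous.
  apply: continuous_subspaceW (pathwise_integral_continuous a0 a1 hw).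
  by apply: subset_itvl; rewrite bnd_simp.
apply: subspace_eq_continuous h => t /set_mem; rewrite /= in_itv/= => /andP[t0 _].
by rewrite /from_subspace /= hX.
Qed.

Lemma ae_Xbeta_hoelder : {ae P, forall w, holder_half_minus (fun t => Xbeta P W z beta t w)}.
Proof.
apply: filterS2 (ae_XbetaE hW b0 b1 z) (ae_regular_path hW) => w hX hw T T0 al al0 al1.
have [g [ag alg g1]] : exists g : R, [/\ a < g, al <= g & g < 2^-1].
  (* The pathwise integral is Hoelder only for exponents above a; smaller ones
      follow because [0, T] is bounded. *)
  exists (Num.max al ((a + 2^-1) / 2)); rewrite lt_max le_max lexx gt_max; split => //.
  - by apply/orP; right; move: a1; lra.
  - by apply/andP; move: a1; split; lra.
have hJ i : exists C, 0 <= C /\ hoelder_on `[0, T] C al (fun t => pathwise_integral W a t w ord0 i).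
  have [C [C0 hC]] := pathwise_integral_hoelder a0 i hw T0 ag g1.
  exists (C * T `^ (g - al)); split; first by rewrite mulr_ge0 ?powR_ge0.
  by apply: hoelder_on_weaken => //; rewrite ?(ltW al0).
have [C [C0 hC]] := hoelder_rows hJ.
exists (Num.sqrt beta * C) => s t sT tT.
have := sT; have := tT; rewrite !in_itv/= => /andP[t0 _] /andP[s0 _].
rewrite !hX// opprD addrACA subrr add0r -scalerBr normrZ ger0_norm ?sqrtr_ge0//.
by rewrite -mulrA ler_wpM2l ?sqrtr_ge0// hC.
Qed.

End fixed_beta.

Variables (T : R) (T0 : 0 < T) (Phi : {uniform` `[0, T] -> 'rV[R]_d} -> R) (M : R).
Hypothesis cPhi : {within path_space T, continuous Phi}.
Hypothesis bPhi : forall x, path_space T x -> `|Phi x| <= M.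

Section fixed_version.
Variable B : R -> Omega -> 'rV[R]_d.
Hypothesis mB : forall t, 0 <= t -> random_vector (B t).
Hypothesis cB : forall w, {within `[0, +oo[, continuous (fun t => B t w)}.
Hypothesis hB : forall w K, 0 < K -> exists C, 0 <= C /\
  forall s t, `[0, K]%classic s -> `[0, K]%classic t -> `|B t w - B s w| <= C * `|t - s| `^ 4^-1.
Hypothesis B0 : forall w, B 0 w = 0.
Hypothesis BE : {ae P, forall w, forall t, B t w = W t w - W 0 w}.

Local Notation Xr beta := (fun t w => rescaled z (B ^~ w) beta t).

Lemma rescaled_random_vector beta t : random_vector (Xr beta t).
Proof.
move=> i; rewrite (_ : (fun w => _) = fun w => z ord0 i + t `^ ((1 - beta) / 2) * B (t `^ beta) w ord0 i); last first.
  by apply/funext => w; rewrite !mxE.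
apply: measurable_funD; first exact: measurable_cst.
apply: measurable_funM; first exact: measurable_cst.
by apply: mB; exact: powR_ge0.
Qed.

Lemma measurable_functional (X : R -> Omega -> 'rV[R]_d) :
  (forall t, `[0, T]%classic t -> random_vector (X t)) -> (forall w, path_space T (X ^~ w)) ->
  measurable_fun setT (fun w => Phi (X ^~ w)).
Proof.
move=> mX cX.
apply: (measurable_fun_cvg (h := fun n w => Phi (interp T n (assemble (grid_values (n := n) T X w))))).
  move=> n; apply: (@measurable_seq_continuous R _ _ Omega P
    (fun y => Phi (interp T n (assemble y))) (grid_values (n := n) T X)).
    exact: seq_continuous_interp.
  by move=> ki; apply: mX; exact: grid_time_itv.
move=> w _; apply: path_functional_cvg => //.
  by move=> n; exact: interp_continuous.
move=> e e0; apply: filterS (interp_cvg T0 (cX w) e0) => n h t At.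
by rewrite interp_grid_values; exact: h.
Qed.

Lemma rescaled_functional_integral beta : 0 < beta -> beta < 1 ->
  (\int[P]_w (Phi (Xbeta P W z beta ^~ w))%:E = \int[P]_w (Phi (rescaled z (B ^~ w) beta))%:E)%E.
Proof.
move=> b0 b1.
apply: (path_law_eq T0 cPhi bPhi (X := Xbeta P W z beta) (X' := Xr beta)).
- by move=> t _; exact: Xbeta_random_vector.
- by move=> t _; exact: rescaled_random_vector.
- exact: ae_path_space_Xbeta.
- by apply: nearW => w; apply: (rescaled_continuous (T := T) (z := z) (hB w) b0 b1).
- by move=> n G cG bG; exact: (grid_law_eq hW b0 b1 T0 z cB BE cG bG).
Qed.

Lemma rescaled_path_space beta w : 0 < beta -> beta < 1 ->
  path_space T (rescaled z (B ^~ w) beta).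
Proof. by move=> b0 b1; exact: (rescaled_continuous (hB w) b0 b1). Qed.

Lemma measurable_rescaled_functional beta : 0 < beta -> beta < 1 ->
  measurable_fun setT (fun w => Phi (rescaled z (B ^~ w) beta)).
Proof.
move=> b0 b1; apply: (measurable_functional (X := Xr beta)) => [t _|w].
  exact: rescaled_random_vector.
exact: rescaled_path_space.
Qed.

Lemma sqrt_path_space (v : 'rV[R]_d) : path_space T (fun t => z + Num.sqrt t *: v).
Proof.
apply: within_continuousDZ; last by move=> t; exact: cst_continuous.
by apply: continuous_in_subspaceT => t _; exact: sqrt_continuous.
Qed.

Lemma measurable_sqrt_functional :
  measurable_fun setT (fun w => Phi (fun t => z + Num.sqrt t *: B 1 w)).
Proof.
apply: (measurable_functional (X := fun t w => z + Num.sqrt t *: B 1 w)) => [t _ i|w].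
  rewrite (_ : (fun w => _) = fun w => z ord0 i + Num.sqrt t * B 1 w ord0 i); last first.
    by apply/funext => w; rewrite !mxE.
  apply: measurable_funD; first exact: measurable_cst.
  by apply: measurable_funM; [exact: measurable_cst|exact: mB].
exact: sqrt_path_space.
Qed.

(** The minimum with 1/2 keeps the exponent below 1 for every positive b, which
    makes the paths continuous along any sequence tending to 0 from the
    right. *)
Lemma fine_rescaled_cvg :
  fine (\int[P]_w (Phi (rescaled z (B ^~ w) (Num.min b 2^-1)))%:E) @[b --> 0^'+] -->
  fine (\int[P]_w (Phi (fun t => z + Num.sqrt t *: B 1 w))%:E).
Proof.
apply/cvg_at_rightP => u [u0 ucv].
pose v n := Num.min (u n) 2^-1.
have v0 n : 0 < v n by rewrite /v lt_min (u0 n) invr_gt0 ltr0n.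
have v1 n : v n < 1 by rewrite /v gt_min; apply/orP; right; lra.
have vcv : v n @[n --> \oo] --> (0 : R).
  apply: (@squeeze_cvgr _ _ _ _ (cst 0) u) => //; last exact: cvg_cst.
  by apply: nearW => n; rewrite (ltW (v0 n)) ge_min lexx.
apply: fine_cvg; rewrite fineK; last first.
  apply: (@bounded_integral_fin_num _ _ _ _ _ M); first exact: measurable_sqrt_functional.
  by move=> w; apply: bPhi; exact: sqrt_path_space.
apply: (@bounded_cvg_integral _ _ _ P (fun n w => Phi (rescaled z (B ^~ w) (v n))) _ M).
- by move=> n; exact: measurable_rescaled_functional.
- by move=> n w; apply: bPhi; exact: rescaled_path_space.
apply: nearW => w; apply: path_functional_cvg => //.
- exact: sqrt_path_space.
- by move=> n; exact: rescaled_path_space.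
- exact: (rescaled_cvg z T0 (B0 w) (hB w) v0 vcv).
Qed.

Lemma Xbeta_functional_cvg :
  (\int[P]_w (Phi (Xbeta P W z b ^~ w))%:E @[b --> 0^'+] -->
   \int[P]_w (Phi (fun t => z + Num.sqrt t *: B 1 w))%:E)%E.
Proof.
have E : \forall b \near 0^'+,
    (fine (\int[P]_w (Phi (rescaled z (B ^~ w) (Num.min b 2^-1)))%:E))%:E =
    (\int[P]_w (Phi (Xbeta P W z b ^~ w))%:E)%E.
  near=> b.
  have b0 : 0 < b by near: b; exact: nbhs_right_gt.
  have b2 : b < 2^-1 by near: b; apply: nbhs_right_lt; rewrite invr_gt0 ltr0n.
  have b1 : b < 1 by lra.
  rewrite min_l ?(ltW b2)// rescaled_functional_integral// fineK//.
  apply: (@bounded_integral_fin_num _ _ _ _ _ M); first exact: measurable_rescaled_functional.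
  by move=> w; apply: bPhi; exact: rescaled_path_space.
have fin : (\int[P]_w (Phi (fun t => z + Num.sqrt t *: B 1 w))%:E)%E \is a fin_num.
  apply: (@bounded_integral_fin_num _ _ _ _ _ M); first exact: measurable_sqrt_functional.
  by move=> w; apply: bPhi; exact: sqrt_path_space.
rewrite -(fineK fin); apply: cvg_trans; first exact: near_eq_cvg E.
by apply/fine_cvgP; split; [exact: nearW|exact: fine_rescaled_cvg].
Unshelve. all: by end_near. Qed.

(** Given the vector v, the path z + sqrt t v depends continuously on v, so
    that the equality of the laws of B 1 and eta on boxes suffices. *)
Lemma gaussian_functional_integral {dO' : measure_display} {Omega' : measurableType dO'}
    (P' : probability Omega' R) (eta : Omega' -> 'rV[R]_d) : centered_normal P' 1 eta ->
  (\int[P]_w (Phi (fun t => z + Num.sqrt t *: B 1 w))%:E =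
   \int[P']_w (Phi (fun t => Xzero eta z t w))%:E)%E.
Proof.
move=> [meta heta].
pose G (y : 'I_d -> R) := Phi (fun t => z + Num.sqrt t *: \row_i y i).
have rowE (v : 'rV[R]_d) : \row_i v ord0 i = v by apply/rowP => i; rewrite mxE.
have cG : seq_continuous G.
  move=> y l yl; apply: path_functional_cvg => //; [exact: sqrt_path_space|by move=> n; exact: sqrt_path_space|].
  move=> e e0; pose S := Num.sqrt T + 1.
  have S0 : 0 < S by rewrite ltr_wpDl ?sqrtr_ge0.
  have eS : 0 < e / S by rewrite divr_gt0.
  have h : \forall n \near \oo, forall i, `|y n i - l i| <= e / S.
    apply: filter_forall => i; move/cvgrPdist_le: (yl i) => /(_ _ eS).
    by apply: filterS => n; rewrite distrC.
  apply: filterS h => n hn t; rewrite /= in_itv/= => /andP[t0 tT].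
  rewrite opprD addrACA subrr add0r -scalerBr normrZ ger0_norm ?sqrtr_ge0//.
  have -> : e = S * (e / S) by rewrite mulrC divfK// gt_eqF.
  apply: ler_pM; rewrite ?sqrtr_ge0 ?normr_ge0//.
    by rewrite (le_trans (ler_wsqrtr tT))// lerDl.
  by apply: norm_row_le => [|i]; [exact: ltW|rewrite !mxE].
transitivity (\int[P]_w (G (fun i => B 1 w ord0 i))%:E)%E.
  by apply: eq_integral => w _; rewrite /G rowE.
rewrite (@law_eq R 'I_d _ _ _ _ P P' (fun w i => B 1 w ord0 i) (fun w i => eta w ord0 i) G M) //.
- by apply: eq_integral => w _; rewrite /G rowE.
- by move=> i; exact: mB.
- move=> D mD; rewrite heta//.
  have [_ hN] := brownian_normal_increments hW (lexx 0) ltr01.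
  rewrite subr0 sqrtr1 in hN; rewrite -hN//.
  have [N [mN N0 hBE]] := BE.
  have mS (Y : Omega -> 'rV[R]_d) : random_vector Y ->
      measurable [set w | forall i, D i (Y w ord0 i)].
    by move=> mY; apply: (@measurable_box R _ _ Omega (fun w i => Y w ord0 i)).
  have mW1 : random_vector (fun w => W 1 w - W 0 w).
    by case: (brownian_normal_increments hW (lexx 0) ltr01).
  have := @integral_null_eq R _ _ P (fun w => (\1_[set w | forall i, D i (B 1 w ord0 i)] w)%:E)
    (fun w => (\1_[set w | forall i, D i ((W 1 w - W 0 w) ord0 i)] w)%:E) N mN N0.
  rewrite !integral_indic ?setIT//; [apply|exact: mS|exact: mS (mB _)].
  move=> w Nw; have BW : B 1 w = W 1 w - W 0 w.
    by apply: contrapT => h; apply: Nw; apply: hBE => /(_ 1).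
  by rewrite !indicE; congr (nat_of_bool _)%:R%:E; apply/idP/idP; rewrite !inE /= BW.
- by move=> y; apply: bPhi; exact: sqrt_path_space.
Qed.

End fixed_version.

End limit_law.

Theorem lemma5p5 (R : realType) (d : nat) (z : 'rV[R]_d)
    (dOmega : measure_display) (Omega : measurableType dOmega) (P : probability Omega R)
    (W : R -> Omega -> 'rV[R]_d) (hW : standard_brownian_motion P W)
    (dOmega' : measure_display) (Omega' : measurableType dOmega') (P' : probability Omega' R)
    (eta : Omega' -> 'rV[R]_d) (heta : centered_normal P' 1 eta) :
  (forall beta : R, 0 < beta -> beta < 1 ->
     {ae P, forall w, holder_half_minus (fun t => Xbeta P W z beta t w)}) /\
  (forall T : R, 0 < T ->
     cvg_in_distribution_on T P (Xbeta P W z) 0^'+ P' (Xzero eta z)).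
Proof.
split=> [beta b0 b1|T T0 Phi cPhi [M bPhi]]; first exact: ae_Xbeta_hoelder.
have [B [mB cB hB B0 BE]] := regularized_brownian hW.
rewrite unlock -(gaussian_functional_integral hW z cPhi bPhi mB BE heta).
exact: (Xbeta_functional_cvg hW T0 cPhi bPhi mB cB hB B0 BE).
Qed.
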